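(* If a valued differential field $F$ is monotone and differential-henselian, then every valued differential field extension of $F$ that is algebraic over $F$ is also monotone and differential-henselian.
   Context: All differential fields have characteristic $0$ and a single distinguished derivation, written $f\mapsto f'$. A valued differential field is a differential field $F$ together with a (Krull) valuation $v:F^\times\to v(F^\times)$ whose residue field has characteristic $0$; $\mathcal{O}$ is its valuation ring and $\mathfrak{m}$ the maximal ideal of $\mathcal{O}$. $F$ is monotone if $v(f')\ge v(f)$ for all $f\in F$. If $F$ is monotone, then its derivation is small, i.e. $\mathfrak{m}'\subseteq\mathfrak{m}$, and also $\mathcal{O}'\subseteq\mathcal{O}$, so the residue field $\mathcal{O}/\mathfrak{m}$ becomes a differential field with the induced derivation. A valued differential field with small derivation is differential-henselian if every differential polynomial $P\in\mathcal{O}\{Y\}=\mathcal{O}[Y,Y',Y'',\dots]$ whose reduction $\overline{P}\in(\mathcal{O}/\mathfrak{m})\{Y\}$ has total degree $1$ has a zero in $\mathcal{O}$. *)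

(* Defs.v *)
From HB Require Import structures.
From mathcomp Require Import all_boot all_order all_algebra.
From mathcomp Require Export ring_quotient mpoly.

Set Implicit Arguments.
Unset Strict Implicit.
Unset Printing Implicit Defensive.

Import Order.TTheory GRing.Theory Num.Theory.
Local Open Scope ring_scope.

(* Totality is an axiom of the mixin rather than a join with [Order.Total]: that
   join would have to be declared below [Num.RealDomain] in the hierarchy. *)
HB.mixin Record isOrderedAbelianGroup G of Num.POrderedZmodule G := {
  oag_le_total : forall x y : G, (x <= y) || (y <= x);
  oag_leD2l : forall z x y : G, x <= y -> z + x <= z + y
}.

#[short(type="oagType")]
HB.structure Definition OrderedAbelianGroup :=
  { G of Num.POrderedZmodule G & isOrderedAbelianGroup G }.

(* [option G] stands for the value group with an element [None] = oo added on
   top, so that the valuation is total with v(0) = oo. *)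
Section ValueGroupInfinity.
Variable G : oagType.

Definition le_oo (a b : option G) : bool :=
  match a, b with
  | _, None => true
  | None, Some _ => false
  | Some x, Some y => x <= y
  end.

Definition lt_oo (a b : option G) : bool := ~~ le_oo b a.

Definition min_oo (a b : option G) : option G := if le_oo a b then a else b.

Definition add_oo (a b : option G) : option G :=
  if a is Some x then if b is Some y then Some (x + y) else None else None.

End ValueGroupInfinity.

HB.mixin Record isDifferential F of GRing.Field F := {
  der : F -> F;
  derD : {morph der : x y / x + y};
  derM : forall x y, der (x * y) = der x * y + x * der y;
  diff_pchar0 : [pchar F] =i pred0
}.

#[short(type="diffFieldType")]
HB.structure Definition DiffField := { F of GRing.Field F & isDifferential F }.

(* By [vval_surj], [G] is exactly the value group v(F^x).  The trivial
   valuation (G = 0) is allowed. *)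
HB.mixin Record isValued (G : oagType) F of GRing.Field F := {
  vval : F -> option G;
  vval_eqoo : forall x, (vval x == None) = (x == 0);
  vvalM : forall x y, vval (x * y) = add_oo (vval x) (vval y);
  vvalD : forall x y, le_oo (min_oo (vval x) (vval y)) (vval (x + y));
  vval_surj : forall g : G, exists x, vval x = Some g
}.

#[short(type="valuedFieldType")]
HB.structure Definition ValuedField (G : oagType) :=
  { F of GRing.Field F & isValued G F }.

Section ValuationRing.
Variables (G : oagType) (F : valuedFieldType G).
Local Notation v := (@vval G F).

Definition valring_pred : {pred F} := [pred x | le_oo (Some 0) (v x)].

Definition maxideal_pred : {pred F} := [pred x | lt_oo (Some 0) (v x)].

Lemma vval0 : v 0 = None.
Proof. by apply/eqP; rewrite vval_eqoo. Qed.

Lemma oag_leD (a b c e : G) : a <= b -> c <= e -> a + c <= b + e.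
Proof.
move=> ab ce; apply: (le_trans (oag_leD2l a _ _ ce)).
by rewrite [a + e]addrC [b + e]addrC; apply: oag_leD2l.
Qed.

Lemma oag_double0 (g : G) : g + g = 0 -> g = 0.
Proof.
move=> gg; case/orP: (oag_le_total 0 g) => g0; apply/le_anti.
  by rewrite g0 andbT -gg -{1}[g]addr0; apply: oag_leD2l.
by rewrite g0 /= -gg -{3}[g]addr0; apply: oag_leD2l.
Qed.

Lemma vval1 : v 1 = Some 0.
Proof.
have := vvalM (1 : F) 1; rewrite mulr1.
have := vval_eqoo (1 : F); rewrite oner_eq0.
case: (v 1) => [g|] //= _ [] /(congr1 (fun t => t - g)).
by rewrite subrr addrK => <-.
Qed.

Lemma vvalN1 : v (-1) = Some 0.
Proof.
have := vvalM (-1 : F) (-1); rewrite mulrNN mulr1 vval1.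
by case: (v (-1)) => [g|] //= [] /esym/oag_double0 ->.
Qed.

Lemma vvalN x : v (- x) = v x.
Proof.
by rewrite -mulN1r vvalM vvalN1; case: (v x) => [g|] //=; rewrite add0r.
Qed.

Lemma le_oo_trans (b a c : option G) : le_oo a b -> le_oo b c -> le_oo a c.
Proof. by case: a b c => [a|] [b|] [c|] //=; apply: le_trans. Qed.

Lemma lt_le_oo_trans (b a c : option G) : lt_oo a b -> le_oo b c -> lt_oo a c.
Proof. by move=> ab bc; apply: contra ab; apply: le_oo_trans. Qed.

Lemma valring_closed : subring_closed valring_pred.
Proof.
split; rewrite ?inE.
- by rewrite vval1 /=.
- move=> x y; rewrite !inE => x0 y0; apply: le_oo_trans (vvalD x (- y)).
  by rewrite vvalN /min_oo; case: ifP.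
- move=> x y; rewrite !inE vvalM.
  case: (v x) (v y) => [a|] [b|] //= a0 b0.
  by rewrite -[X in X <= _]addr0; apply: oag_leD.
Qed.

HB.instance Definition _ := GRing.isSubringClosed.Build F valring_pred
  valring_closed.

Record valring := ValRing { valring_val : F; _ : valring_val \in valring_pred }.

HB.instance Definition _ := [isSub for valring_val].
HB.instance Definition _ := [Choice of valring by <:].
HB.instance Definition _ := [SubChoice_isSubComNzRing of valring by <:].

(* The maximal ideal, as an ideal of the valuation ring. *)
Definition maxideal : {pred valring} := [pred x | \val x \in maxideal_pred].

Lemma maxideal_closed : idealr_closed maxideal.
Proof.
split; rewrite ?inE.
- by rewrite raddf0 vval0.
- by rewrite rmorph1 vval1 /lt_oo /= lexx.
- move=> a x y; rewrite !inE rmorphD rmorphM => x0 y0.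
  apply: lt_le_oo_trans (vvalD _ _); rewrite /min_oo; case: ifP => // _.
  apply: lt_le_oo_trans x0 _; rewrite vvalM.
  have := valP a; rewrite inE.
  case: (v (\val a)) (v (\val x)) => [s|] [t|] //= s0.
  by rewrite -[X in X <= _]add0r; apply: oag_leD.
Qed.

HB.instance Definition _ := isIdealr.Build valring maxideal maxideal_closed.

Definition residue := {ideal_quot maxideal}.

Definition res : {rmorphism valring -> residue} := \pi_residue%qT.

End ValuationRing.

HB.mixin Record hasResiduePchar0 (G : oagType) F of ValuedField G F := {
  residue_pchar0 : [pchar (residue F)] =i pred0
}.

#[short(type="valuedDiffFieldType")]
HB.structure Definition ValuedDiffField (G : oagType) :=
  { F of ValuedField G F & DiffField F & hasResiduePchar0 G F }.

Section Properties.
Variables (G : oagType) (F : valuedDiffFieldType G).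

Definition monotone_der : Prop :=
  forall f : F, le_oo (@vval G F f) (@vval G F (der f)).

Definition small_der : Prop :=
  forall f : F, f \in @maxideal_pred G F -> der f \in @maxideal_pred G F.

(* A differential polynomial over the valuation ring O involving only Y and its
   first n-1 derivatives is an element of {mpoly O[n]}, the i-th variable
   standing for the i-th derivative of Y; O{Y} is the union over all n. *)
Definition diffpoly_eval n (P : {mpoly (valring F)[n]}) (y : F) : F :=
  mmap (@valring_val G F) (fun i : 'I_n => iter i der y) P.

Definition diffpoly_reduction n (P : {mpoly (valring F)[n]}) :
  {mpoly (residue F)[n]} := map_mpoly (@res G F) P.

(* [msize] is one more than the total degree. *)
Definition diff_henselian : Prop :=
  small_der /\
  forall n (P : {mpoly (valring F)[n]}),
    msize (diffpoly_reduction P) = 2%N ->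
    exists y : valring F, diffpoly_eval P (\val y) = 0.

End Properties.

(* [ext_vgrp] is the inclusion of value groups under which the valuation of L
   extends that of F. *)
Record vdf_extension (G H : oagType) (F : valuedDiffFieldType G)
    (L : valuedDiffFieldType H) := VdfExtension {
  ext_map :> {rmorphism F -> L};
  ext_vgrp : {additive G -> H};
  ext_vgrp_le : {mono ext_vgrp : x y / x <= y};
  ext_der : forall x, ext_map (der x) = der (ext_map x);
  ext_vval : forall x : F, @vval H L (ext_map x) = omap ext_vgrp (@vval G F x)
}.

(* Main.v *)
(** Write x ≼ y for v x >= v y and work with differential subfields K of L.

    By induction on degrees it suffices to treat suitable simple extensions
    K1 = K(theta) inside L. Given alpha outside K, translate it so that its trace
    vanishes; since minimal polynomials of infinitesimals have infinitesimal lower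
    coefficients, alpha is then not asymptotic to an element of K. A Newton
    iteration in K[u] produces theta in K(alpha), not in K, such that either
    theta is a unit whose powers have K-independent residues, or theta^p lies in K
    for a prime p and its smaller powers lie in distinct classes modulo v(K).
    In both cases the powers of theta form a valuation basis and theta' ≼ theta, so
    that K1 is monotone.

    For differential henselianity of K1, let P be quasilinear over K1. Linear
    operators A over K1 with integral coefficients, one of them a unit, satisfy
    A(w) = b for some w ≼ b: some product A B has, up to a factor, coefficients
    in K. Hence Newton's method squares residuals P(y), and if P has no zero, the
    set D of attained residuals is closed under products up to domination. Passing
    to coordinates with respect to theta, the approximate solutions become
    approximate solutions of a system over K, with error below each d in D. An
    ultraproduct argument over K, where residues can be lifted, turns them into a
    solution with error below all of D at once; this error would itself belong to
    D, and so would be dominated by its square, a contradiction. *)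

From HB Require Import structures.
Require Import Defs.
From mathcomp Require Import all_boot all_order all_algebra.
From mathcomp Require Import boolp.
From mathcomp Require filter.
From mathcomp Require Import ring zify.

Set Implicit Arguments.
Unset Strict Implicit.
Unset Printing Implicit Defensive.

Import Order.TTheory GRing.Theory.
Local Open Scope ring_scope.

(** Two obstacles shape the argument. [L] need not be complete, so Newton's method over K1 squares
    residuals but its iterates have no limit; and differential henselianity of K concerns one
    equation in one unknown, whereas coordinates over K produce systems in several unknowns. Call an
    element infinitesimal if it lies below all of D. A differential subring E of the integral
    elements of K on which infinitesimals vanish can be enlarged to meet the class, modulo
    infinitesimals, of any integral element of K; this takes one equation in one unknown, a minimal
    one for that element. Differential polynomials over E that are infinitesimal at points of E then
    vanish there, whatever their number. An approximate solution with error below a single d does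
    not suffice for this, but the diagonal family of approximate solutions has infinitesimal error
    in an ultraproduct along D. So the solutions are lifted there, after the constants of the system
    have been lifted in K. Residue characteristic 0 enters through integers being units: in
    separants, in the trace divided by the degree, and in p-th roots of 1 + eps. *)

Section Domination.
Variables (H : oagType) (L : valuedFieldType H).

(* [x ≼ y] means v x >= v y: the larger element has the smaller valuation. *)
Definition vle (x y : L) : bool := le_oo (vval y) (vval x).
Definition vlt (x y : L) : bool := ~~ vle y x.

End Domination.

Notation "x ≼ y" := (vle x y) (at level 70, no associativity) : ring_scope.
Notation "x ≺ y" := (vlt x y) (at level 70, no associativity) : ring_scope.

(** * Calculus of dominance *)

Section DominationTheory.
Variables (H : oagType) (L : valuedFieldType H).
Implicit Types x y z w : L.

Lemma le_oo_total (a b : option H) : le_oo a b || le_oo b a.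
Proof. by case: a b => [a|] [b|] //=; apply: oag_le_total. Qed.

Lemma vle_refl x : x ≼ x.
Proof. by have := le_oo_total (vval x) (vval x); rewrite orbb. Qed.
Hint Resolve vle_refl : core.

Lemma vle_trans y x z : x ≼ y -> y ≼ z -> x ≼ z.
Proof. by move=> xy yz; apply: le_oo_trans yz xy. Qed.

Lemma vle_total x y : (x ≼ y) || (y ≼ x).
Proof. exact: le_oo_total. Qed.

Lemma vlt_le x y : x ≺ y -> x ≼ y.
Proof. by rewrite /vlt; have := vle_total x y; case: (x ≼ y) => //= ->. Qed.

Lemma vlt_irr x : (x ≺ x) = false.
Proof. by rewrite /vlt vle_refl. Qed.

Lemma vnlt x y : ~~ (x ≺ y) = (y ≼ x).
Proof. by rewrite /vlt negbK. Qed.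

Lemma vltP x y : reflect (~ y ≼ x) (x ≺ y).
Proof. exact: negP. Qed.

Lemma vle_lt_trans y x z : x ≼ y -> y ≺ z -> x ≺ z.
Proof. by move=> xy; apply: contra => zx; apply: vle_trans zx xy. Qed.

Lemma vlt_le_trans y x z : x ≺ y -> y ≼ z -> x ≺ z.
Proof. by move=> xy yz; apply: contra xy; apply: vle_trans. Qed.

Lemma v0le x : 0 ≼ x.
Proof. by rewrite /vle vval0; case: (vval x). Qed.
Hint Resolve v0le : core.

Lemma vle0 x : (x ≼ 0) = (x == 0).
Proof. by rewrite /vle vval0 -vval_eqoo; case: (vval x). Qed.

Lemma v0lt x : (0 ≺ x) = (x != 0).
Proof. by rewrite /vlt vle0. Qed.

Lemma vlt0 x : (x ≺ 0) = false.
Proof. by rewrite /vlt v0le. Qed.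

Lemma vlt_neq0 x y : x ≺ y -> y != 0.
Proof. by rewrite -v0lt; apply: vle_lt_trans. Qed.

Lemma vle_neq0 x y : x ≼ y -> x != 0 -> y != 0.
Proof. by move=> xy; apply: contraNneq => y0; rewrite -vle0 -y0. Qed.

Lemma vleN x y : (- x ≼ y) = (x ≼ y).
Proof. by rewrite /vle vvalN. Qed.

Lemma vleNr x y : (x ≼ - y) = (x ≼ y).
Proof. by rewrite /vle vvalN. Qed.

Lemma vltN x y : (- x ≺ y) = (x ≺ y).
Proof. by rewrite /vlt vleNr. Qed.

Lemma vleD z x y : x ≼ z -> y ≼ z -> x + y ≼ z.
Proof.
rewrite /vle => xz yz; apply: le_oo_trans (vvalD x y).
by rewrite /min_oo; case: ifP.
Qed.

Lemma vleB z x y : x ≼ z -> y ≼ z -> x - y ≼ z.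
Proof. by move=> xz yz; apply: vleD => //; rewrite vleN. Qed.

Lemma vltD z x y : x ≺ z -> y ≺ z -> x + y ≺ z.
Proof.
move=> xz yz; case/orP: (vle_total x y) => xy.
  by apply: vle_lt_trans yz; apply: vleD.
by apply: vle_lt_trans xz; apply: vleD.
Qed.

Lemma vltB z x y : x ≺ z -> y ≺ z -> x - y ≺ z.
Proof. by move=> xz yz; apply: vltD => //; rewrite vltN. Qed.

Lemma vle_sum (I : Type) (r : seq I) (P : pred I) (F : I -> L) z :
  (forall i, P i -> F i ≼ z) -> \sum_(i <- r | P i) F i ≼ z.
Proof. by move=> h; apply: (big_ind (fun x => x ≼ z)) => // x y; apply: vleD. Qed.

Lemma vlt_sum (I : Type) (r : seq I) (P : pred I) (F : I -> L) z :
  z != 0 -> (forall i, P i -> F i ≺ z) -> \sum_(i <- r | P i) F i ≺ z.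
Proof.
move=> z0 h; apply: (big_ind (fun x => x ≺ z)) => //; first by rewrite v0lt.
by move=> x y; apply: vltD.
Qed.

Lemma oag_leD2E (g a b : H) : (g + a <= g + b)%R = (a <= b)%R.
Proof.
apply/idP/idP; last exact: oag_leD2l.
by move=> /(oag_leD2l (- g)); rewrite !addKr.
Qed.

Lemma vle_pM2l z x y : z != 0 -> (z * x ≼ z * y) = (x ≼ y).
Proof.
rewrite -vval_eqoo /vle !vvalM; case: (vval z) => // g _.
by case: (vval x) (vval y) => [a|] [b|] //=; rewrite oag_leD2E.
Qed.

Lemma vle_pM2r z x y : z != 0 -> (x * z ≼ y * z) = (x ≼ y).
Proof. by move=> z0; rewrite !(mulrC _ z) vle_pM2l. Qed.

Lemma vlt_pM2l z x y : z != 0 -> (z * x ≺ z * y) = (x ≺ y).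
Proof. by move=> z0; rewrite /vlt vle_pM2l. Qed.

Lemma vlt_pM2r z x y : z != 0 -> (x * z ≺ y * z) = (x ≺ y).
Proof. by move=> z0; rewrite /vlt vle_pM2r. Qed.

Lemma vleM x y z w : x ≼ y -> z ≼ w -> x * z ≼ y * w.
Proof.
move=> xy zw; have [->|x0] := eqVneq x 0; first by rewrite mul0r.
have y0 := vle_neq0 xy x0.
have [->|z0] := eqVneq z 0; first by rewrite mulr0.
by apply: (@vle_trans (y * z)); rewrite ?vle_pM2r ?vle_pM2l.
Qed.

Lemma vltM x y z w : x ≺ y -> z ≺ w -> x * z ≺ y * w.
Proof.
move=> xy zw; have y0 := vlt_neq0 xy.
apply: (@vle_lt_trans (y * z)); last by rewrite vlt_pM2l.
by apply: vleM => //; apply: vlt_le.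
Qed.

Lemma vlt_leM x y z w : x ≺ y -> z ≼ w -> w != 0 -> x * z ≺ y * w.
Proof.
move=> xy zw w0; apply: (@vle_lt_trans (x * w)); first exact: vleM.
by rewrite vlt_pM2r.
Qed.

Lemma vle_ltM x y z w : x ≼ y -> y != 0 -> z ≺ w -> x * z ≺ y * w.
Proof. by move=> xy y0 zw; rewrite mulrC (mulrC y); apply: vlt_leM. Qed.

Lemma vle_M1 x y z : x ≼ y -> z ≼ 1 -> x * z ≼ y.
Proof. by move=> xy z1; rewrite -(mulr1 y); apply: vleM. Qed.

Lemma vle_1M x y z : z ≼ 1 -> x ≼ y -> z * x ≼ y.
Proof. by move=> z1 xy; rewrite mulrC; apply: vle_M1. Qed.

Lemma vlt_M1 x y z : x ≺ y -> z ≼ 1 -> x * z ≺ y.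
Proof. by move=> xy z1; rewrite -(mulr1 y); apply: vlt_leM => //; rewrite oner_eq0. Qed.

Lemma vlt_1M x y z : z ≼ 1 -> x ≺ y -> z * x ≺ y.
Proof. by move=> z1 xy; rewrite mulrC; apply: vlt_M1. Qed.

Lemma vleX1 x n : x ≼ 1 -> x ^+ n ≼ 1.
Proof. by move=> x1; elim: n => [|n IH]; rewrite ?expr0 // exprS; apply: vle_M1. Qed.

Lemma v0lt1 : (0 : L) ≺ 1.
Proof. by rewrite v0lt oner_eq0. Qed.

Lemma vdiv_le z x y : z != 0 -> (x / z ≼ y) = (x ≼ y * z).
Proof. by move=> z0; rewrite -(vle_pM2r _ _ z0) divfK. Qed.

Lemma vdiv_ge z x y : z != 0 -> (y ≼ x / z) = (y * z ≼ x).
Proof. by move=> z0; rewrite -(vle_pM2r _ _ z0) divfK. Qed.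

Lemma vdiv_lt z x y : z != 0 -> (x / z ≺ y) = (x ≺ y * z).
Proof. by move=> z0; rewrite /vlt vdiv_ge. Qed.

Lemma vle_div1 x y : x ≼ y -> x / y ≼ 1.
Proof.
have [->|y0] := eqVneq y 0; first by rewrite invr0 mulr0.
by rewrite vdiv_le // mul1r.
Qed.

Lemma vlt_div1 x y : x ≺ y -> x / y ≺ 1.
Proof. by move=> xy; rewrite vdiv_lt ?mul1r // (vlt_neq0 xy). Qed.

Lemma vle_addr x y : y ≺ x -> x ≼ x + y.
Proof.
move=> yx; rewrite -vnlt; apply/negP => h.
by have := vltB h yx; rewrite addrK vlt_irr.
Qed.

Lemma vle_addr_iff x y z : y ≺ z -> (z ≼ x + y) = (z ≼ x).
Proof.
move=> yz; apply/idP/idP => h; last first.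
  by apply: (vle_trans h); apply: vle_addr; apply: vlt_le_trans h.
rewrite -[x](addrK y); rewrite -vnlt; apply/negP => h2.
have : x + y - y + y ≺ z by apply: vltD.
by rewrite subrK => /vltP; apply.
Qed.

Lemma vle_swap x y z : x - y ≼ z -> y ≼ z -> x ≼ z.
Proof. by move=> h1 h2; rewrite -(subrK y x); apply: vleD. Qed.

Lemma vlt_swap x y z : x - y ≺ z -> y ≺ z -> x ≺ z.
Proof. by move=> h1 h2; rewrite -(subrK y x); apply: vltD. Qed.

Lemma vle_subC x y z : (x - y ≼ z) = (y - x ≼ z).
Proof. by rewrite -vleN opprB. Qed.

Lemma vlt_subC x y z : (x - y ≺ z) = (y - x ≺ z).
Proof. by rewrite -vltN opprB. Qed.

Lemma vle_max (n : nat) (f : nat -> L) :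
  (0 < n)%N -> exists2 i, (i < n)%N & forall j, (j < n)%N -> f j ≼ f i.
Proof.
elim: n => // -[|n] IH _; first by exists 0%N => // -[].
have [//|i ltin hi] := IH.
case/orP: (vle_total (f i) (f n.+1)) => h.
  exists n.+1 => // j; rewrite ltnS leq_eqVlt => /predU1P[->//|/hi] /vle_trans.
  exact.
exists i => [|j]; first exact: ltnW.
by rewrite ltnS leq_eqVlt => /predU1P[->|/hi].
Qed.

(** Taking the last dominant term makes all later ones strictly smaller. The arguments in the style
    of Gauss' lemma and of Newton polygons below rest on this strictness. *)
Lemma vle_last_max (n : nat) (f : nat -> L) :
  (exists2 i, (i < n)%N & f i != 0) ->
  exists i, [/\ (i < n)%N, f i != 0, forall j, (j < n)%N -> f j ≼ f i &
    forall j, (i < j < n)%N -> f j ≺ f i].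
Proof.
elim: n => [[]//|n IH] [i0 lti0 fi0].
have [[i lti fi]|none] := EM (exists2 i, (i < n)%N & f i != 0).
  have [|i1 [lti1 fi1 m1 m2]] := IH; first by exists i.
  case: (boolP (f i1 ≼ f n)) => h.
    exists n; split=> //.
    - by apply: vle_neq0 fi1.
    - move=> j; rewrite ltnS leq_eqVlt => /predU1P[->//|/m1] /vle_trans; exact.
    - by move=> j /andP[]; rewrite ltnS => /leq_trans h1 /h1; rewrite ltnn.
  exists i1; split=> //.
  - exact: ltnW.
  - move=> j; rewrite ltnS leq_eqVlt => /predU1P[->|/m1//].
    exact: vlt_le.
  - move=> j /andP[ij]; rewrite ltnS leq_eqVlt => /predU1P[->//|jn].
    by apply: m2; rewrite ij.
have z j : (j < n)%N -> f j = 0.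
  by move=> jn; apply/eqP/negP => /negP h; apply: none; exists j.
have i0n : i0 = n.
  by move: lti0; rewrite ltnS leq_eqVlt => /predU1P[//|/z h]; rewrite h eqxx in fi0.
exists n; subst i0; split=> //.
- by move=> j; rewrite ltnS leq_eqVlt => /predU1P[->//|/z ->].
- by move=> j /andP[]; rewrite ltnS => /leq_trans h1 /h1; rewrite ltnn.
Qed.

End DominationTheory.

#[global] Hint Resolve vle_refl v0le v0lt1 : core.

(** * Differential polynomials *)

Lemma mnm_ind n (P : 'X_{1..n} -> Prop) :
  P 0%MM -> (forall m i, P m -> P (m + U_(i))%MM) -> forall m, P m.
Proof.
move=> P0 PS m; have [d] := ubnP (mdeg m); elim: d m => // d IH m ltm.
have [->//|/eqP m0] := eqVneq m 0%MM.
have [i mi] : exists i, m i != 0%N.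
  apply/existsP; apply: contra_notT m0 => /existsPn h.
  by apply/mnmP => i; rewrite mnm0E; apply/eqP; have := h i; rewrite negbK.
have Ui : (U_(i) <= m)%MM by rewrite lep1mP.
rewrite -(submK Ui); apply: PS; apply: IH.
by move: ltm; rewrite -{1}(submK Ui) mdegD mdeg1 addn1 ltnS.
Qed.

Section Taylor.
Variables (R A : comNzRingType) (phi : {rmorphism R -> A}) (n : nat).
Variables (B : subringClosed A) (J : zmodClosed A).
Hypothesis JB : forall b x, b \in B -> x \in J -> b * x \in J.
Variables (a h : 'I_n -> A).
Hypothesis aB : forall i, a i \in B.
Hypothesis hB : forall i, h i \in B.
Hypothesis hJ : forall i j, h i * h j \in J.

Local Notation ev v := (mmap phi v).
Local Notation tay p :=
  (ev (fun i => a i + h i) p - ev a p - \sum_i ev a (p^`M(i)) * h i).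

Lemma mmap_in (p : {mpoly R[n]}) (v : 'I_n -> A) :
  (forall m, phi p@_m \in B) -> (forall i, v i \in B) -> ev v p \in B.
Proof.
move=> pB vB; rewrite /mmap rpred_sum // => m _; rewrite rpredM //.
by rewrite /mmap1 rpred_prod // => i _; rewrite rpredX.
Qed.

Lemma mmapM_XU (v : 'I_n -> A) p i : ev v (p * 'X_i) = ev v p * v i.
Proof. by rewrite rmorphM /= mmapX mmap1U. Qed.

Lemma mmapX_in m : ev a 'X_[m] \in B.
Proof. by rewrite mmapX /mmap1 rpred_prod // => i _; rewrite rpredX. Qed.

Lemma mmap_derX_in m i : ev a ('X_[m]^`M(i)) \in B.
Proof. by rewrite mderivX mmapZ rmorph_nat rpredM ?rpred_nat ?mmapX_in. Qed.

Lemma taylorX m : tay 'X_[m] \in J.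
Proof.
elim/mnm_ind: m => [|m i IH].
  rewrite mpolyX0 !rmorph1 subrr big1 ?subr0 ?rpred0 // => i _.
  by rewrite -mpolyC1 mderivC rmorph0 mul0r.
have dE k : ev a ('X_[m + U_(i)]^`M(k)) * h k =
    ev a ('X_[m]^`M(k)) * a i * h k + ev a 'X_[m] * (i == k)%:R * h k.
  rewrite mpolyXD mderivM rmorphD /= mmapM_XU mulrDl; congr (_ + _ * _).
  rewrite rmorphM /=; congr (_ * _); rewrite mderivX mmapZ rmorph_nat mnm1E.
  have [->|ne] := eqVneq i k; last by rewrite mul0r.
  have -> : (U_(k) - U_(k) = 0 :> 'X_{1..n})%MM by rewrite -{1}[U_(k)%MM]add0m addmK.
  by rewrite mmapX mmap11 mulr1.
rewrite (eq_bigr _ (fun k _ => dE k)) big_split /=.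
have -> : \sum_k ev a 'X_[m] * (i == k)%:R * h k = ev a 'X_[m] * h i.
  rewrite (bigD1 i) //= eqxx mulr1 big1 ?addr0 // => k ki.
  by rewrite eq_sym (negbTE ki) mulr0 mul0r.
have -> : \sum_k ev a ('X_[m]^`M(k)) * a i * h k =
    a i * \sum_k ev a ('X_[m]^`M(k)) * h k.
  by rewrite mulr_sumr; apply: eq_bigr => k _; ring.
rewrite mpolyXD !mmapM_XU; set S := \sum_k _ in IH *.
set T := ev _ _ in IH *; set U := ev a _ in IH *.
have -> : T * (a i + h i) - U * a i - (a i * S + U * h i) =
  (a i + h i) * (T - U - S) + h i * S by ring.
apply: rpredD; first by apply: JB; [apply: rpredD; rewrite ?aB ?hB | exact: IH].
rewrite /S mulr_sumr rpred_sum // => k _.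
by rewrite mulrCA JB ?mmap_derX_in.
Qed.

(** The remainder group [J] is left abstract because the expansion serves twice: at points of [L],
    with [J] a ball ([deval_add]), and for the polynomial G(x + d Y), with [J] the polynomials with
    small coefficients and no terms of degree below 2 ([dhens_newton]). *)
Lemma taylor p : (forall m, phi p@_m \in B) -> tay p \in J.
Proof.
move=> pB; have -> : tay p = \sum_(m <- msupp p) phi p@_m * tay 'X_[m].
  have E v q : ev v q = \sum_(m <- msupp q) phi q@_m * ev v 'X_[m].
    by apply: eq_bigr => m _; rewrite mmapX.
  under [RHS]eq_bigr => m _ do rewrite !mulrBr.
  rewrite !sumrB -!E; congr (_ - _).
  under [RHS]eq_bigr => m _ do rewrite mulr_sumr.
  rewrite exchange_big; apply: eq_bigr => i _.
  rewrite {1}(mpolyE p) [mderiv _ _]raddf_sum [mmap _ _ _]raddf_sum mulr_suml. 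
  apply: eq_bigr => m _.
  by rewrite /= mderivZ mmapZ mulrA.
by rewrite rpred_sum // => m _; rewrite JB ?taylorX.
Qed.

End Taylor.

Lemma der_additive (F : diffFieldType) : zmod_morphism (@der F).
Proof.
have d0 : der (0 : F) = 0.
  by have := congr1 (fun z => z - der 0) (derD (0 : F) 0); rewrite addr0 subrr addrK.
by move=> x y; rewrite derD; congr (_ + _); apply/eqP; rewrite -addr_eq0 -derD addNr d0.
Qed.

HB.instance Definition _ (F : diffFieldType) :=
  GRing.isZmodMorphism.Build F F (@der F) (@der_additive F).

Section Derivation.
Variable F : diffFieldType.
Implicit Types (x y c : F) (k : nat).

Definition jet k x : F := iter k der x.

Lemma jetS k x : jet k.+1 x = der (jet k x). Proof. by []. Qed.

Lemma jet_additive k : zmod_morphism (jet k).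
Proof. by elim: k => // k IH x y; rewrite !jetS IH raddfB. Qed.

HB.instance Definition _ k := GRing.isZmodMorphism.Build F F (jet k) (jet_additive k).

Lemma der1 : der (1 : F) = 0.
Proof.
by have := congr1 (fun z => z - der 1) (derM (1 : F) 1); rewrite !mulr1 mul1r subrr addrK.
Qed.

Lemma der_nat n : der (n%:R : F) = 0.
Proof. by rewrite raddfMn /= der1 mul0rn. Qed.

Lemma derX x n : der (x ^+ n) = n%:R * x ^+ n.-1 * der x.
Proof.
elim: n => [|n IH]; first by rewrite expr0 der1 !mul0r.
rewrite exprS derM IH; case: n {IH} => [|n]; first by rewrite !expr0; ring.
rewrite /= exprS; ring.
Qed.

(* [leib c k] lists the coefficients of the operator y |-> (c y)^(k). *)
Fixpoint leib c k : {poly F} :=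
  if k is k'.+1 then map_poly der (leib c k') + 'X * leib c k' else c%:P.

Lemma leibS c k i :
  (leib c k.+1)`_i = der (leib c k)`_i + (if i is i'.+1 then (leib c k)`_i' else 0).
Proof. by rewrite /= coefD coef_map /= coefXM; case: i. Qed.

Lemma leib_size c k i : (k < i)%N -> (leib c k)`_i = 0.
Proof.
elim: k i => [|k IH] i; first by rewrite /= coefC; case: i.
by case: i => // i ltki; rewrite leibS !IH ?raddf0 ?addr0 // ltnW.
Qed.

Lemma leib_top c k : (leib c k)`_k = c.
Proof.
elim: k => [|k IH]; first by rewrite /= coefC.
by rewrite leibS leib_size // raddf0 add0r.
Qed.

Lemma leibE c k y : jet k (c * y) = \sum_(i < k.+1) (leib c k)`_i * jet i y.
Proof.
elim: k => [|k IH]; first by rewrite big_ord1 /= coefC.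
rewrite jetS IH raddf_sum /=.
under eq_bigr => i _ do rewrite derM -jetS.
rewrite big_split /=; under [RHS]eq_bigr => i _ do rewrite leibS mulrDl.
rewrite [RHS]big_split /=; congr (_ + _).
  by rewrite [RHS]big_ord_recr /= leib_size // raddf0 mul0r addr0.
by rewrite [RHS]big_ord_recl /= mul0r add0r.
Qed.

Lemma leib_ind (P : F -> Prop) c k :
  P 0 -> (forall x y, P x -> P y -> P (x + y)) -> (forall x, P x -> P (der x)) ->
  P c -> forall i, P (leib c k)`_i.
Proof.
move=> P0 PD Pd Pc; elim: k => [|k IH] i; first by rewrite /= coefC; case: i.
by rewrite leibS; apply: PD; [apply: Pd | case: i].
Qed.

End Derivation.

Section Coefficients.
Variables (R : comNzRingType) (n : nat).

Definition mcoefs (S : {pred R}) : {pred {mpoly R[n]}} := [pred p | p \is a mpolyOver n S].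

Lemma mcoefs_closed (S : subringClosed R) : subring_closed (mcoefs S).
Proof.
split; first by rewrite inE -mpolyC1 mpolyOverC rpred1.
  by move=> P Q; rewrite !inE; apply: rpredB.
by move=> P Q; rewrite !inE; apply: rpredM.
Qed.

HB.instance Definition _ (S : subringClosed R) :=
  GRing.isSubringClosed.Build {mpoly R[n]} (mcoefs S) (@mcoefs_closed S).

Lemma mcoefsP (S : subringClosed R) (P : {mpoly R[n]}) :
  reflect (forall m, P@_m \in S) (P \in mcoefs S).
Proof. by rewrite inE; apply: mpolyOverP. Qed.

Lemma mcoefsC (S : subringClosed R) c : (c%:MP \in mcoefs S) = (c \in S).
Proof. by rewrite inE mpolyOverC. Qed.

Lemma mcoefsX (S : subringClosed R) i : 'X_i \in mcoefs S.
Proof. by rewrite inE mpolyOverX. Qed.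

Lemma mcoefs_ind (S : subringClosed R) (P : {mpoly R[n]} -> Prop) :
  (forall c, c \in S -> P c%:MP) -> (forall i, P 'X_i) ->
  (forall p q, P p -> P q -> P (p + q)) -> (forall p q, P p -> P q -> P (p * q)) ->
  forall p, p \in mcoefs S -> P p.
Proof.
move=> PC PX PD PM p /mcoefsP pS; rewrite (mpolyE p).
apply: big_ind => [|//|m _]; first by rewrite -mpolyC0; apply: PC; apply: rpred0.
have P1 : P 1 by rewrite -mpolyC1; apply: (PC 1); apply: rpred1.
rewrite -mul_mpolyC; apply: (PM _ _); first exact: PC.
elim/mnm_ind: m => [|m i IH]; first by rewrite mpolyX0.
by rewrite mpolyXD; apply: (PM _ _).
Qed.

End Coefficients.

Section Multi.
Variables (R : comNzRingType) (n : nat).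

Lemma meval_mwiden (q : {mpoly R[n]}) (w : 'I_n.+1 -> R) :
  (mwiden q).@[w] = q.@[fun i => w (widen_ord (leqnSn n) i)].
Proof.
rewrite (mpolyE q) [mwiden _]raddf_sum [LHS]raddf_sum [RHS]raddf_sum; apply: eq_bigr => m _ /=.
rewrite mwidenZ mwidenX !mevalZ !mevalX; congr (_ * _).
rewrite big_ord_recr /= mnmwiden_ordmax expr0 mulr1.
by apply: eq_bigr => i _; rewrite mnmwiden_widen.
Qed.

(* Differential polynomials are viewed as polynomials in their highest derivative. *)
Definition peval (v : nat -> R) (p : {poly {mpoly R[n]}}) : R :=
  (map_poly (meval (fun i : 'I_n => v i)) p).[v n].

Lemma peval_mmulti (v : nat -> R) (p : {poly {mpoly R[n]}}) :
  (mmulti p).@[fun i : 'I_n.+1 => v i] = peval v p.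
Proof.
rewrite /peval (horner_coef_wide _ (size_poly _ _)) /mmulti raddf_sum.
apply: eq_bigr => i _ /=; rewrite mevalM meval_mwiden rmorphXn /= mevalXU.
by rewrite coef_map.
Qed.

(** Identifies the separant, the partial derivative in the highest derivative of the unknown, with a
    formal derivative in one variable. *)
Lemma mderiv_mmulti (p : {poly {mpoly R[n]}}) :
  (mmulti p)^`M(ord_max) = mmulti p^`().
Proof.
have d0 (q : {mpoly R[n]}) : (mwiden q)^`M(ord_max) = 0.
  rewrite (mpolyE q) [mwiden _]raddf_sum [LHS]raddf_sum big1 // => m _ /=.
  by rewrite mwidenZ mwidenX mderivZ mderivX mnmwiden_ordmax scale0r scaler0.
have wide (r : {poly {mpoly R[n]}}) k : (size r <= k)%N ->
    mmulti r = \sum_(i < k) mwiden r`_i * 'X_ord_max ^+ i.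
  move=> le; rewrite /mmulti (big_ord_widen _ (fun i => mwiden r`_i * 'X_ord_max ^+ i) le).
  rewrite big_mkcond; apply: eq_bigr => i _; case: ifPn => //.
  by rewrite -leqNgt => h; rewrite nth_default // mwiden0 mul0r.
have dX i : ('X_ord_max ^+ i)^`M(ord_max) =
    'X_ord_max ^+ i.-1 *+ i :> {mpoly R[n.+1]}.
  elim: i => [|i IH]; first by rewrite expr0 -mpolyC1 mderivC mulr0n.
  rewrite exprS mderivM IH mderivX mnm1E eqxx scale1r.
  have -> : (U_(ord_max) - U_(ord_max) = 0 :> 'X_{1..n.+1})%MM.
    by rewrite -{1}[U_(ord_max)%MM]add0m addmK.
  rewrite mpolyX0 mul1r mulrSr addrC; congr (_ + _).
  by case: i {IH} => [|i]; rewrite ?mulr0n ?mulr0 // mulrnAr -exprS.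
rewrite (wide p (size p).+1) // (wide p^`() (size p)); last first.
  by apply: leq_trans (size_poly _ _) (leq_pred _).
rewrite raddf_sum big_ord_recl /= expr0 mulr1 d0 add0r; apply: eq_bigr => i _.
by rewrite mderivM d0 mul0r add0r dX /= coef_deriv raddfMn /= mulrnAl mulrnAr.
Qed.

Lemma muni_peval (v : nat -> R) (q : {mpoly R[n.+1]}) :
  peval v (muni q) = q.@[fun i : 'I_n.+1 => v i].
Proof.
rewrite muniE /peval raddf_sum horner_sum mevalE; apply: eq_bigr => m _.
rewrite /= map_polyZ map_polyXn /= mevalZ mevalX hornerZ hornerXn -mulrA.
congr (_ * _); rewrite big_ord_recr /=; congr (_ * _).
by apply: eq_bigr => i _; rewrite mnmE.
Qed.

Lemma muni_coef (q : {mpoly R[n.+1]}) (m : 'X_{1..n.+1}) :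
  ((muni q)`_(m ord_max))@_[multinom m (widen_ord (leqnSn n) i) | i < n] = q@_m.
Proof.
rewrite muniE coef_sum [LHS]raddf_sum [in RHS](mpolyE q) [RHS]raddf_sum.
apply: eq_bigr => k _; rewrite /= coefZ coefXn mulr_natr raddfMn /=.
rewrite !mcoeffZ !mcoeffX -mulrnAr; congr (_ * _).
have -> : (k == m) = ([multinom k (widen_ord (leqnSn n) i) | i < n] ==
    [multinom m (widen_ord (leqnSn n) i) | i < n]) && (m ord_max == k ord_max).
  apply/eqP/andP => [-> //|[/eqP e1 /eqP e2]]; apply/mnmP => i.
  case: (unliftP ord_max i) => [j ->|-> //].
  have := congr1 (fun u : 'X_{1..n} => u j) e1; rewrite !mnmE.
  by rewrite (_ : widen_ord _ j = lift ord_max j) //; apply/val_inj; rewrite /= /bump leqNgt ltn_ord.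
by case: eqP; case: eqP.
Qed.

Lemma muni_mcoefs (S : subringClosed R) (q : {mpoly R[n.+1]}) :
  q \in mcoefs S -> muni q \is a polyOver (mcoefs S).
Proof.
move=> /mcoefsP qS; rewrite muniE rpred_sum // => m _.
rewrite -mul_polyC rpredM ?rpredX ?polyOverX ?polyOverC //.
by rewrite -mul_mpolyC rpredM ?mcoefsC // inE mpolyOverX.
Qed.

End Multi.

(** * Intermediate fields, monotonicity and differential henselianity *)

Section Subfields.
Variables (H : oagType) (L : valuedDiffFieldType H).
Implicit Types (x y z : L) (K : divringClosed L).

Lemma res_eq0 (x : valring L) : (res L x == 0) = (\val x ≺ 1).
Proof.
have -> : (\val x ≺ 1) = (x - 0 \in @maxideal H L).
  by rewrite subr0 unfold_in /= inE /maxideal_pred /lt_oo /vlt /vle vval1.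
by rewrite Quotient.idealrBE -[0](rmorph0 (res L)).
Qed.

Lemma vint_valring x : (x \in @valring_pred H L) = (x ≼ 1).
Proof. by rewrite inE /vle vval1. Qed.

Lemma vnat_le1 n : (n%:R : L) ≼ 1.
Proof. by elim: n => // n IH; rewrite -natr1; apply: vleD. Qed.

(** Prime divisors are split off one at a time; an infinitesimal prime would be a positive
    characteristic of the residue field. *)
Lemma vnat_ge1 n : (0 < n)%N -> (1 : L) ≼ n%:R.
Proof.
have [m] := ubnP n; elim: m n => // m IH n ltnm n0.
have [n1|] := leqP n 1; first by have -> : n = 1%N by apply/eqP; rewrite eqn_leq n1.
move=> n1; have pp := pdiv_prime n1.
have q0 : (0 < n %/ pdiv n)%N by rewrite divn_gt0 ?pdiv_gt0 // dvdn_leq // pdiv_dvd.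
have qn : (n %/ pdiv n < m)%N.
  by apply: leq_trans (ltn_Pdiv (prime_gt1 pp) n0) _.
have -> : (n%:R : L) = (n %/ pdiv n)%:R * (pdiv n)%:R.
  by rewrite -natrM (divnK (pdiv_dvd n)).
apply: (vle_trans (IH _ qn q0)).
rewrite -{1}[(n %/ pdiv n)%:R]mulr1; apply: vleM => //.
rewrite -vnlt; apply/negP => h.
have : pdiv n \in [pchar (residue L)].
  by rewrite inE pp -(rmorph_nat (res L)) res_eq0 rmorph_nat.
by rewrite residue_pchar0.
Qed.

Lemma vnat_neq0 n : (0 < n)%N -> (n%:R : L) != 0.
Proof. by move=> n0; apply: vle_neq0 (vnat_ge1 n0) (oner_neq0 _). Qed.

Lemma vle_natM n x y : (0 < n)%N -> (n%:R * x ≼ y) = (x ≼ y).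
Proof.
move=> n0; apply/idP/idP => [h|]; last by apply: vle_1M; apply: vnat_le1.
rewrite -[x](mulKf (vnat_neq0 n0)); apply: vle_1M => //.
by rewrite -[_^-1]mul1r vdiv_le ?mul1r ?vnat_ge1 ?vnat_neq0.
Qed.

Definition vint_in K : {pred L} := [pred x | (x \in K) && (x ≼ 1)].

Lemma vint_in_closed K : subring_closed (vint_in K).
Proof.
split; first by rewrite inE rpred1 vle_refl.
  by move=> x y /andP[xK x1] /andP[yK y1]; rewrite inE rpredB ?vleB.
by move=> x y /andP[xK x1] /andP[yK y1]; rewrite inE rpredM ?vle_M1.
Qed.

HB.instance Definition _ K := GRing.isSubringClosed.Build L (vint_in K) (vint_in_closed K).

Lemma vint_inP K x : reflect (x \in K /\ x ≼ 1) (x \in vint_in K).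
Proof. by rewrite inE; apply: andP. Qed.

Definition vball K z : {pred L} := [pred x | (x \in K) && (x ≼ z)].

Lemma vball_closed K z : zmod_closed (vball K z).
Proof.
split; first by rewrite inE rpred0 v0le.
by move=> x y /andP[xK x1] /andP[yK y1]; rewrite inE rpredB ?vleB.
Qed.

HB.instance Definition _ K z := GRing.isZmodClosed.Build L (vball K z) (vball_closed K z).

Lemma vballP K z x : reflect (x \in K /\ x ≼ z) (x \in vball K z).
Proof. by rewrite inE; apply: andP. Qed.

Lemma vballM K z b x : b \in vint_in K -> x \in vball K z -> b * x \in vball K z.
Proof.
by move=> /vint_inP[bK b1] /vballP[xK xz]; apply/vballP; rewrite rpredM ?vle_1M.
Qed.

(** Intermediate fields are predicates on the fixed field [L]. They share its valuation and
    derivation, and the steps of a tower need no embeddings. *)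
Definition mono_subfield K : Prop :=
  forall x, x \in K -> der x \in K /\ der x ≼ x.

Definition deval n (P : {mpoly L[n]}) y : L := P.@[fun i : 'I_n => jet i y].

(** The degree condition on the reduction of [P], expressed by dominance so that no residue field of
    [K] has to be formed. The constant coefficient may be any integral element. *)
Definition quasilinear K n (P : {mpoly L[n]}) : Prop :=
  [/\ forall m, P@_m \in vint_in K, forall m, (1 < mdeg m)%N -> P@_m ≺ 1 &
      exists i : 'I_n, 1 ≼ P@_U_(i)].

Definition dhens K : Prop :=
  forall n (P : {mpoly L[n]}), quasilinear K P ->
  exists2 y, y \in vint_in K & deval P y = 0.

Section Monotone.
Variable K : divringClosed L.
Hypothesis Kmono : mono_subfield K.

Lemma jet_in k x : x \in K -> jet k x \in K.
Proof. by move=> xK; elim: k => // k IH; case: (Kmono IH). Qed.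

Lemma jet_le k x : x \in K -> jet k x ≼ x.
Proof.
move=> xK; elim: k => [|k IH]; first exact: vle_refl.
by apply: vle_trans IH; case: (Kmono (jet_in k xK)).
Qed.

Lemma jet_vint k x : x \in vint_in K -> jet k x \in vint_in K.
Proof.
move=> /vint_inP[xK x1]; apply/vint_inP; split; first exact: jet_in.
by apply: vle_trans x1; apply: jet_le.
Qed.

Lemma jet_vball k x z : x \in vball K z -> jet k x \in vball K z.
Proof.
move=> /vballP[xK x1]; apply/vballP; split; first exact: jet_in.
by apply: vle_trans x1; apply: jet_le.
Qed.

Lemma leib_vball c k z i : c \in vball K z -> (leib c k)`_i \in vball K z.
Proof.
move=> cK; apply: (@leib_ind _ (fun x => x \in vball K z)) => //.
- exact: rpred0.
- by move=> x y; apply: rpredD.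
- by move=> x; apply: (@jet_vball 1).
Qed.

Lemma deval_vint n (P : {mpoly L[n]}) x :
  (forall m, P@_m \in vint_in K) -> x \in vint_in K -> deval P x \in vint_in K.
Proof. by move=> PK xK; apply: mmap_in => // i; apply: jet_vint. Qed.

Lemma mderiv_vint n (P : {mpoly L[n]}) k :
  (forall m, P@_m \in vint_in K) -> forall m, (P^`M(k))@_m \in vint_in K.
Proof. by move=> PK m; rewrite mcoeff_mderiv rpredMn. Qed.

Lemma deval_add n (P : {mpoly L[n]}) x w z :
  (forall m, P@_m \in vint_in K) -> x \in vint_in K -> w \in vball K z -> z ≼ 1 ->
  deval P (x + w) - deval P x - \sum_i deval P^`M(i) x * jet i w \in vball K (z ^+ 2).
Proof.
move=> PK xK wK z1.
have wO : w \in vint_in K.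
  by move: wK => /vballP[wK wz]; apply/vint_inP; split=> //; apply: vle_trans z1.
have := @taylor _ _ (@idfun L) n (vint_in K) (vball K (z ^+ 2)) _
  (fun i : 'I_n => jet i x) (fun i : 'I_n => jet i w) _ _ _ P PK.
rewrite /deval /meval; set T := _ - _ - _ => h.
have -> : mmap idfun (fun i : 'I_n => jet i (x + w)) P =
          mmap idfun (fun i : 'I_n => jet i x + jet i w) P.
  by apply: meval_eq => i; rewrite raddfD.
apply: h => [b y||i|i j].
- exact: vballM.
- by move=> i; apply: jet_vint.
- exact: jet_vint.
- have /vballP[iK iz] := jet_vball i wK; have /vballP[jK jz] := jet_vball j wK.
  by apply/vballP; rewrite rpredM // expr2; split=> //; apply: vleM.
Qed.

End Monotone.
End Subfields.

Lemma mcoeffM_ind (R : comNzRingType) n (P : R -> Prop) (p q : {mpoly R[n]}) m :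
  P 0 -> (forall x y, P x -> P y -> P (x + y)) ->
  (forall m1 m2, (m1 + m2)%MM = m -> P (p@_m1 * q@_m2)) -> P (p * q)@_m.
Proof.
move=> P0 PD h; rewrite mcoeffM; apply: big_ind => // k /eqP mE.
by apply: h; rewrite -mE.
Qed.

Lemma mmap_mpolyC (R : comNzRingType) n k (u : 'I_n -> {mpoly R[k]}) (G : {mpoly R[n]}) v :
  (mmap (@mpolyC k R) u G).@[v] = G.@[fun i => (u i).@[v]].
Proof.
rewrite [RHS]mevalE /mmap raddf_sum; apply: eq_bigr => m _ /=.
rewrite mevalM mevalC /mmap1 rmorph_prod; congr (_ * _).
by apply: eq_bigr => i _; rewrite rmorphXn.
Qed.

Lemma mmap_const (R : comNzRingType) n k (u : 'I_n -> R) (G : {mpoly R[n]}) :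
  mmap (@mpolyC k R) (fun i => (u i)%:MP) G = (G.@[u])%:MP.
Proof.
rewrite mevalE /mmap [RHS](raddf_sum (@mpolyC k R)); apply: eq_bigr => m _ /=.
rewrite mpolyCM /mmap1 (rmorph_prod (@mpolyC k R)); congr (_ * _).
by apply: eq_bigr => i _; rewrite (rmorphXn (@mpolyC k R)).
Qed.

(** * From approximate to exact zeros of one differential polynomial *)

Section NewtonPoint.
Variables (H : oagType) (L : valuedDiffFieldType H).
Variable K : divringClosed L.

Definition quadratic_part n (z : L) : {pred {mpoly L[n]}} :=
  fun Q => `[< forall m, Q@_m \in vball K z /\ ((mdeg m < 2)%N -> Q@_m = 0) >].

Lemma quadratic_part_closed n z : zmod_closed (@quadratic_part n z).
Proof.
split; first by apply/asboolP => m; rewrite mcoeff0 rpred0.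
move=> P Q /asboolP PJ /asboolP QJ; apply/asboolP => m; rewrite mcoeffB.
have [P1 P2] := PJ m; have [Q1 Q2] := QJ m.
by split=> [|h]; [apply: rpredB | rewrite P2 ?Q2 // subr0].
Qed.

HB.instance Definition _ n z :=
  GRing.isZmodClosed.Build {mpoly L[n]} (quadratic_part z) (@quadratic_part_closed n z).

Lemma quadratic_partM n z (b Q : {mpoly L[n]}) :
  b \in @mcoefs L n (vint_in K) -> Q \in quadratic_part z -> b * Q \in quadratic_part z.
Proof.
move=> /mcoefsP bK /asboolP QJ; apply/asboolP => m; split.
  apply: (@mcoeffM_ind _ _ (fun x => x \in vball K z)) => [|x y|m1 m2 _]; [exact: rpred0 | exact: rpredD |].
  by apply: vballM => //; case: (QJ m2).
move=> h; apply: (@mcoeffM_ind _ _ (fun x => x = 0)) => [//|x y -> ->|m1 m2 mE]; first by rewrite addr0.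
have [_ ->] := QJ m2; first by rewrite mulr0.
by apply: leq_ltn_trans h; rewrite -mE mdegD leq_addl.
Qed.

Hypothesis Kmono : mono_subfield K.
Hypothesis Kd : dhens K.

(* Newton's method: after rescaling by [delta], the Taylor expansion of [G] at
   [x] is quasilinear. *)
Lemma dhens_newton n (G : {mpoly L[n]}) x (k : 'I_n) :
  (forall m, G@_m \in vint_in K) -> x \in vint_in K ->
  deval G x ≺ deval G^`M(k) x ^+ 2 ->
  exists x', [/\ x' \in vint_in K, deval G x' = 0 &
    deval G^`M(k) x * (x' - x) ≼ deval G x].
Proof.
move=> GK xO lt; set g := deval G x in lt *.
have [g0|g0] := eqVneq g 0.
  by exists x; split; rewrite // subrr mulr0.
pose a i := deval G^`M(i) x.
have aO i : a i \in vint_in K by apply: deval_vint => //; apply: mderiv_vint.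
pose f j := oapp a 0 (insub j : option 'I_n).
have fE (i : 'I_n) : f i = a i by rewrite /f valK.
(* Among the dominant partial derivatives at [x], the one of highest order: it will supply the unit
   linear coefficient of the rescaled polynomial. *)
have [|i0' [lti0 s0 smax slast]] := @vle_last_max _ L n f.
  exists k => //; rewrite fE; apply/eqP => ak; move: lt.
  by rewrite -/(a k) ak expr0n /= vlt0.
pose i0 := Ordinal lti0; pose s := a i0.
have fi0 : f i0' = s by rewrite -[i0']/(val i0) fE.
rewrite fi0 in s0 smax slast.
have {}smax i : a i ≼ s by rewrite -fE smax.
have {}slast (i : 'I_n) : (i0 < i)%N -> a i ≺ s.
  by move=> h; rewrite -fE slast // h /=.
have [sK s1] := vint_inP _ _ (aO i0).
have [xK x1] := vint_inP _ _ xO.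
have [gK g1] := vint_inP _ _ (deval_vint Kmono GK xO).
pose d := g / s; have d0 : d != 0 by rewrite mulf_neq0 ?invr_neq0.
have dK : d \in K by rewrite rpred_div.
have dsg : s * d = g by rewrite mulrC divfK.
have ds : d ≺ s.
  rewrite vdiv_lt // -expr2; apply: vlt_le_trans lt _.
  by rewrite !expr2; apply: vleM; apply: smax.
have d1 : d ≼ 1 by apply: vle_trans s1; apply: vlt_le.
have d2g : d ^+ 2 ≺ g by rewrite -dsg expr2 vlt_pM2r.
have dball : d \in vball K d by apply/vballP.
(* [h i] is the i-th derivative of d Y, written out by Leibniz' rule, so that [Q] below is G(x + d
   Y). The choice of [d] makes the linear term of index [i0] exactly as large as the constant term
   [g]. *)
pose h (i : 'I_n) : {mpoly L[n]} := \sum_(l < n) (leib d i)`_l *: 'X_l.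
have hC i m : (h i)@_m = \sum_(l < n) (leib d i)`_l * (U_(l)%MM == m)%:R.
  by rewrite raddf_sum; apply: eq_bigr => l _; rewrite /= mcoeffZ mcoeffX.
have hU i (l : 'I_n) : (h i)@_U_(l) = (leib d i)`_l.
  rewrite hC (bigD1 l) //= eqxx mulr1 big1 ?addr0 // => j jl.
  by rewrite eq_mnm1 (negbTE jl) mulr0.
have hball i m : (h i)@_m \in vball K d.
  rewrite hC rpred_sum // => l _.
  by rewrite mulrC vballM ?rpred_nat //; apply: leib_vball.
have hn1 i m : mdeg m != 1%N -> (h i)@_m = 0.
  move=> m1; rewrite hC big1 // => l _; have [E|] := eqVneq U_(l)%MM m.
    by rewrite -E mdeg1 in m1.
  by rewrite mulr0.
have hO i : h i \in @mcoefs L n (vint_in K).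
  apply/mcoefsP => m; have /vballP[? hd] := hball i m.
  by apply/vint_inP; split => //; apply: vle_trans d1.
have hJ i j : h i * h j \in quadratic_part (d ^+ 2).
  apply/asboolP => m; split.
    apply: (@mcoeffM_ind _ _ (fun x => x \in vball K (d ^+ 2))) => [|u1 u2|m1 m2 _]; [exact: rpred0 | exact: rpredD |].
    have /vballP[iK ib] := hball i m1; have /vballP[jK jb] := hball j m2.
    by apply/vballP; rewrite rpredM // expr2; split=> //; apply: vleM.
  move=> m2; apply: (@mcoeffM_ind _ _ (fun x => x = 0)) => [//|u1 u2 -> ->|q1 q2 mE]; first by rewrite addr0.
  have [e1|/hn1->] := eqVneq (mdeg q1) 1%N; last by rewrite mul0r.
  have [e2|/hn1->] := eqVneq (mdeg q2) 1%N; last by rewrite mulr0.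
  by move: m2; rewrite -mE mdegD e1 e2.
pose Q := mmap (@mpolyC n L) (fun i : 'I_n => (jet i x)%:MP + h i) G.
have := @taylor _ _ (@mpolyC n L) n (@mcoefs L n (vint_in K))
  (quadratic_part (d ^+ 2)) (@quadratic_partM n _)
  (fun i : 'I_n => (jet i x)%:MP) h _ hO hJ G _.
have jO (i : 'I_n) : jet i x \in vint_in K by apply: jet_vint.
move=> /(_ _ _)/asboolP; rewrite -/Q.
under eq_bigr => i _ do rewrite mmap_const -/(deval _ x) -/(a i).
rewrite mmap_const -/(deval G x) -/g => QJ.
have {}QJ m : Q@_m - (g%:MP)@_m - \sum_i a i * (h i)@_m \in vball K (d ^+ 2) /\
    ((mdeg m < 2)%N -> Q@_m - (g%:MP)@_m - \sum_i a i * (h i)@_m = 0).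
  have -> : \sum_i a i * (h i)@_m = (\sum_i (a i)%:MP * h i)@_m.
    by rewrite raddf_sum; apply: eq_bigr => i _; rewrite /= mcoeffCM.
  rewrite -!mcoeffB; apply: QJ => [i|m']; last by rewrite mcoefsC.
  by rewrite mcoefsC.
have sumball m : \sum_i a i * (h i)@_m \in vball K g.
  apply: rpred_sum => i _; have /vballP[iK ib] := hball i m.
  have [aK _] := vint_inP _ _ (aO i).
  by apply/vballP; rewrite rpredM // -dsg; split=> //; apply: vleM.
have Qball m : Q@_m \in vball K g.
  have [/vballP[rK rb] _] := QJ m.
  rewrite -[Q@_m](subrK (g%:MP)@_m); apply: rpredD; last first.
    rewrite mcoeffC; case: eqP => _; last by rewrite mulr0 rpred0.
    by rewrite mulr1; apply/vballP.
  rewrite -[_ - _](subrK (\sum_i a i * (h i)@_m)); apply: rpredD => //.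
  by apply/vballP; split=> //; apply: vle_trans (vlt_le d2g).
have QQ : quasilinear K (g^-1 *: Q).
  split.
  - move=> m; rewrite mcoeffZ; have /vballP[QK Qb] := Qball m.
    by apply/vint_inP; rewrite rpredM ?rpredV // mulrC vle_div1.
  - move=> m m2; rewrite mcoeffZ mulrC vlt_div1 //.
    have [/vballP[_ rb] _] := QJ m; move: rb.
    rewrite mcoeffC; have -> : (m == 0%MM) = false.
      by apply/eqP => m0; rewrite m0 mdeg0 in m2.
    rewrite mulr0 subr0 big1 ?subr0 => [h2|i _]; first exact: vle_lt_trans d2g.
    by rewrite hn1 ?mulr0 //; case: (mdeg m) m2 => [|[]].
  (* Only [i0] contributes a dominant term to this coefficient: for i < i0 the i-th derivative of d
     Y does not reach order [i0], and for i > i0 the factor [a i] is strictly smaller than [s]. *)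
  exists i0; rewrite mcoeffZ mulrC vdiv_ge // mul1r.
  have [_ /(_ _)] := QJ U_(i0)%MM; rewrite mdeg1 => /(_ isT).
  rewrite mcoeffC mnm1_eq0 mulr0 subr0 => /eqP; rewrite subr_eq0 => /eqP ->.
  rewrite (bigD1 i0) //= hU leib_top -/s dsg; apply: vle_addr.
  apply: vlt_sum => // i ii0; rewrite hU.
  have [lt_i|lt_i|/val_inj ii] := ltngtP i i0; last by rewrite ii eqxx in ii0.
    by rewrite leib_size // mulr0 v0lt.
  rewrite -dsg; apply: vlt_leM => //; first exact: slast.
  by have /vballP[] := leib_vball Kmono i i0 dball.
have [y yO Qy] := Kd QQ; have [yK y1] := vint_inP _ _ yO.
have dy : d * y ≼ d by apply: vle_M1.
exists (x + d * y); split.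
- apply/vint_inP; split; first by apply: rpredD => //; apply: rpredM.
  by apply: vleD => //; apply: vle_trans d1.
- have : Q.@[fun i : 'I_n => jet i y] = 0.
    move: Qy; rewrite /deval mevalZ => /eqP; rewrite mulf_eq0 invr_eq0 (negbTE g0).
    by move=> /eqP.
  rewrite /Q mmap_mpolyC => <-; apply: meval_eq => i.
  rewrite mevalD mevalC raddfD /= leibE; congr (_ + _).
  rewrite raddf_sum (big_ord_widen n (fun l => (leib d i)`_l * jet l y)) //.
  rewrite big_mkcond; apply: eq_bigr => l _ /=; rewrite mevalZ mevalXU.
  by case: ifPn => //; rewrite -leqNgt => h1; rewrite leib_size ?mul0r.
by rewrite addrC addKr -dsg; apply: vleM => //; apply: smax.
Qed.

End NewtonPoint.

(** * Lifting differential subrings *)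

(** The quotient rule needed for stability of E' under [d] in [lift_algebraic]. There [y] is S^k,
    [X] its derivative, [c] the integer k, and [a'], [s'] approximate S da and S dS; powers with a
    variable exponent are thus hidden from [ring]. *)
Fact quotient_identity (R : comNzRingType) (S f a a' s' da df dS y X c : R) :
  S ^+ 2 * X = S * dS * y * c ->
  S * (S * y) * df - (S * a' - s' * a * c) = S ^+ 2 * (X * f + y * df - da)
    + S * (S * da - a') - (S * dS * (y * f - a) + a * (S * dS - s')) * c.
Proof.
move=> key; have E : S ^+ 2 * (X * f) = S * dS * y * c * f by rewrite -key; ring.
have -> : S ^+ 2 * (X * f + y * df - da) = S ^+ 2 * (X * f) + S * S * (y * df - da) by ring.
by rewrite E; ring.
Qed.

Lemma pack_subring (R : comNzRingType) (E : {pred R}) :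
  subring_closed E -> exists S : subringClosed R, forall x, (x \in S) = (x \in E).
Proof.
move=> h; exists (HB.pack_for (subringClosed R) E (GRing.isSubringClosed.Build R E h)).
by move=> x.
Qed.

Lemma pseudo_division (A : comNzRingType) (S : subringClosed A) (G P : {poly A}) :
  (0 < size G)%N -> G \is a polyOver S -> P \is a polyOver S ->
  exists j Q T, [/\ Q \is a polyOver S, T \is a polyOver S,
    (lead_coef G ^+ j) *: P = Q * G + T & (size T < size G)%N].
Proof.
move=> G0 GS; have lS : lead_coef G \in S by rewrite lead_coefE; apply: (polyOverP GS).
have [s] := ubnP (size P); elim: s P => // s IH P; rewrite ltnS => le PS.
have [lt|ge] := ltnP (size P) (size G).
  by exists 0%N, 0, P; split; rewrite // ?rpred0 // expr0 scale1r mul0r add0r.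
have cS : lead_coef P \in S by rewrite lead_coefE; apply: (polyOverP PS).
pose U := lead_coef P *: 'X^(size P - size G).
pose P1 := lead_coef G *: P - U * G.
have US : U \is a polyOver S.
  by rewrite /U -mul_polyC rpredM ?rpredX ?polyOverX // polyOverC.
have P1S : P1 \is a polyOver S.
  apply: rpredB; last exact: rpredM.
  by rewrite -mul_polyC; apply: rpredM => //; rewrite polyOverC.
have P0 : (0 < size P)%N by apply: leq_trans G0 ge.
have lt1 : (size P1 < s)%N.
  apply: leq_trans le; rewrite -(prednK P0) ltnS; apply/leq_sizeP => k.
  rewrite leq_eqVlt => /predU1P[<-|lt]; rewrite coefB coefZ -scalerAl coefZ coefXnM.
    have -> : ((size P).-1 < size P - size G)%N = false.
      by apply/negP; lia.
    have -> : ((size P).-1 - (size P - size G) = (size G).-1)%N by lia.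
    by rewrite -!lead_coefE mulrC subrr.
  have hP : (size P <= k)%N by rewrite -(prednK P0).
  rewrite nth_default // mulr0 sub0r; case: ifPn => [_|_]; first by rewrite mulr0 oppr0.
  have h2 : (size G <= k - (size P - size G))%N by clear -ge hP; lia.
  by rewrite [G`__]nth_default ?mulr0 ?oppr0.
have [j [Q [T [QS TS E lt]]]] := IH P1 lt1 P1S.
exists j.+1, (lead_coef G ^+ j *: U + Q), T; split=> //.
  by rewrite rpredD // -mul_polyC rpredM // polyOverC rpredX.
rewrite exprSr -scalerA -[lead_coef G *: P](subrK (U * G)) scalerDr -/P1 E.
by rewrite mulrDl addrC addrA scalerAl.
Qed.

(** The setting is abstract because the lifting is done twice: in [L], where [Z] is zero and [I] the
    infinitesimals ([lift_const]), and for families, where [Z] consists of those vanishing almost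
    everywhere ([fam_lift]). Working modulo [Z] avoids forming the ultraproduct as a quotient;
    [primeZ] says that the quotient of [B] would be a domain. *)
Section AlgebraicLifting.
Variables (R : comNzRingType) (d : {additive R -> R}).
Variables (B : subringClosed R) (Z I : zmodClosed R).

Hypothesis dM : forall x y, d (x * y) = d x * y + x * d y.
Hypothesis dB : forall x, x \in B -> d x \in B.
Hypothesis ZI : forall x, x \in Z -> x \in I.
Hypothesis ZM : forall b x, b \in B -> x \in Z -> b * x \in Z.
Hypothesis IM : forall b x, b \in B -> x \in I -> b * x \in I.
Hypothesis dZ : forall x, x \in B -> x \in Z -> d x \in Z.
Hypothesis dI : forall x, x \in B -> x \in I -> d x \in I.
Hypothesis primeZ : forall x y, x \in B -> y \in B -> x * y \in Z -> x \notin Z -> y \in Z.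
Hypothesis natI : forall n x, (0 < n)%N -> x \in B -> x *+ n \in I -> x \in I.

Definition djets x (k : nat) : R := iter k d x.

Hypothesis hensel : forall n (G : {poly {mpoly R[n]}}) x,
  G \is a polyOver (mcoefs B) -> x \in B ->
  peval (djets x) G \in I -> peval (djets x) G^`() \notin I ->
  exists x', [/\ x' \in B, x' - x \in I & peval (djets x') G \in Z].

(* A differential subring on which [I] reduces to [Z]: a partial lift of the
   residue ring of [I]. *)
Definition residue_lift (E : {pred R}) : Prop :=
  [/\ {subset E <= B}, forall x, x \in E -> d x \in E &
      forall x, x \in E -> x \in I -> x \in Z].

Lemma djets_in x k : x \in B -> djets x k \in B.
Proof. by move=> xB; elim: k => //= k; apply: dB. Qed.

Lemma djetsS x k : djets x k.+1 = d (djets x k). Proof. by []. Qed.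

Lemma congr_djets x y k : x \in B -> y \in B -> x - y \in I -> djets x k - djets y k \in I.
Proof.
move=> xB yB xy; elim: k => //= k IH; rewrite -raddfB; apply: dI => //.
by apply: rpredB; apply: djets_in.
Qed.

Lemma congrM x y z w : x \in B -> y \in B -> z \in B -> w \in B ->
  x - y \in I -> z - w \in I -> x * z - y * w \in I.
Proof.
move=> xB yB zB wB xy zw; have -> : x * z - y * w = z * (x - y) + y * (z - w) by ring.
by apply: rpredD; apply: IM.
Qed.

Local Notation ev v n q := (q : {mpoly R[n]}).@[fun i : 'I_n => v i].

Lemma ev_in n (S : subringClosed R) (v : nat -> R) (q : {mpoly R[n]}) :
  (forall k, (k < n)%N -> v k \in S) -> q \in mcoefs S -> ev v n q \in S.
Proof.
move=> vS; elim/mcoefs_ind => [c|i|p1 p2|p1 p2].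
- by rewrite mevalC.
- by rewrite mevalXU; apply: vS.
- by rewrite mevalD; apply: rpredD.
- by rewrite mevalM; apply: rpredM.
Qed.

Lemma mmulti_mcoefs n (S : subringClosed R) (p : {poly {mpoly R[n]}}) :
  p \is a polyOver (mcoefs S) -> mmulti p \in mcoefs S.
Proof.
move=> /polyOverP pS; apply: rpred_sum => i _; apply: rpredM; last first.
  by apply: rpredX; apply: mcoefsX.
elim/mcoefs_ind: (p`_i) / (pS i) => [c cS|j|q1 q2 h1 h2|q1 q2 h1 h2].
- by rewrite mwidenC mcoefsC.
- by rewrite mwidenX mnmwiden1 mcoefsX.
- by rewrite mwidenD rpredD.
- by rewrite mwidenM rpredM.
Qed.

Lemma peval_in n (S : subringClosed R) (v : nat -> R) (p : {poly {mpoly R[n]}}) :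
  (forall k, (k <= n)%N -> v k \in S) -> p \is a polyOver (mcoefs S) -> peval v p \in S.
Proof.
by move=> vS pS; rewrite -peval_mmulti; apply: ev_in => //; apply: mmulti_mcoefs.
Qed.

Lemma congr_ev n (v w : nat -> R) (q : {mpoly R[n]}) :
  (forall k, v k \in B) -> (forall k, w k \in B) -> (forall k, v k - w k \in I) ->
  q \in mcoefs B -> ev v n q - ev w n q \in I.
Proof.
move=> vB wB vw qB.
suff: [/\ ev v n q \in B, ev w n q \in B & ev v n q - ev w n q \in I] by case.
elim/mcoefs_ind: q / qB => [c cB|j|q1 q2 [v1 w1 h1] [v2 w2 h2]|q1 q2 [v1 w1 h1] [v2 w2 h2]].
- by rewrite !mevalC subrr rpred0.
- by rewrite !mevalXU.
- rewrite !mevalD opprD addrACA; split; by apply: rpredD.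
- rewrite !mevalM; split; [exact: rpredM | exact: rpredM | exact: congrM].
Qed.

Lemma congr_peval n (v w : nat -> R) (p : {poly {mpoly R[n]}}) :
  (forall k, v k \in B) -> (forall k, w k \in B) -> (forall k, v k - w k \in I) ->
  p \is a polyOver (mcoefs B) -> peval v p - peval w p \in I.
Proof.
by move=> *; rewrite -!peval_mmulti; apply: congr_ev => //; apply: mmulti_mcoefs.
Qed.

Definition coefsZ n (q : {mpoly R[n]}) : Prop := forall m, q@_m \in Z.

Lemma ev_Z n (v : nat -> R) (q : {mpoly R[n]}) :
  (forall k, v k \in B) -> coefsZ q -> ev v n q \in Z.
Proof.
move=> vB qZ; rewrite mevalE; apply: rpred_sum => m _; rewrite mulrC; apply: ZM => //.
by apply: rpred_prod => i _; apply: rpredX.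
Qed.

Lemma peval_Z n (v : nat -> R) (p : {poly {mpoly R[n]}}) :
  (forall k, v k \in B) -> (forall i, coefsZ p`_i) -> peval v p \in Z.
Proof.
move=> vB pZ; rewrite /peval horner_coef; apply: rpred_sum => i _.
by rewrite coef_map mulrC; apply: ZM; [apply: rpredX | apply: ev_Z].
Qed.

Section Extension.
Variable E : subringClosed R.
Hypothesis Elift : residue_lift E.

Lemma EB x : x \in E -> x \in B. Proof. by case: Elift => h _ _; apply: h. Qed.
Lemma Ed x : x \in E -> d x \in E. Proof. by case: Elift => _ h _; apply: h. Qed.
Lemma EZ x : x \in E -> x \in I -> x \in Z. Proof. by case: Elift => _ _ h; apply: h. Qed.

Lemma mcoefsEB n (q : {mpoly R[n]}) : q \in mcoefs E -> q \in mcoefs B.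
Proof. by move=> /mcoefsP h; apply/mcoefsP => m; apply: EB. Qed.

Lemma polyOverEB n (p : {poly {mpoly R[n]}}) :
  p \is a polyOver (mcoefs E) -> p \is a polyOver (mcoefs B).
Proof. by move=> /polyOverP h; apply/polyOverP => m; apply: mcoefsEB. Qed.

(** The ring E[v 0, ..., v n], seen as polynomials in [v n]. *)
Definition gen n (v : nat -> R) : {pred R} :=
  fun f => `[< exists2 p : {poly {mpoly R[n]}}, p \is a polyOver (mcoefs E) & f = peval v p >].

Lemma gen_closed n v : subring_closed (gen n v).
Proof.
split.
- by apply/asboolP; exists 1; rewrite ?rpred1 // /peval rmorph1 hornerC.
- move=> x y /asboolP[p pE ->] /asboolP[q qE ->]; apply/asboolP.
  by exists (p - q); rewrite ?rpredB // /peval rmorphB hornerD hornerN.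
- move=> x y /asboolP[p pE ->] /asboolP[q qE ->]; apply/asboolP.
  by exists (p * q); rewrite ?rpredM // /peval rmorphM hornerM.
Qed.

HB.instance Definition _ n v := GRing.isSubringClosed.Build R (gen n v) (gen_closed n v).

Lemma gen_peval n (v : nat -> R) (p : {poly {mpoly R[n]}}) :
  p \is a polyOver (mcoefs E) -> peval v p \in gen n v.
Proof. by move=> pE; apply/asboolP; exists p. Qed.

Lemma gen_ev n (v : nat -> R) (q : {mpoly R[n]}) : q \in mcoefs E -> ev v n q \in gen n v.
Proof.
move=> qE; apply/asboolP; exists q%:P; first by rewrite polyOverC.
by rewrite /peval map_polyC hornerC.
Qed.

Lemma gen_E n (v : nat -> R) c : c \in E -> c \in gen n v.
Proof. by move=> cE; rewrite -[c](mevalC (fun i : 'I_n => v i)) gen_ev ?mcoefsC. Qed.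

Lemma gen_v n (v : nat -> R) k : (k <= n)%N -> v k \in gen n v.
Proof.
rewrite leq_eqVlt => /predU1P[->|lt].
  by apply/asboolP; exists 'X; rewrite ?polyOverX // /peval map_polyX hornerX.
rewrite (_ : v k = ev v n 'X_(Ordinal lt)); last by rewrite mevalXU.
by apply: gen_ev; apply: mcoefsX.
Qed.

Lemma gen_sub n v f : f \in gen n v -> f \in gen n.+1 v.
Proof.
move=> /asboolP[p pE ->]; rewrite -peval_mmulti; apply: gen_ev.
exact: mmulti_mcoefs.
Qed.

Lemma gen_in n v f : (forall k, v k \in B) -> f \in gen n v -> f \in B.
Proof. by move=> vB /asboolP[p pE ->]; apply: peval_in => //; apply: polyOverEB. Qed.

Lemma d1 : d 1 = 0.
Proof. by have := congr1 (fun z => z - d 1) (dM 1 1); rewrite !mulr1 mul1r subrr addrK. Qed.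

Lemma d_horner (P : {poly R}) y : d P.[y] = (map_poly d P).[y] + P^`().[y] * d y.
Proof.
elim/poly_ind: P => [|P c IH].
  by rewrite deriv0 map_poly0 !horner0 raddf0 mul0r addr0.
have -> : map_poly d (P * 'X + c%:P) = map_poly d P * 'X + (d c)%:P.
  apply/polyP => i; rewrite coef_map /= !coefD !coefMX !coefC raddfD /= coef_map.
  by case: eqP => _; rewrite ?raddf0.
rewrite derivD derivM derivX derivC addr0 !hornerE raddfD /= dM IH; ring.
Qed.

Lemma d_ev n y (q : {mpoly R[n]}) : q \in mcoefs E ->
  d (ev (djets y) n q) \in gen n (djets y).
Proof.
move=> qE; pose v := djets y.
suff: ev v n q \in gen n v /\ d (ev v n q) \in gen n v by case.
elim/mcoefs_ind: q / qE => [c cB|j|q1 q2 [v1 w1] [v2 w2]|q1 q2 [v1 w1] [v2 w2]].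
- by rewrite !mevalC; split; apply: gen_E => //; apply: Ed.
- by rewrite !mevalXU -djetsS; split; apply: gen_v => //; apply: ltnW.
- by rewrite !mevalD raddfD; split; apply: rpredD.
- rewrite !mevalM dM; split; first exact: rpredM.
  by apply: rpredD; apply: rpredM.
Qed.

Lemma d_peval n y (p : {poly {mpoly R[n]}}) : p \is a polyOver (mcoefs E) ->
  d (peval (djets y) p) - peval (djets y) p^`() * djets y n.+1 \in gen n (djets y).
Proof.
move=> pE; rewrite /peval d_horner deriv_map djetsS addrK horner_coef.
apply: rpred_sum => i _; apply: rpredM; last by apply: rpredX; apply: gen_v.
by rewrite !coef_map; apply: d_ev; apply: (polyOverP pE).
Qed.

Lemma d_gen n y f : f \in gen n (djets y) ->
  exists b c, [/\ b \in gen n (djets y), c \in gen n (djets y) &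
    d f = b + c * djets y n.+1].
Proof.
move=> /asboolP[p pE ->]; have h := d_peval y pE.
exists (d (peval (djets y) p) - peval (djets y) p^`() * djets y n.+1), (peval (djets y) p^`()).
split=> //; last by rewrite subrK.
by apply: gen_peval; apply: polyOver_deriv.
Qed.

Variable x : R.
Hypothesis xB : x \in B.

(** Modulo [I], the element [x] satisfies a differential equation over [E] of order at most [n]
    which is nontrivial modulo [Z]. *)
Definition algdep n : Prop := exists p : {poly {mpoly R[n]}},
  [/\ p \is a polyOver (mcoefs E), peval (djets x) p \in I & ~ forall k, coefsZ p`_k].

(** Without variables this is the lifting property of [E]; otherwise [q], read as a polynomial in
    its last variable, would be a dependence of order below [n]. *)
Lemma coefsZ_E n (q : {mpoly R[n]}) :
  (forall k, (k < n)%N -> ~ algdep k) -> q \in mcoefs E -> ev (djets x) n q \in I -> coefsZ q.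
Proof.
case: n q => [|n] q nd qE qI m.
  have qC : q = (q@_m)%:MP.
    apply/mpolyP => m'; rewrite mcoeffC.
    have -> : m' = 0%MM by apply/mnmP => -[].
    have -> : m = 0%MM by apply/mnmP => -[].
    by rewrite eqxx mulr1.
  by move: qI; rewrite qC mevalC mcoeffC => qI; rewrite mulrC; apply: ZM;
    rewrite ?rpred_nat //; apply: EZ => //; apply: (mcoefsP _ _ qE).
rewrite -muni_coef; set k := m _; set m' := [multinom _ | _ < _].
suff : forall k, coefsZ (muni q)`_k by apply.
apply: contrapT => nZ; apply: (nd n (ltnSn n)); exists (muni q); split=> //.
  exact: muni_mcoefs.
by rewrite muni_peval.
Qed.

(** Here [x] itself can be adjoined: an element of E{x} lying in [I] is a relation for [x], hence
    has its coefficients in [Z]. *)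
Lemma lift_transcendental : (forall n, ~ algdep n) ->
  exists E' : subringClosed R,
    [/\ residue_lift E', {subset E <= E'} & exists2 x', x' \in E' & x' - x \in I].
Proof.
move=> nd; pose v := djets x.
have vB k : v k \in B by apply: djets_in.
have up n m f : (n <= m)%N -> f \in gen n v -> f \in gen m v.
  elim: m => [|m IH]; first by rewrite leqn0 => /eqP ->.
  by rewrite leq_eqVlt => /predU1P[->//|/IH h] /h; apply: gen_sub.
have cl : subring_closed (fun f => `[< exists n, f \in gen n v >]).
  split; first by apply/asboolP; exists 0%N; apply: rpred1.
    move=> f g /asboolP[n fn] /asboolP[m gm]; apply/asboolP; exists (maxn n m).
    by apply: rpredB; [apply: up fn; apply: leq_maxl | apply: up gm; apply: leq_maxr].
  move=> f g /asboolP[n fn] /asboolP[m gm]; apply/asboolP; exists (maxn n m).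
  by apply: rpredM; [apply: up fn; apply: leq_maxl | apply: up gm; apply: leq_maxr].
have [E' E'E] := pack_subring cl.
exists E'; split.
- split=> f; rewrite E'E => /asboolP[n fn]; first exact: gen_in fn.
  + rewrite E'E; apply/asboolP; exists n.+1.
    have [b [c [bg cg ->]]] := d_gen fn.
    apply: rpredD; first exact: gen_sub.
    by apply: rpredM; [exact: gen_sub | apply: gen_v].
  + have /asboolP[p pE ->] := fn; rewrite -peval_mmulti => fI.
    have qE := mmulti_mcoefs pE; apply: ev_Z => //.
    by apply: coefsZ_E => // k _; apply: nd.
- by move=> f fE; rewrite E'E; apply/asboolP; exists 0%N; apply: gen_E.
exists x; rewrite ?subrr ?rpred0 // E'E; apply/asboolP; exists 0%N.
exact: (@gen_v 0 v 0).
Qed.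

(** [G] is a minimal equation of [x] modulo [I]: of least order and, for that order, of least degree
    in the highest derivative. Minimality keeps its leading coefficient and its separant S outside
    [I], so [hensel] corrects [x] to x' with G(x') in [Z]. Higher derivatives of x' are then
    determined up to division by S, so E' consists of the elements of [B] that a power of S moves
    into E[x', ..., x'^(n)] modulo [Z]. *)
Lemma lift_algebraic n : algdep n -> (forall k, (k < n)%N -> ~ algdep k) ->
  exists E' : subringClosed R,
    [/\ residue_lift E', {subset E <= E'} & exists2 x', x' \in E' & x' - x \in I].
Proof.
move=> dep nd; pose v := djets x.
have vB k : v k \in B by apply: djets_in.
pose P s := `[< exists p : {poly {mpoly R[n]}}, [/\ p \is a polyOver (mcoefs E),
  peval v p \in I, ~ forall k, coefsZ p`_k & size p = s] >].
have exP : exists s, P s.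
  by case: dep => p [p1 p2 p3]; exists (size p); apply/asboolP; exists p.
case: (ex_minnP exP) => s /asboolP[G [GE GI Gnz sG]] smin.
have minG (p : {poly {mpoly R[n]}}) : p \is a polyOver (mcoefs E) -> peval v p \in I -> (size p < size G)%N ->
    forall k, coefsZ p`_k.
  move=> pE pI lt; apply: contrapT => pnz.
  have : P (size p) by apply/asboolP; exists p.
  by move=> /smin; rewrite -sG leqNgt lt.
have G0 : (0 < size G)%N.
  rewrite lt0n size_poly_eq0; apply/eqP => G0; apply: Gnz => k m.
  by rewrite G0 coef0 mcoeff0 rpred0.
pose l := lead_coef G.
have lE : l \in mcoefs E by rewrite /l lead_coefE; apply: (polyOverP GE).
have lnz : ~ coefsZ l.
  move=> lZ; pose G1 := G - l *: 'X^((size G).-1).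
  have G1E : G1 \is a polyOver (mcoefs E).
    by apply: rpredB => //; rewrite -mul_polyC rpredM ?rpredX ?polyOverX // polyOverC.
  have lt : (size G1 < size G)%N.
    rewrite -[X in (_ < X)%N](prednK G0) ltnS; apply/leq_sizeP => k; rewrite leq_eqVlt coefB coefZ coefXn.
    move=> /predU1P[<-|lt]; first by rewrite eqxx mulr1 /l lead_coefE subrr.
    by rewrite (gtn_eqF lt) mulr0 subr0 nth_default // -(prednK G0).
  have lXZ k : coefsZ (l *: 'X^((size G).-1))`_k.
    move=> m; rewrite coefZ coefXn; case: eqP => _; first by rewrite mulr1.
    by rewrite mulr0 mcoeff0 rpred0.
  have G1I : peval v G1 \in I.
    rewrite /G1 /peval rmorphB hornerD hornerN rpredB //; apply: ZI.
    exact: peval_Z.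
  apply: Gnz => k m; rewrite -[G](subrK (l *: 'X^((size G).-1))) coefD mcoeffD.
  by apply: rpredD; [apply: minG | apply: lXZ].
have lnI : ev v n l \notin I.
  by apply/negP => lI; apply: lnz; apply: (coefsZ_E nd).
have G2 : (1 < size G)%N.
  rewrite ltnNge; apply/negP => le1; case/negP: lnI.
  have E1 : G = l%:P.
    rewrite (size1_polyC le1); congr _%:P; rewrite /l lead_coefE; congr (_`_ _).
    by move: (size G) G0 le1 => [|[]].
  by move: GI; rewrite E1 /peval map_polyC hornerC.
have G'E : G^`() \is a polyOver (mcoefs E) by apply: polyOver_deriv.
(* The derivative has smaller degree, so in [I] it would have all its coefficients in [Z]. Its top
   coefficient is that of [G] times the degree, a factor which [natI] removes. *)
have G'nI : peval v G^`() \notin I.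
  apply/negP => h; apply: lnz => m.
  have lt : (size G^`() < size G)%N by apply: lt_size_deriv; rewrite -size_poly_gt0.
  have := minG _ G'E h lt (size G).-2 m; rewrite coef_deriv.
  have -> : (size G).-2.+1 = (size G).-1 by move: (size G) G2 => [|[]].
  rewrite -lead_coefE -/l mcoeffMn => hl; have lmE := mcoefsP _ _ lE m.
  apply: EZ => //; apply: (@natI (size G).-1); first by move: (size G) G2 => [|[]].
    exact: EB.
  exact: ZI.
have [x' [x'B xx' Gx']] := hensel (polyOverEB GE) xB GI G'nI.
pose w := djets x'.
have wB k : w k \in B by apply: djets_in.
have wv k : w k - v k \in I by apply: congr_djets.
pose S := peval w G^`().
have SB : S \in B by apply: peval_in => //; apply: polyOverEB.
have Sg : S \in gen n w by apply: gen_peval.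
have notI f g : f - g \in I -> g \notin I -> f \notin I.
  move=> fg; apply: contra => fI.
  by rewrite -[g](subKr f) rpredB.
have SnI : S \notin I by apply: notI G'nI; apply: congr_peval => //; apply: polyOverEB.
have SnZ : S \notin Z by apply: contra SnI; apply: ZI.
have SkZ k f : f \in B -> S ^+ k * f \in Z -> f \in Z.
  elim: k f => [|k IH] f fB; first by rewrite mul1r.
  rewrite exprSr -mulrA => /IH h; apply: (primeZ SB fB) => //; apply: h.
  exact: rpredM.
(* differentiating the equation [G] expresses [S * x'^(n+1)] *)
have [u ug uE] : exists2 u, u \in gen n w & S * w n.+1 - u \in Z.
  exists (- (d (peval w G) - S * w n.+1)); first by rewrite rpredN; apply: d_peval.
  rewrite opprK addrC subrK; apply: dZ => //.
  by apply: peval_in => //; apply: polyOverEB.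
have gB f : f \in gen n w -> f \in B by apply: gen_in.
have dgen (f : R) : f \in gen n w -> exists2 g, g \in gen n w & S * d f - g \in Z.
  move=> fg; have [b [c [bg cg ->]]] := d_gen fg.
  exists (S * b + c * u); first by rewrite rpredD ?rpredM.
  have -> : S * (b + c * w n.+1) - (S * b + c * u) = c * (S * w n.+1 - u) by ring.
  by apply: ZM => //; apply: gB.
pose Q f := f \in B /\ exists k a, a \in gen n w /\ S ^+ k * f - a \in Z.
have Qd f : Q f -> Q (d f).
  move=> [fB [k [a [ag fa]]]]; split; first exact: dB.
  have [a' a'g a'E] := dgen _ ag; have [s' s'g s'E] := dgen _ Sg.
  exists k.+2, (S * a' - (s' * a) *+ k); split.
    by rewrite rpredB ?rpredMn ?rpredM.
  have dSk j : d (S ^+ j) = (S ^+ j.-1 * d S) *+ j.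
    elim: j => [|j IH]; first by rewrite expr0 d1.
    rewrite exprS dM IH; case: j {IH} => [|j]; first by rewrite !expr0 mulr1n; ring.
    by rewrite /= [in RHS]mulrS exprS; ring.
  have dfa : d (S ^+ k * f - a) \in Z.
    by apply: dZ => //; apply: rpredB; [apply: rpredM => //; apply: rpredX | apply: gB].
  have -> : S ^+ k.+2 * d f - (S * a' - (s' * a) *+ k) =
      S ^+ 2 * d (S ^+ k * f - a) + S * (S * d a - a')
      - (S * d S * (S ^+ k * f - a) + a * (S * d S - s')) *+ k.
    have key : S ^+ 2 * (S ^+ k.-1 * d S *+ k) = S * d S * S ^+ k * k%:R.
      case: k {fa dfa} => [|k]; first by rewrite mulr0n !mulr0.
      by rewrite /= -mulr_natr [S ^+ k.+1]exprS; move: (S ^+ k) (k.+1%:R) => y c; ring.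
    rewrite (raddfB d) /= dM dSk [S ^+ k.+2]exprS [S ^+ k.+1]exprS; move: key.
    rewrite -[(s' * a) *+ k]mulr_natr -[(_ + _) *+ k]mulr_natr.
    move: (S ^+ k) (S ^+ k.-1 * d S *+ k) (k%:R) (d f) (d a) (d S) => y X c df da dS key.
    exact: quotient_identity.
  have aB := gB _ ag; have s'B := gB _ s'g.
  apply: rpredB; last apply: rpredMn.
    by apply: rpredD; [apply: ZM => //; apply: rpredX | apply: ZM].
  by apply: rpredD; apply: ZM => //; apply: rpredM => //; apply: dB.
have Qg f : f \in gen n w -> Q f.
  by move=> fg; split; [apply: gB | exists 0%N, f; rewrite mul1r subrr rpred0].
have cl : subring_closed (fun f => `[< Q f >]).
  split; first by apply/asboolP; apply: Qg; apply: rpred1.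
    move=> f g /asboolP[fB [k [a [ag fa]]]] /asboolP[gB' [j [b [bg gb]]]].
    apply/asboolP; split; first exact: rpredB.
    exists (k + j)%N, (S ^+ j * a - S ^+ k * b); split.
      by rewrite rpredB // rpredM // rpredX.
    have -> : S ^+ (k + j) * (f - g) - (S ^+ j * a - S ^+ k * b) =
      S ^+ j * (S ^+ k * f - a) - S ^+ k * (S ^+ j * g - b) by rewrite exprD; ring.
    by apply: rpredB; apply: ZM => //; apply: rpredX.
  move=> f g /asboolP[fB [k [a [ag fa]]]] /asboolP[gB' [j [b [bg gb]]]].
  apply/asboolP; split; first exact: rpredM.
  exists (k + j)%N, (a * b); split; first by rewrite rpredM.
  have -> : S ^+ (k + j) * (f * g) - a * b =
    (S ^+ j * g) * (S ^+ k * f - a) + a * (S ^+ j * g - b) by rewrite exprD; ring.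
  apply: rpredD; apply: ZM => //; last exact: gB.
  by apply: rpredM => //; apply: rpredX.
have [E' E'E] := pack_subring cl.
exists E'; split.
- split=> f; rewrite E'E => /asboolP Qf; first by case: Qf.
    by rewrite E'E; apply/asboolP; apply: Qd.
  move=> fI; have [fB [k [a [ag fa]]]] := Qf.
  apply: (@SkZ k) => //; rewrite -[_ * f](subrK a); apply: rpredD => //.
  have aI : a \in I.
    rewrite -[a](subKr (S ^+ k * f)); apply: rpredB; last exact: ZI.
    by apply: IM => //; apply: rpredX.
  have /asboolP[p pE aE] := ag.
  (* Since [G] vanishes modulo [Z] at x', pseudo-division replaces [p] by a remainder of smaller
     degree. Its value at x' lies in [I], hence so does its value at [x], and minimality of [G] puts
     its coefficients in [Z]. *)
  have [j [q [t [qE tE pG lt]]]] := pseudo_division G0 GE pE.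
  have lw : ev w n l \in B by apply: ev_in => //; apply: mcoefsEB.
  have lwnI : ev w n l \notin I.
    by apply: notI lnI; apply: congr_ev => //; apply: mcoefsEB.
  have pev : ev w n l ^+ j * a = peval w q * peval w G + peval w t.
    rewrite aE /peval -hornerM -hornerD -rmorphM -rmorphD -pG /= map_polyZ hornerZ /=.
    by rewrite rmorphXn.
  have tI : peval w t \in I.
    rewrite -[peval w t](addKr (peval w q * peval w G)) -pev addrC; apply: rpredB.
      by apply: IM => //; apply: rpredX.
    by apply: IM; [apply: peval_in => //; apply: polyOverEB | apply: ZI].
  have tvI : peval v t \in I.
    rewrite -[peval v t](subKr (peval w t)); apply: rpredB => //.
    by apply: congr_peval => //; apply: polyOverEB.
  have tZ : peval w t \in Z by apply: peval_Z => //; apply: minG.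
  have : ev w n l ^+ j * a \in Z.
    rewrite pev; apply: rpredD => //; apply: ZM => //.
    by apply: peval_in => //; apply: polyOverEB.
  have aB := gB _ ag; clear -aB lw lwnI primeZ ZI.
  elim: j => [|j IH]; first by rewrite mul1r.
  rewrite exprS -mulrA => /(primeZ lw) h; apply: IH; apply: h.
    by apply: rpredM => //; apply: rpredX.
  by apply: contra lwnI; apply: ZI.
- by move=> f fE; rewrite E'E; apply/asboolP; apply: Qg; apply: gen_E.
by exists x' => //; rewrite E'E; apply/asboolP; apply: Qg; apply: (@gen_v n w 0).
Qed.

Lemma lift_element : exists E' : subringClosed R,
    [/\ residue_lift E', {subset E <= E'} & exists2 x', x' \in E' & x' - x \in I].
Proof.
have [[n dep]|nd] := EM (exists n, algdep n); last first.
  by apply: lift_transcendental => n dep; apply: nd; exists n.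
have exP : exists n, `[< algdep n >] by exists n; apply/asboolP.
case: (ex_minnP exP) => m /asboolP mdep mmin; apply: (lift_algebraic mdep) => k lt kd.
by have := mmin k (asboolT kd); rewrite leqNgt lt.
Qed.

End Extension.
End AlgebraicLifting.

(** Differential polynomials in several unknowns as syntax: composition and derivation stay inside
    the type, constants can be replaced one by one, and the same term is evaluated in [L] and at
    each index of a family. *)
Inductive dterm (T : Type) : Type :=
| DConst of T
| DVar of nat
| DAdd of dterm T & dterm T
| DMul of dterm T & dterm T
| DDer of dterm T.

Section Evaluation.
Variable L : diffFieldType.

Fixpoint teval (z : nat -> L) (t : dterm L) : L :=
  match t with
  | DConst c => c
  | DVar j => z j
  | DAdd t1 t2 => teval z t1 + teval z t2
  | DMul t1 t2 => teval z t1 * teval z t2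
  | DDer t1 => der (teval z t1)
  end.

Fixpoint tconst (S : {pred L}) (t : dterm L) : bool :=
  match t with
  | DConst c => c \in S
  | DVar _ => true
  | DAdd t1 t2 | DMul t1 t2 => tconst S t1 && tconst S t2
  | DDer t1 => tconst S t1
  end.

Lemma tconst_sub (S S' : {pred L}) t : {subset S <= S'} -> tconst S t -> tconst S' t.
Proof.
move=> h; elim: t => [c /h||t1 h1 t2 h2 /andP[/h1 + /h2]|t1 h1 t2 h2 /andP[/h1 + /h2]|] //=.
  by move=> -> ->.
by move=> -> ->.
Qed.

End Evaluation.

(** * Lifts inside an intermediate field *)

Section Swap.
Variables (H : oagType) (L : valuedDiffFieldType H).
Variable K : divringClosed L.
Hypothesis Kmono : mono_subfield K.
Hypothesis Kd : dhens K.

(* A multiplicatively cofinal set of nonzero infinitesimals; it plays the role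
   of a convex subgroup of the value group. *)
Variable D : L -> Prop.
Hypothesis D_ex : exists d, D d.
Hypothesis D_small : forall d, D d -> d != 0 /\ d ≺ 1.
Hypothesis D_mul : forall d e, D d -> D e -> exists2 f, D f & f ≼ d * e.

Definition infinitesimal x : Prop := forall d, D d -> x ≼ d.

Lemma inf_le1 x : infinitesimal x -> x ≺ 1.
Proof. by case: D_ex => d Dd /(_ d Dd) h; apply: vle_lt_trans h _; case: (D_small Dd). Qed.

Lemma inf_closed_sub x y : infinitesimal x -> infinitesimal y -> infinitesimal (x - y).
Proof. by move=> hx hy d Dd; apply: vleB; auto. Qed.

Lemma notinf x : ~ infinitesimal x -> exists2 d, D d & d ≺ x.
Proof.
move=> h; apply: contrapT => nh; apply: h => d Dd; rewrite -vnlt.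
by apply/negP => lt; apply: nh; exists d.
Qed.

Definition inf_pred : {pred L} := fun x => `[< infinitesimal x >].

Lemma inf_predP x : reflect (infinitesimal x) (x \in inf_pred).
Proof. exact: asboolP. Qed.

Lemma inf_pred_closed : zmod_closed inf_pred.
Proof.
split; first by apply/inf_predP => d _.
by move=> x y /inf_predP hx /inf_predP hy; apply/inf_predP; apply: inf_closed_sub.
Qed.

HB.instance Definition _ := GRing.isZmodClosed.Build L inf_pred inf_pred_closed.

Definition zero_pred : {pred L} := pred1 0.

Lemma zero_pred_closed : zmod_closed zero_pred.
Proof. by split=> [|x y]; rewrite !inE // => /eqP -> /eqP ->; rewrite subr0. Qed.

HB.instance Definition _ := GRing.isZmodClosed.Build L zero_pred zero_pred_closed.

Lemma deval_mmulti n (G : {poly {mpoly L[n]}}) x :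
  deval (mmulti G) x = peval (djets (@der L) x) G.
Proof. by rewrite -peval_mmulti. Qed.

(** The last clause quantifies over [e] after the zero is chosen: a single zero must be close to [x]
    with respect to every member of D. *)
Lemma hensel_point n (G : {poly {mpoly L[n]}}) x d :
  G \is a polyOver (mcoefs (vint_in K)) -> x \in vint_in K ->
  d ≺ peval (djets der x) G^`() -> d != 0 -> peval (djets der x) G ≼ d * d ->
  exists x', [/\ x' \in vint_in K, peval (djets der x') G = 0 &
    forall e, peval (djets der x) G ≼ e * d -> x' - x ≼ e].
Proof.
move=> GK xK dS d0 gd; have := @dhens_newton _ _ _ Kmono Kd _ (mmulti G) x ord_max.
rewrite mderiv_mmulti !deval_mmulti => -[||| x' [x'K x'0 le]] //.
- by move=> m; apply: (mcoefsP _ _ (mmulti_mcoefs GK)).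
- by apply: vle_lt_trans gd _; rewrite expr2; apply: vltM.
exists x'; split=> // [|e ge]; first by rewrite -deval_mmulti.
have S0 := vlt_neq0 dS.
rewrite -(vle_pM2l _ _ S0); apply: vle_trans le (vle_trans ge _).
by rewrite mulrC; apply: vleM => //; apply: vlt_le.
Qed.

Lemma vint_inf b x : b \in vint_in K -> infinitesimal x -> infinitesimal (b * x).
Proof. by move=> /vint_inP[_ b1] hx d Dd; apply: vle_1M => //; apply: hx. Qed.

Definition lift_in_L (E : {pred L}) := residue_lift (@der L) (vint_in K) zero_pred inf_pred E.

Lemma lift_const (E : subringClosed L) x : lift_in_L E -> x \in vint_in K ->
  exists E' : subringClosed L,
    [/\ lift_in_L E', {subset E <= E'} & exists2 x', x' \in E' & x' - x \in inf_pred].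
Proof.
move=> hE xK; apply: (@lift_element L (@der L) (vint_in K) zero_pred inf_pred) => //.
- exact: derM.
- exact: (@jet_vint _ _ _ Kmono 1).
- by move=> y /eqP ->; apply: rpred0.
- by move=> b y _ /eqP ->; rewrite mulr0 inE.
- by move=> b y bK /inf_predP yI; apply/inf_predP; apply: vint_inf.
- by move=> y _ /eqP ->; rewrite raddf0 inE.
- move=> y /vint_inP[yK _] /inf_predP yI; apply/inf_predP => d Dd.
  by apply: vle_trans (yI d Dd); case: (Kmono yK).
- move=> y w _ _; rewrite !inE mulf_eq0 => /orP[-> //|->]; by rewrite ?inE.
- move=> n y n0 _ /inf_predP yI; apply/inf_predP => d Dd.
  by have := yI d Dd; rewrite -mulr_natl vle_natM.
move=> n G y GK yK /inf_predP gI /negP SI.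
have [d Dd dS] : exists2 d, D d & d ≺ peval (djets der y) G^`().
  by apply: notinf => h; apply: SI; apply/inf_predP.
have [d0 _] := D_small Dd; have [e De le] := D_mul Dd Dd.
have [|y' [y'K y'0 yy']] := hensel_point GK yK dS d0; first exact: vle_trans (gI e De) le.
exists y'; split=> //; last by rewrite inE y'0.
apply/inf_predP => f Df; apply: yy'; have [g Dg leg] := D_mul Df Dd.
exact: vle_trans (gI g Dg) leg.
Qed.

(** The image of the integers is a lift because nonzero integers are units of the valuation ring;
    every other lift is grown from it. *)
Lemma lift_prime_ring : exists E : subringClosed L, lift_in_L E.
Proof.
pose P : {pred L} := fun x => `[< exists n m : nat, x = n%:R - m%:R >].
have cl : subring_closed P.
  split; first by apply/asboolP; exists 1%N, 0%N; rewrite subr0.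
    move=> x y /asboolP[n [m ->]] /asboolP[n' [m' ->]]; apply/asboolP.
    by exists (n + m')%N, (m + n')%N; rewrite !natrD; ring.
  move=> x y /asboolP[n [m ->]] /asboolP[n' [m' ->]]; apply/asboolP.
  by exists (n * n' + m * m')%N, (n * m' + m * n')%N; rewrite !natrD !natrM; ring.
have [E EP] := pack_subring cl; exists E; split=> x; rewrite EP => /asboolP[n [m ->]].
- apply: rpredB; exact: rpred_nat.
- by rewrite raddfB /= !der_nat subrr rpred0.
move=> /inf_predP /inf_le1.
have gen k : (k%:R : L) ≺ 1 -> k = 0%N.
  by case: k => // k; rewrite /vlt vnat_ge1.
have [le|/ltnW le] := leqP m n.
  by rewrite -natrB // => /gen ->; rewrite inE.
by rewrite -opprB -natrB // vltN => /gen ->; rewrite oppr0 inE.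
Qed.

Definition near_terms (t t' : dterm L) : Prop :=
  forall z, (forall j, z j \in vint_in K) ->
  [/\ teval z t \in vint_in K, teval z t' \in vint_in K & infinitesimal (teval z t - teval z t')].

(** Each constant is moved by an infinitesimal into a growing lift, which changes values at integral
    points by infinitesimals only. Terms with constants in a lift have their values at points of the
    lift again in it, and there infinitesimal means zero. *)
Lemma lift_term t : tconst (vint_in K) t -> forall E : subringClosed L, lift_in_L E ->
  exists E' : subringClosed L, exists t',
    [/\ lift_in_L E', {subset E <= E'}, tconst E' t' & near_terms t t'].
Proof.
have infM x y z w : x \in vint_in K -> y \in vint_in K -> z \in vint_in K -> w \in vint_in K ->
    infinitesimal (x - y) -> infinitesimal (z - w) -> infinitesimal (x * z - y * w).
  move=> xB yB zB wB xy zw; have -> : x * z - y * w = z * (x - y) - y * (w - z) by ring.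
  apply: inf_closed_sub; apply: vint_inf => //.
  by move=> d Dd; rewrite -opprB vleN; apply: zw.
have infD x y : infinitesimal x -> infinitesimal y -> infinitesimal (x + y).
  by move=> hx hy d Dd; apply: vleD; auto.
have step t1 t2 : (forall E : subringClosed L, lift_in_L E ->
    exists E' : subringClosed L, exists t',
    [/\ lift_in_L E', {subset E <= E'}, tconst E' t' & near_terms t1 t']) ->
    (forall E : subringClosed L, lift_in_L E ->
    exists E' : subringClosed L, exists t',
    [/\ lift_in_L E', {subset E <= E'}, tconst E' t' & near_terms t2 t']) ->
    forall E : subringClosed L, lift_in_L E -> exists E' : subringClosed L, exists t1' t2',
    [/\ lift_in_L E', {subset E <= E'}, tconst E' t1' && tconst E' t2', near_terms t1 t1' &
        near_terms t2 t2'].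
  move=> h1 h2 E hE; have [E1 [u1 [l1 s1 c1 n1]]] := h1 E hE.
  have [E2 [u2 [l2 s2 c2 n2]]] := h2 E1 l1; exists E2, u1, u2; split=> //.
    by move=> x /s1 /s2.
  by rewrite c2 (tconst_sub s2 c1).
elim: t => [c|j|t1 h1 t2 h2|t1 h1 t2 h2|t1 h1] /=.
- move=> cK E hE; have [E' [l s [c' c'E /inf_predP cc']]] := lift_const hE cK.
  exists E', (DConst c'); split=> // z zK; split=> //=; first by case: l => B _ _; apply: B.
  by move=> d Dd; rewrite -opprB vleN; apply: cc'.
- move=> _ E hE; exists E, (DVar _ j); split=> // z zK /=; split=> //.
  by rewrite subrr => d _.
- move=> /andP[/h1 {}h1 /h2 {}h2] E /(step _ _ h1 h2)[E' [u1 [u2 [l s c n1 n2]]]].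
  exists E', (DAdd u1 u2); split=> // z zK; have [a1 b1 i1] := n1 z zK.
  have [a2 b2 i2] := n2 z zK; split=> /=; rewrite ?rpredD // opprD addrACA.
  exact: infD.
- move=> /andP[/h1 {}h1 /h2 {}h2] E /(step _ _ h1 h2)[E' [u1 [u2 [l s c n1 n2]]]].
  exists E', (DMul u1 u2); split=> // z zK; have [a1 b1 i1] := n1 z zK.
  by have [a2 b2 i2] := n2 z zK; split=> /=; rewrite ?rpredM //; apply: infM.
- move=> /h1 {}h1 E /h1[E' [u [l s c n]]]; exists E', (DDer u); split=> // z zK.
  have [a b i] := n z zK; split=> /=; rewrite ?(@jet_vint _ _ _ Kmono 1) //.
  rewrite -raddfB => d Dd; apply: vle_trans (i d Dd).
  have /vint_inP[abK _] : teval z t1 - teval z u \in vint_in K by apply: rpredB.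
  by case: (Kmono abK).
Qed.

Lemma lift_terms (t : nat -> dterm L) m : (forall i, (i < m)%N -> tconst (vint_in K) (t i)) ->
  exists E : subringClosed L, exists t' : nat -> dterm L, lift_in_L E /\
    forall i, (i < m)%N -> tconst E (t' i) /\ near_terms (t i) (t' i).
Proof.
elim: m => [|m IH] h; first by have [E hE] := lift_prime_ring; exists E, t.
have [i lt|E [t' [hE ht']]] := IH; first by apply: h; apply: ltnW.
have [E' [u [hE' s c n]]] := lift_term (h m (ltnSn m)) hE.
exists E', (fun i => if i == m then u else t' i); split=> // i.
rewrite ltnS leq_eqVlt; case: eqP => [-> _ //|_ /= lt]; have [c1 n1] := ht' i lt.
by split=> //; apply: tconst_sub c1.
Qed.

End Swap.

(** * Exchanging quantifiers by an ultraproduct *)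

Section Ultraproduct.
Variable L : fieldType.

(* Families are indexed by [L] because the ultrafilter concentrates on [D]. *)
Definition fam : Type := L -> L.

HB.instance Definition _ := Choice.copy fam (L -> L).

Definition fam_add (f g : fam) : fam := fun i => f i + g i.
Definition fam_opp (f : fam) : fam := fun i => - f i.
Definition fam_mul (f g : fam) : fam := fun i => f i * g i.
Definition fam_cst (c : L) : fam := fun=> c.

Fact fam_addA : associative fam_add.
Proof. by move=> f g h; apply/funext => i; apply: addrA. Qed.
Fact fam_addC : commutative fam_add.
Proof. by move=> f g; apply/funext => i; apply: addrC. Qed.
Fact fam_add0 : left_id (fam_cst 0) fam_add.
Proof. by move=> f; apply/funext => i; apply: add0r. Qed.
Fact fam_addN : left_inverse (fam_cst 0) fam_opp fam_add.
Proof. by move=> f; apply/funext => i; apply: addNr. Qed.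

HB.instance Definition _ := GRing.isZmodule.Build fam fam_addA fam_addC fam_add0 fam_addN.

Fact fam_mulA : associative fam_mul.
Proof. by move=> f g h; apply/funext => i; apply: mulrA. Qed.
Fact fam_mulC : commutative fam_mul.
Proof. by move=> f g; apply/funext => i; apply: mulrC. Qed.
Fact fam_mul1 : left_id (fam_cst 1) fam_mul.
Proof. by move=> f; apply/funext => i; apply: mul1r. Qed.
Fact fam_mulD : left_distributive fam_mul +%R.
Proof. by move=> f g h; apply/funext => i; apply: mulrDl. Qed.
Fact fam_neq0 : fam_cst 1 != 0.
Proof. by apply/eqP => /(congr1 (fun f : fam => f 0)) /eqP; rewrite oner_eq0. Qed.

HB.instance Definition _ := GRing.Zmodule_isComNzRing.Build fam
  fam_mulA fam_mulC fam_mul1 fam_mulD fam_neq0.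

Definition at_ (i : L) (f : fam) : L := f i.

Fact at_additive i : zmod_morphism (at_ i). Proof. by []. Qed.
HB.instance Definition _ i := GRing.isZmodMorphism.Build fam L (at_ i) (at_additive i).
Fact at_monoid i : monoid_morphism (at_ i). Proof. by []. Qed.
HB.instance Definition _ i := GRing.isMonoidMorphism.Build fam L (at_ i) (at_monoid i).

End Ultraproduct.

Section Naturality.
Variables (R S : comNzRingType) (f : {rmorphism R -> S}) (n : nat).

Lemma meval_map_mpoly (v : 'I_n -> R) (q : {mpoly R[n]}) :
  f q.@[v] = (map_mpoly f q).@[fun i => f (v i)].
Proof.
rewrite (mpolyE q) [map_mpoly _ _]raddf_sum [meval v _]raddf_sum !raddf_sum.
apply: eq_bigr => m _ /=; rewrite map_mpolyZ map_mpolyX !mevalZ !mevalX rmorphM rmorph_prod.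
by congr (_ * _); apply: eq_bigr => i _; rewrite rmorphXn.
Qed.

Lemma peval_map (v : nat -> R) (p : {poly {mpoly R[n]}}) :
  f (peval v p) = peval (fun k => f (v k)) (map_poly (map_mpoly f) p).
Proof.
rewrite /peval -horner_map; congr (_.[_]); apply/polyP => k.
by rewrite !coef_map /= meval_map_mpoly.
Qed.

End Naturality.

Section SwapQuantifiers.
Variables (H : oagType) (L : valuedDiffFieldType H).
Variable K : divringClosed L.
Hypothesis Kmono : mono_subfield K.
Hypothesis Kd : dhens K.
Variable D : L -> Prop.
Hypothesis D_ex : exists d, D d.
Hypothesis D_small : forall d, D d -> d != 0 /\ d ≺ 1.
Hypothesis D_mul : forall d e, D d -> D e -> exists2 f, D f & f ≼ d * e.

(** Dominance is total, so the tails of D form a chain of nonempty sets and generate a proper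
    filter, which extends to an ultrafilter. *)
Lemma tail_ultrafilter : exists U : (L -> Prop) -> Prop,
  [/\ forall A B : L -> Prop, (forall i, A i -> B i) -> U A -> U B,
      forall A B : L -> Prop, U A -> U B -> U (fun i => A i /\ B i),
      forall A : L -> Prop, U A -> exists i, A i,
      forall A : L -> Prop, ~ U A -> U (fun i => ~ A i) &
      forall d, D d -> U (fun i => D i /\ i ≼ d)].
Proof.
pose F (A : L -> Prop) := exists2 d, D d & forall i, D i -> i ≼ d -> A i.
have PF : filter.ProperFilter F.
  apply: filter.Build_ProperFilter; first by case=> d Dd /(_ d Dd (vle_refl d)).
  apply: filter.Build_Filter.
  - by have [d Dd] := D_ex; exists d.
  - move=> A B [d Dd dA] [e De eB].
    case/orP: (vle_total d e) => h.
      exists d => // i Di id; split; [exact: dA | apply: eB => //].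
      exact: vle_trans h.
    exists e => // i Di ie; split; [apply: dA => // | exact: eB].
    exact: vle_trans h.
  - by move=> A B AB [d Dd dA]; exists d => // i Di id; apply: AB; apply: dA.
have [U [Uu FU]] := filter.ultraFilterLemma PF.
exists U; split.
- by move=> A B AB; apply: filter.filterS.
- by move=> A B; apply: filter.filterI.
- by move=> A UA; apply: filter.filter_ex UA.
- by move=> A nA; have [] := filter.in_ultra_setVsetC A Uu.
- by move=> d Dd; apply: FU; exists d.
Qed.

Section UltraLift.
Variable U : (L -> Prop) -> Prop.
Hypothesis Us : forall A B : L -> Prop, (forall i, A i -> B i) -> U A -> U B.
Hypothesis UI : forall A B : L -> Prop, U A -> U B -> U (fun i => A i /\ B i).
Hypothesis Uex : forall A : L -> Prop, U A -> exists i, A i.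
Hypothesis Uc : forall A : L -> Prop, ~ U A -> U (fun i => ~ A i).
Hypothesis Ut : forall d, D d -> U (fun i => D i /\ i ≼ d).

Lemma Uall (A : L -> Prop) : (forall i, A i) -> U A.
Proof. by move=> h; have [d Dd] := D_ex; apply: Us (Ut Dd) => i _; apply: h. Qed.

(** Modulo [famZ], the ring [famB] is an ultrapower of the integral elements of [K]. Membership in
    [famI] is tested against constants [d] only, on a set of indices that may depend on [d]. *)
Definition famB : {pred fam L} := fun f => `[< forall i, f i \in vint_in K >].
Definition famZ : {pred fam L} := fun f => `[< U (fun i => f i = 0) >].
Definition famI : {pred fam L} := fun f => `[< forall d, D d -> U (fun i => f i ≼ d) >].

Lemma famB_closed : subring_closed famB.
Proof.
split; first by apply/asboolP => i; apply: rpred1.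
  by move=> f g /asboolP fB /asboolP gB; apply/asboolP => i; apply: (rpredB (fB i) (gB i)).
by move=> f g /asboolP fB /asboolP gB; apply/asboolP => i; apply: (@rpredM _ (vint_in K) (f i) (g i) (fB i) (gB i)).
Qed.
HB.instance Definition _ := GRing.isSubringClosed.Build (fam L) famB famB_closed.

Lemma famZ_closed : zmod_closed famZ.
Proof.
split; first by apply/asboolP; apply: Uall.
move=> f g /asboolP fZ /asboolP gZ; apply/asboolP; apply: Us (UI fZ gZ) => i [f0 g0].
by rewrite -[LHS]/(f i - g i) f0 g0 subr0.
Qed.
HB.instance Definition _ := GRing.isZmodClosed.Build (fam L) famZ famZ_closed.

Lemma famI_closed : zmod_closed famI.
Proof.
split; first by apply/asboolP => d Dd; apply: Uall => i; apply: v0le.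
move=> f g /asboolP fI /asboolP gI; apply/asboolP => d Dd.
by apply: Us (UI (fI d Dd) (gI d Dd)) => i [f0 g0]; apply: (@vleB _ _ d (f i) (g i)).
Qed.
HB.instance Definition _ := GRing.isZmodClosed.Build (fam L) famI famI_closed.

Definition fam_der (f : fam L) : fam L := fun i => der (f i).
Lemma fam_der_additive : zmod_morphism fam_der.
Proof. by move=> f g; apply/funext => i; apply: (raddfB (@der L)). Qed.
HB.instance Definition _ := GRing.isZmodMorphism.Build (fam L) (fam L) fam_der fam_der_additive.

Lemma djets_at f k i : at_ i (djets fam_der f k) = djets der (f i) k.
Proof. by elim: k => // k IH; rewrite !djetsS -IH. Qed.

Definition lift_in_fam (E : {pred fam L}) := residue_lift fam_der famB famZ famI E.

Lemma fam_hensel n (G : {poly {mpoly (fam L)[n]}}) x :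
  G \is a polyOver (mcoefs famB) -> x \in famB ->
  peval (djets fam_der x) G \in famI -> peval (djets fam_der x) G^`() \notin famI ->
  exists x', [/\ x' \in famB, x' - x \in famI & peval (djets fam_der x') G \in famZ].
Proof.
move=> GB /asboolP xB /asboolP gI /negP SI.
pose Gi i := map_poly (map_mpoly (at_ i)) G.
have GiE y i : at_ i (peval (djets fam_der y) G) = peval (djets der (y i)) (Gi i).
  rewrite peval_map /Gi /peval; congr horner; last exact: djets_at.
  by apply: eq_map_poly => q; apply: meval_eq => k; apply: djets_at.
have GiE' y i : at_ i (peval (djets fam_der y) G^`()) = peval (djets der (y i)) (Gi i)^`().
  rewrite peval_map /Gi deriv_map /peval; congr horner; last exact: djets_at.
  by apply: eq_map_poly => q; apply: meval_eq => k; apply: djets_at.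
have GiK i : Gi i \is a polyOver (mcoefs (vint_in K)).
  apply/polyOverP => k; rewrite coef_map; apply/mcoefsP => m /=.
  rewrite mcoeff_map_mpoly; have := mcoefsP _ _ (polyOverP GB k) m.
  by move=> /asboolP; apply.
have [d Dd dS] : exists2 d, D d & ~ U (fun i => peval (djets fam_der x) G^`() i ≼ d).
  apply: contrapT => h; apply: SI; apply/asboolP => d Dd.
  by apply: contrapT => nU; apply: h; exists d.
have [d0 _] := D_small Dd; have [e De le] := D_mul Dd Dd.
(* The Newton zero is required only at indices where the separant exceeds [d] and the residual is at
   most d * d. These are almost all indices; elsewhere [x i] is kept. *)
pose P i y := y \in vint_in K /\ (d ≺ peval (djets der (x i)) (Gi i)^`() ->
  peval (djets der (x i)) (Gi i) ≼ d * d -> peval (djets der y) (Gi i) = 0 /\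
  forall e, peval (djets der (x i)) (Gi i) ≼ e * d -> y - x i ≼ e).
have exP i : exists y, P i y.
  have [[h1 h2]|nh] := EM (d ≺ peval (djets der (x i)) (Gi i)^`() /\
    peval (djets der (x i)) (Gi i) ≼ d * d).
    have [y [y1 y2 y3]] := hensel_point Kmono Kd (GiK i) (xB i) h1 d0 h2.
    by exists y; split.
  by exists (x i); split=> [//|h1 h2]; case: nh.
have [x' hx'] := choice exP.
have big : U (fun i => d ≺ peval (djets der (x i)) (Gi i)^`() /\
    peval (djets der (x i)) (Gi i) ≼ d * d).
  apply: Us (UI (Uc dS) (gI e De)) => i [h1 h2]; split.
    by rewrite -GiE'; apply/negP.
  by rewrite -GiE; apply: vle_trans h2 le.
exists x'; split.
- by apply/asboolP => i; case: (hx' i).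
- apply/asboolP => f Df; have [g Dg leg] := D_mul Df Dd.
  apply: Us (UI big (gI g Dg)) => i [[h1 h2] h3].
  have [_ /(_ h1 h2)[_ h]] := hx' i; apply: h; rewrite -GiE.
  exact: vle_trans h3 leg.
apply/asboolP; apply: Us big => i [h1 h2].
by have [_ /(_ h1 h2)[h _]] := hx' i; rewrite -h -GiE.
Qed.

Lemma fam_lift (E : subringClosed (fam L)) x : lift_in_fam E -> x \in famB ->
  exists E' : subringClosed (fam L),
    [/\ lift_in_fam E', {subset E <= E'} & exists2 x', x' \in E' & x' - x \in famI].
Proof.
move=> hE xB; apply: (@lift_element (fam L) fam_der famB famZ famI) => //.
- by move=> f g; apply/funext => i; apply: derM.
- move=> f /asboolP fB; apply/asboolP => i; exact: (@jet_vint _ _ _ Kmono 1).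
- move=> f /asboolP fZ; apply/asboolP => d Dd.
  by apply: Us fZ => i ->; apply: v0le.
- move=> b f /asboolP bB /asboolP fZ; apply/asboolP; apply: Us fZ => i f0.
  by rewrite -[LHS]/(b i * f i) f0 mulr0.
- move=> b f /asboolP bB /asboolP fI; apply/asboolP => d Dd; apply: Us (fI d Dd) => i fd.
  by apply: (@vle_1M _ _ (f i) d (b i)) => //; case/vint_inP: (bB i).
- move=> f _ /asboolP fZ; apply/asboolP; apply: Us fZ => i f0.
  by rewrite -[LHS]/(der (f i)) f0 raddf0.
- move=> f /asboolP fB /asboolP fI; apply/asboolP => d Dd; apply: Us (fI d Dd) => i fd.
  by apply: vle_trans fd; have /vint_inP[fK _] := fB i; case: (Kmono fK).
- move=> f g _ _ /asboolP fgZ /asboolP nfZ; apply/asboolP.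
  apply: Us (UI fgZ (Uc nfZ)) => i [/eqP]; rewrite -[X in X == 0]/(f i * g i) mulf_eq0.
  by case/orP=> /eqP.
- move=> n f n0 _ /asboolP fI; apply/asboolP => d Dd; apply: Us (fI d Dd) => i.
  by rewrite -[X in X ≼ d -> _]/(at_ i (f *+ n)) raddfMn /= -mulr_natl vle_natM.
- exact: fam_hensel.
Qed.

Lemma fam_lift_const (E0 : subringClosed L) : lift_in_L K D E0 ->
  exists E : subringClosed (fam L), lift_in_fam E /\ forall c, c \in E0 -> fam_cst c \in E.
Proof.
move=> [E0B E0d E0Z].
have cl : subring_closed (fun f : fam L => `[< exists2 c, c \in E0 & f = fam_cst c >]).
  split; first by apply/asboolP; exists 1; rewrite ?rpred1.
    move=> f g /asboolP[c cE ->] /asboolP[c' cE' ->]; apply/asboolP.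
    by exists (c - c'); rewrite ?rpredB.
  move=> f g /asboolP[c cE ->] /asboolP[c' cE' ->]; apply/asboolP.
  by exists (c * c'); rewrite ?rpredM.
have [E EP] := pack_subring cl; exists E; split; last first.
  by move=> c cE; rewrite EP; apply/asboolP; exists c.
split=> f; rewrite EP => /asboolP[c cE ->].
- by apply/asboolP => i; apply: E0B.
- by rewrite EP; apply/asboolP; exists (der c) => //; apply: E0d.
move=> /asboolP cI; apply/asboolP; apply: Uall => i; apply/eqP.
have : c \in @zero_pred H L; last by rewrite inE.
by apply: E0Z => //; apply/inf_predP => d Dd; have [j] := Uex (cI d Dd).
Qed.

Lemma fam_lift_vars (E0 : subringClosed L) N (z : nat -> fam L) :
  lift_in_L K D E0 -> (forall j, z j \in famB) -> (forall j, (N <= j)%N -> z j = 0) ->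
  exists E : subringClosed (fam L), exists z' : nat -> fam L,
    [/\ lift_in_fam E, forall c, c \in E0 -> fam_cst c \in E, forall j, z' j \in E,
       forall j, (N <= j)%N -> z' j = 0 & forall j, z' j - z j \in famI].
Proof.
move=> hE0 zB z0; have [E [hE hc]] := fam_lift_const hE0.
suff: forall n, exists E : subringClosed (fam L), exists z' : nat -> fam L,
    [/\ lift_in_fam E, forall c, c \in E0 -> fam_cst c \in E, forall j, z' j \in E,
       forall j, (n <= j)%N -> z' j = 0 & forall j, (j < n)%N -> z' j - z j \in famI].
  move=> /(_ N)[E' [z' [h1 h2 h3 h4 h5]]]; exists E', z'; split=> // j.
  by have [/h5 //|h] := ltnP j N; rewrite h4 // z0 // subrr rpred0.
elim=> [|n [E1 [z1 [h1 h2 h3 h4 h5]]]]; first by exists E, (fun=> 0); split=> // j; rewrite ?rpred0 ?ltn0.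
have [E2 [l2 s2 [y yE yz]]] := fam_lift h1 (zB n).
exists E2, (fun j => if j == n then y else z1 j); split=> //.
- by move=> c /h2 /s2.
- by move=> j; case: eqP => // _; apply: s2.
- by move=> j lt; rewrite gtn_eqF // h4 // ltnW.
- by move=> j; rewrite ltnS leq_eqVlt; case: eqP => [-> //|_ /=]; apply: h5.
Qed.

Lemma fam_teval_in (E : subringClosed (fam L)) (E0 : {pred L}) (z : nat -> fam L) t :
  lift_in_fam E -> (forall c, c \in E0 -> fam_cst c \in E) -> (forall j, z j \in E) ->
  tconst E0 t -> (fun i => teval (fun j => z j i) t) \in E.
Proof.
move=> [_ Ed _] cE zE; elim: t => [c /cE|j _|t1 h1 t2 h2 /andP[/h1 {}h1 /h2 {}h2]
  |t1 h1 t2 h2 /andP[/h1 {}h1 /h2 {}h2]|t1 h1 /h1 {}h1] //=.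
- exact: (rpredD h1 h2).
- by apply: (@rpredM _ E _ _ h1 h2).
- exact: (Ed _ h1).
Qed.

Lemma fam_teval_near (z z' : nat -> fam L) t : (forall j, z j \in famB) ->
  (forall j, z' j \in famB) -> (forall j, z' j - z j \in famI) -> tconst (vint_in K) t ->
  forall d, D d -> U (fun i => teval (fun j => z' j i) t - teval (fun j => z j i) t ≼ d).
Proof.
move=> zB z'B zz'.
have zBi i j : z j i \in vint_in K by have /asboolP := zB j.
have zBi' i j : z' j i \in vint_in K by have /asboolP := z'B j.
have tB i t' : tconst (vint_in K) t' -> teval (fun j => z j i) t' \in vint_in K /\
    teval (fun j => z' j i) t' \in vint_in K.
  elim: t' => [c cK|j _|t1 h1 t2 h2 /andP[/h1[a1 b1] /h2[a2 b2]]
  |t1 h1 t2 h2 /andP[/h1[a1 b1] /h2[a2 b2]]|t1 h1 /h1[a1 b1]] //=.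
  - by split; apply: rpredD.
  - by split; apply: rpredM.
  - by split; apply: (@jet_vint _ _ _ Kmono 1).
elim: t => [c cK|j _|t1 h1 t2 h2 /andP[c1 c2]
  |t1 h1 t2 h2 /andP[c1 c2]|t1 h1 c1] d Dd //=.
- by apply: Uall => i; rewrite subrr v0le.
- by have /asboolP := zz' j; apply.
- apply: Us (UI (h1 c1 d Dd) (h2 c2 d Dd)) => i [e1 e2].
  by rewrite opprD addrACA vleD.
- apply: Us (UI (h1 c1 d Dd) (h2 c2 d Dd)) => i [e1 e2].
  have [/vint_inP[_ a1] _] := tB i _ c1; have [_ /vint_inP[_ b2]] := tB i _ c2.
  have mulB (x1 y1 x2 y2 : L) : x1 * x2 - y1 * y2 = x2 * (x1 - y1) + y1 * (x2 - y2) by ring.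
  by rewrite mulB; apply: vleD; apply: vle_1M.
- apply: Us (h1 c1 d Dd) => i e; rewrite -(raddfB (@der L)); apply: vle_trans e.
  have [b a] := tB i t1 c1; have /vint_inP[abK _] := rpredB a b.
  by case: (Kmono abK).
Qed.

End UltraLift.

(* The approximate solutions form a family; moved into a partial lift of the
   ultraproduct, its infinitesimal terms vanish at almost every index, and any
   such index gives the tuple. *)
Theorem swap_quantifiers N m (t : nat -> dterm L) (A : L -> (nat -> L) -> Prop) :
  (forall i, (i < m)%N -> tconst (vint_in K) (t i)) ->
  (forall d, D d -> exists z, [/\ A d z, forall j, z j \in vint_in K,
     forall j, (N <= j)%N -> z j = 0 & forall i, (i < m)%N -> teval z (t i) ≼ d]) ->
  forall d, D d -> exists e z0 z, [/\ D e /\ e ≼ d, A e z0,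
     forall j, z j \in vint_in K /\ z j - z0 j ≼ d, forall j, (N <= j)%N -> z j = 0 &
     forall i, (i < m)%N -> infinitesimal D (teval z (t i))].
Proof.
move=> tK hyp d0 Dd0.
have [U [Us UI Uex Uc Ut]] := tail_ultrafilter.
have [E0 [t' [hE0 ht']]] := lift_terms Kmono Kd D_ex D_small D_mul tK.
(* The index itself is the allowed error. Outside D the zero tuple serves as default. *)
pose P i (zi : nat -> L) := [/\ forall j, zi j \in vint_in K, forall j, (N <= j)%N -> zi j = 0 &
    D i -> A i zi /\ forall k, (k < m)%N -> teval zi (t k) ≼ i].
have exP i : exists zi, P i zi.
  have [/hyp[zi [h1 h2 h3 h4]]|nD] := EM (D i); first by exists zi; split.
  by exists (fun=> 0); split=> // j; rewrite rpred0.
have [z hz] := choice exP.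
pose zf (j : nat) : fam L := fun i => z i j.
have zfB j : zf j \in famB by apply/asboolP => i; case: (hz i) => h _ _; apply: h.
have zf0 j : (N <= j)%N -> zf j = 0.
  by move=> le; apply/funext => i; case: (hz i) => _ h _; apply: h.
have [E [z' [hE hc z'E z'0 zz']]] :=
  fam_lift_vars Us UI Uex Uc Ut hE0 zfB zf0.
have z'B j : z' j \in famB by case: hE => B _ _; apply: B.
have zero k : (k < m)%N -> U (fun i => teval (fun j => z' j i) (t' k) = 0).
  move=> lt; have [c n] := ht' k lt.
  have cB : tconst (vint_in K) (t' k) by apply: tconst_sub c; case: hE0.
  have fE := fam_teval_in hE hc z'E c.
  (* This family lies in the lift, so membership in [famI] already makes it vanish almost
     everywhere. For each d its value is small for three reasons: z' is close to z, t' differs from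
     t by infinitesimals, and the residual of t at [z i] is at most i, which is eventually at most
     d. *)
  suff: (fun i => teval (fun j => z' j i) (t' k)) \in famI U.
    by case: hE => _ _ /(_ _ fE) h /h /asboolP.
  apply/asboolP => d Dd.
  apply: (Us _ _ _ (UI _ _ (fam_teval_near Us UI Ut zfB z'B zz' cB Dd) (Ut d Dd))) => i [e1 [Di id]].
  have [zK _ /(_ Di)[_ /(_ k lt) h]] := hz i; have [_ _ /(_ d Dd) e2] := n _ zK.
  apply: vle_swap e1 _; rewrite -(subKr (teval (z i) (t k)) (teval _ (t' k))).
  by apply: vleB => //; apply: vle_trans h id.
have zeros : U (fun i => forall k, (k < m)%N -> teval (fun j => z' j i) (t' k) = 0).
  elim: {hyp tK ht' P exP hz} m zero => [_|n IH h]; first exact: (Uall Us Ut).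
  apply: (Us _ _ _ (UI _ _ (IH (fun k lt => h k (ltnW lt))) (h n (ltnSn n)))) => i [a b] k.
  by rewrite ltnS leq_eqVlt => /predU1P[->|/a].
have near : U (fun i => forall j, z' j i - z i j ≼ d0).
  suff: U (fun i => forall j, (j < N)%N -> z' j i - z i j ≼ d0).
    apply: (Us _ _ _) => i h j; have [/h//|le] := ltnP j N.
    by rewrite z'0 // -[z i j]/(zf j i) zf0 // subrr v0le.
  elim: {z'0 zf0 hyp P exP hz} N => [|n IH]; first exact: (Uall Us Ut).
  have /asboolP/(_ d0 Dd0) h := zz' n.
  by apply: (Us _ _ _ (UI _ _ IH h)) => i [a b] j; rewrite ltnS leq_eqVlt => /predU1P[->|/a].
have [i [[Di id] [h1 h2]]] := Uex _ (UI _ _ (Ut d0 Dd0) (UI _ _ zeros near)).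
have [_ _ /(_ Di)[Ai _]] := hz i.
exists i, (z i), (fun j => z' j i); split=> //.
- by move=> j; split=> //; have /asboolP := z'B j.
- by move=> j le; rewrite z'0.
move=> k lt d Dd; have [c n] := ht' k lt.
have z'K j : z' j i \in vint_in K by have /asboolP := z'B j.
by have [_ _ /(_ d Dd)] := n _ z'K; rewrite h1 // subr0.
Qed.

End SwapQuantifiers.

(** * Exact zeros of systems over an intermediate field *)

Section Exact.
Variables (H : oagType) (L : valuedDiffFieldType H).
Variable K : divringClosed L.
Hypothesis Kmono : mono_subfield K.
Hypothesis Kd : dhens K.

(** Kept extensional, so that equations can be assembled as functions and the terms demanded by
    [swap_quantifiers] recovered only at the end. *)
Definition dmap (f : (nat -> L) -> L) : Prop :=
  exists2 t, tconst (vint_in K) t & forall z, f z = teval z t.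

Lemma dmap_const c : c \in vint_in K -> dmap (fun=> c).
Proof. by move=> cK; exists (DConst c). Qed.

Lemma dmap_var j : dmap (fun z => z j).
Proof. by exists (DVar _ j). Qed.

Lemma dmap_add f g : dmap f -> dmap g -> dmap (fun z => f z + g z).
Proof.
move=> [t tK ft] [u uK gu]; exists (DAdd t u) => [/=|z /=]; first by rewrite tK.
by rewrite ft gu.
Qed.

Lemma dmap_mul f g : dmap f -> dmap g -> dmap (fun z => f z * g z).
Proof.
move=> [t tK ft] [u uK gu]; exists (DMul t u) => [/=|z /=]; first by rewrite tK.
by rewrite ft gu.
Qed.

Lemma dmap_der f : dmap f -> dmap (fun z => der (f z)).
Proof. by move=> [t tK ft]; exists (DDer t) => [//|z /=]; rewrite ft. Qed.

Lemma dmap_sum n (f : nat -> (nat -> L) -> L) :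
  (forall i, (i < n)%N -> dmap (f i)) -> dmap (fun z => \sum_(i < n) f i z).
Proof.
elim: n => [|n IH] h.
  have [t tK ft] := dmap_const (rpred0 (vint_in K)).
  by exists t => // z; rewrite big_ord0 -ft.
have [|t tK ft] := IH; first by move=> i lt; apply: h; apply: ltnW.
have [u uK gu] := h n (ltnSn n); exists (DAdd t u) => [/=|z]; first by rewrite tK.
by rewrite big_ord_recr /= ft gu.
Qed.

Lemma dmap_ext f g : (forall z, f z = g z) -> dmap f -> dmap g.
Proof. by move=> fg [t tK ft]; exists t => // z; rewrite -fg. Qed.

Lemma dmap_vint f z : dmap f -> (forall j, z j \in vint_in K) -> f z \in vint_in K.
Proof.
move=> [t tK ->] zK; elim: t tK => [c|j|t1 h1 t2 h2|t1 h1 t2 h2|t1 h1] //=.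
- by case/andP=> /h1 ? /h2 ?; apply: rpredD.
- by case/andP=> /h1 ? /h2 ?; apply: rpredM.
- by move/h1; apply: (@jet_vint _ _ _ Kmono 1).
Qed.

Definition tuple_in N (z : nat -> L) : Prop :=
  (forall j, z j \in vint_in K) /\ (forall j, (N <= j)%N -> z j = 0).

(* The case of [swap_quantifiers] where Newton's method squares residuals: the
   attained residuals are then closed under multiplication, so a zero exists. *)
Lemma newton_zero N m (f : nat -> (nat -> L) -> L) (P : (nat -> L) -> Prop) :
  (forall i, (i < m)%N -> dmap (f i)) ->
  (forall z z0, P z0 -> tuple_in N z -> (forall j, z j - z0 j ≺ 1) -> P z) ->
  (exists z d, [/\ P z, tuple_in N z, d != 0 /\ d ≺ 1 & forall i, (i < m)%N -> f i z ≼ d]) ->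
  (forall z d, P z -> tuple_in N z -> d != 0 -> d ≺ 1 ->
    (forall i, (i < m)%N -> f i z ≼ d) ->
    exists z', [/\ P z', tuple_in N z' & forall i, (i < m)%N -> f i z' ≼ d * d]) ->
  exists z, [/\ P z, tuple_in N z & forall i, (i < m)%N -> f i z = 0].
Proof.
move=> fd Pstable [z1 [d1 [Pz1 z1N [d1n0 d1lt] hz1]]] newton.
pose D d := [/\ d != 0, d ≺ 1 &
  exists z, [/\ P z, tuple_in N z & forall i, (i < m)%N -> f i z ≼ d]].
have D2 d : D d -> D (d * d).
  move=> [d0 dlt [z [Pz zN hz]]]; split; rewrite ?mulf_neq0 //.
    by apply: vlt_M1 => //; apply: vlt_le.
  exact: newton zN d0 dlt hz.
have Dex : exists d, D d by exists d1; split=> //; exists z1.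
have Dsm d : D d -> d != 0 /\ d ≺ 1 by case.
have Dmul d e : D d -> D e -> exists2 g, D g & g ≼ d * e.
  move=> Dd De; case/orP: (vle_total d e) => le.
    by exists (d * d); [apply: D2 | apply: vleM].
  by exists (e * e); [apply: D2 | apply: vleM].
have exT : forall i, exists t, (i < m)%N -> tconst (vint_in K) t /\ forall z, f i z = teval z t.
  move=> i; have [/fd[t tK ft]|ge] := ltnP i m; first by exists t.
  by exists (DConst 0).
have [t ht] := choice exT.
have tK i : (i < m)%N -> tconst (vint_in K) (t i) by move=> lt; case: (ht i lt).
have hyp d : D d -> exists z, [/\ P z /\ tuple_in N z, forall j, z j \in vint_in K,
    forall j, (N <= j)%N -> z j = 0 & forall i, (i < m)%N -> teval z (t i) ≼ d].
  move=> [d0 dlt [z [Pz [zK z0] hz]]]; exists z; split=> // i lt.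
  by case: (ht i lt) => _ <-; apply: hz.
have Dd1 : D d1 by split=> //; exists z1.
have [e [z0 [z [[De ed] [Pz0 z0N] zz0 zN hz]]]] :=
  swap_quantifiers Kmono Kd Dex Dsm Dmul (A := fun _ z => P z /\ tuple_in N z) tK hyp Dd1.
have zin : tuple_in N z by split=> [j|//]; case: (zz0 j).
have Pz : P z.
  by apply: Pstable Pz0 zin _ => j; have [_ h] := zz0 j; apply: vle_lt_trans h d1lt.
exists z; split=> // i lt; apply/eqP; apply: contraT => nz.
have [k ltk kmax] := vle_max (fun i => f i z) (leq_ltn_trans (leq0n i) lt).
have inf k' : (k' < m)%N -> infinitesimal D (f k' z).
  by move=> lt'; case: (ht k' lt') => _ ->; apply: hz.
have fk0 : f k z != 0 by apply: vle_neq0 (kmax i lt) nz.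
have fk1 : f k z ≺ 1 by apply: inf_le1 (inf k ltk).
have Dk : D (f k z) by split=> //; exists z.
have := inf k ltk _ (D2 _ Dk); rewrite -{1}[f k z]mulr1 vle_pM2l // => h.
by have := vlt_le_trans fk1 h; rewrite vlt_irr.
Qed.

End Exact.

(** * Linear systems and division with bounded coefficients *)

Section LinearSystems.
Variables (H : oagType) (L : valuedDiffFieldType H).
Variable K : divringClosed L.

(** Elimination of the last unknown: its pivot 1 + M n n is a unit, and the reduced matrix is again
    1 plus an infinitesimal matrix, so neither [K] nor the ball is left. *)
Lemma lin_solve d n (M : nat -> nat -> L) (b : nat -> L) :
  (forall i j, M i j \in K /\ M i j ≺ 1) -> (forall i, b i \in vball K d) ->
  exists x : nat -> L, (forall j, x j \in vball K d) /\
    forall i, (i < n)%N -> x i + \sum_(j < n) M i j * x j = b i.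
Proof.
elim: n M b => [|n IH] M b hM hb; first by exists (fun=> 0); split=> // j; apply: rpred0.
pose u := 1 + M n n.
have [MK M1] := hM n n.
have uK : u \in K by rewrite rpredD ?rpred1.
have u1 : 1 ≼ u by apply: vle_addr.
have u0 : u != 0 by apply: vle_neq0 u1 (oner_neq0 _).
have uV : u^-1 \in vint_in K.
  by apply/vint_inP; rewrite rpredV // -[_^-1]mul1r vdiv_le // mul1r.
have Mint i j : M i j \in vint_in K.
  by have [? ?] := hM i j; apply/vint_inP; split=> //; apply: vlt_le.
have [|| x [xd xE]] := IH (fun i j => M i j - M i n * u^-1 * M n j)
    (fun i => b i - M i n * u^-1 * b n).
- move=> i j; have [iK i1] := hM i j; have [nK n1] := hM i n; have [jK j1] := hM n j.
  split; first by rewrite rpredB ?rpredM ?rpredV.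
  apply: vltB => //; rewrite -mulrA; apply: vlt_M1 => //.
  by apply: vle_M1; [case/vint_inP: uV | apply: vlt_le].
- move=> i; apply: rpredB => //; apply: vballM => //; apply: rpredM => //.
pose y := u^-1 * (b n - \sum_(j < n) M n j * x j).
have yd : y \in vball K d.
  by apply: vballM => //; apply: rpredB => //; apply: rpred_sum => j _; apply: vballM.
exists (fun j => if j == n then y else x j); split=> [j|i]; first by case: eqP.
have sE k : \sum_(j < n.+1) M k j * (if (j : nat) == n then y else x j) =
    \sum_(j < n) M k j * x j + M k n * y.
  rewrite big_ord_recr /= eqxx; congr (_ + _); apply: eq_bigr => j _.
  by rewrite ltn_eqF.
rewrite sE ltnS leq_eqVlt => /predU1P[->|lt].
  rewrite eqxx addrCA -[X in _ + (X + _)]mul1r -mulrDl -/u /y mulVKf //.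
  by rewrite addrC subrK.
rewrite (ltn_eqF lt); have := xE i lt.
under eq_bigr => j _ do rewrite mulrBl -[_ * M n j * _]mulrA.
rewrite sumrB -mulr_sumr /y -{2}[b i](subrK (M i n * u^-1 * b n)) => <-.
by move: (\sum_(j < n) _) (\sum_(j < n) _) (u^-1) => S1 S2 v; ring.
Qed.

Lemma polyOver_vballM d e (p q : {poly L}) : p \is a polyOver (vball K d) ->
  q \is a polyOver (vball K e) -> p * q \is a polyOver (vball K (d * e)).
Proof.
move=> /polyOverP pd /polyOverP qe; apply/polyOverP => i; rewrite coefM.
apply: rpred_sum => j _; have /vballP[a b] := pd j; have /vballP[a' b'] := qe (i - j)%N.
by apply/vballP; rewrite rpredM // vleM.
Qed.

Lemma polyOver_vball1 (p : {poly L}) :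
  (p \is a polyOver (vint_in K)) = (p \is a polyOver (vball K 1)).
Proof. by apply/polyOverP/polyOverP => h i; have := h i; rewrite !inE. Qed.

Lemma polyOver_vintM d (p q : {poly L}) : p \is a polyOver (vint_in K) ->
  q \is a polyOver (vball K d) -> p * q \is a polyOver (vball K d).
Proof. by rewrite polyOver_vball1 => pd qe; rewrite -[d]mul1r polyOver_vballM. Qed.

Lemma monic_division d (f g : {poly L}) : g \is monic -> g \is a polyOver (vint_in K) ->
  f \is a polyOver (vball K d) ->
  f %% g \is a polyOver (vball K d) /\ f %/ g \is a polyOver (vball K d).
Proof.
move=> gm gK; have [n] := ubnP (size f); elim: n f => // n IH f; rewrite ltnS => le fd.
have g0 := monic_neq0 gm; have [lt|ge] := ltnP (size f) (size g).
  by rewrite modp_small // divp_small // rpred0.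
have [f0|f0] := eqVneq f 0; first by rewrite f0 mod0p div0p rpred0.
pose U := lead_coef f *: 'X^(size f - size g).
have Ud : U \is a polyOver (vball K d).
  apply/polyOverP => i; rewrite coefZ coefXn mulrC; apply: vballM; first exact: rpred_nat.
  by rewrite lead_coefE; apply: (polyOverP fd).
have f1d : f - U * g \is a polyOver (vball K d).
  by rewrite rpredB // mulrC polyOver_vintM.
have sU : size (U * g) = size f.
  rewrite size_proper_mul; last first.
    by rewrite lead_coefZ lead_coefXn mulr1 (monicP gm) mulr1 lead_coef_eq0.
  rewrite size_scale ?lead_coef_eq0 // size_polyXn addSn /= subnK //.
have sf : (0 < size f)%N by rewrite size_poly_gt0.
have lt1 : (size (f - U * g)%R < n)%N.
  apply: leq_trans le; rewrite -[X in (_ < X)%N](prednK sf) ltnS.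
  apply/leq_sizeP => k; rewrite leq_eqVlt => /predU1P[<-|lt].
    have : lead_coef (U * g) = lead_coef f.
      by rewrite lead_coefM (monicP gm) lead_coefZ lead_coefXn !mulr1.
    by rewrite coefB [lead_coef (U * g)]lead_coefE sU => ->; rewrite lead_coefE subrr.
  have hk : (size f <= k)%N by rewrite -(prednK sf).
  by rewrite coefB !nth_default ?subrr ?sU.
have [h1 h2] := IH _ lt1 f1d.
rewrite -(subrK (U * g) f) modpD divpD modp_mull addr0 mulpK //; split=> //.
exact: rpredD.
Qed.

End LinearSystems.

(** * Factorization and minimal polynomials *)

Section HenselFactor.
Variables (H : oagType) (L : valuedDiffFieldType H).
Variable K : divringClosed L.
Hypothesis Kmono : mono_subfield K.
Hypothesis Kd : dhens K.

Lemma modp_linear (g : {poly L}) n (x : nat -> L) :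
  (\poly_(k < n) x k) %% g = \sum_(k < n) x k *: ('X^k %% g).
Proof.
rewrite poly_def; under [RHS]eq_bigr => k _ do rewrite -modpZl.
by apply: (big_morph (fun p => p %% g)) => [p r|]; rewrite ?modpD ?mod0p.
Qed.

Section Factor.
Variables (n j : nat) (q : {poly L}).
Hypothesis jn : (j <= n)%N.
Hypothesis qK : q \is a polyOver (vint_in K).
Hypothesis sq : (size q <= n.+1)%N.
Hypothesis qj : 1 ≼ q`_j.
Hypothesis qhigh : forall i, (j < i)%N -> q`_i ≺ 1.

(** The first [j] unknowns are the lower coefficients of the monic factor, the next n - j + 1 the
    coefficients of its cofactor. *)
Let gp (z : nat -> L) : {poly L} := 'X^j + \poly_(a < j) z a.
Let hp (z : nat -> L) : {poly L} := \poly_(b < (n - j).+1) z (j + b)%N.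

Let gpE z k : (gp z)`_k = (k == j)%:R + (if (k < j)%N then z k else 0).
Proof. by rewrite coefD coefXn coef_poly. Qed.

Let gp_size z : size (gp z) = j.+1.
Proof. by rewrite size_polyDl size_polyXn // ltnS size_poly. Qed.

Let gp_monic z : gp z \is monic.
Proof.
by rewrite monicE lead_coefE gp_size /= gpE eqxx ltnn addr0.
Qed.

Let hp_size z : (size (hp z) <= (n - j).+1)%N.
Proof. exact: size_poly. Qed.

Let gp_in z : (forall k, z k \in vint_in K) -> gp z \is a polyOver (vint_in K).
Proof.
move=> zK; apply/polyOverP => k; rewrite gpE rpredD ?rpred_nat //.
by case: ifP => // _; apply: rpred0.
Qed.

Let hp_in z : (forall k, z k \in vint_in K) -> hp z \is a polyOver (vint_in K).
Proof.
by move=> zK; apply/polyOverP => k; rewrite coef_poly; case: ifP => // _; apply: rpred0.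
Qed.

Let res i z := (gp z * hp z - q)`_i.

Let res_dmap i : dmap K (res i).
Proof.
have cK c : c \in vint_in K -> dmap K (fun=> c) by apply: dmap_const.
have gd k : dmap K (fun z => (gp z)`_k).
  apply: (@dmap_ext _ _ _ (fun z => (k == j)%:R + (if (k < j)%N then z k else 0))) => [z|].
    by rewrite (gpE z k).
  apply: dmap_add; first by apply: cK; apply: rpred_nat.
  by case: (k < j)%N; [apply: dmap_var | apply: cK; apply: rpred0].
have hd k : dmap K (fun z => (hp z)`_k).
  apply: (@dmap_ext _ _ _ (fun z => if (k < (n - j).+1)%N then z (j + k)%N else 0)) => [z|].
    by rewrite coef_poly.
  by case: (k < (n - j).+1)%N; [apply: dmap_var | apply: cK; apply: rpred0].
apply: (@dmap_ext _ _ _ (fun z => \sum_(k < i.+1) (gp z)`_k * (hp z)`_(i - k) + (- q`_i))) => [z|].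
  by rewrite /res coefB coefM.
apply: dmap_add; last by apply: cK; rewrite rpredN; apply: (polyOverP qK).
apply: (@dmap_sum _ _ _ _ (fun k z => (gp z)`_k * (hp z)`_(i - k))) => k _.
exact: dmap_mul.
Qed.

Let size_gh z : (size (gp z * hp z)%R <= n.+1)%N.
Proof.
apply: leq_trans (size_polyMleq _ _) _; rewrite gp_size /=.
by apply: leq_trans (leq_add (leqnn j) (hp_size z)) _; rewrite addnS subnKC.
Qed.

Let near z := z j - q`_j ≺ 1 /\ forall b, (j < b)%N -> z b ≺ 1.

Let qj0 : q`_j != 0.
Proof. exact: vle_neq0 qj (oner_neq0 _). Qed.

Let qjV : (q`_j)^-1 \in vint_in K.
Proof.
have /vint_inP[qjK _] := polyOverP qK j; apply/vint_inP; rewrite rpredV qjK.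
by rewrite -[_^-1]mul1r vdiv_le ?mul1r.
Qed.

Let newton_step z d : near z -> tuple_in K n.+1 z -> d != 0 -> d ≺ 1 ->
  (forall i, (i < n.+1)%N -> res i z ≼ d) ->
  exists z', [/\ near z', tuple_in K n.+1 z' & forall i, (i < n.+1)%N -> res i z' ≼ d * d].
Proof.
move=> [zj zb] [zK z0] d0 dlt hz; pose g := gp z; pose h := hp z; pose u := z j.
have gK : g \is a polyOver (vint_in K) by apply: gp_in.
have hK : h \is a polyOver (vint_in K) by apply: hp_in.
have u1 : 1 ≼ u.
  by rewrite /u -[z j](subrK q`_j) addrC vle_addr_iff.
have u0 : u != 0 by apply: vle_neq0 u1 (oner_neq0 _).
have uV : u^-1 \in vint_in K.
  have /vint_inP[uK _] := zK j.
  by apply/vint_inP; rewrite rpredV uK -[_^-1]mul1r vdiv_le ?mul1r.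
pose e := q - g * h.
have ed : e \is a polyOver (vball K d).
  apply/polyOverP => i; have [lt|ge] := ltnP i n.+1; last first.
    rewrite coefB (nth_default _ (leq_trans sq ge)) (nth_default _ (leq_trans (size_gh z) ge)).
    by rewrite subrr rpred0.
  apply/vballP; split; last by rewrite /e -opprB coefN vleN; apply: hz.
  have : e \is a polyOver (vint_in K) by rewrite rpredB ?rpredM.
  by move=> /polyOverP/(_ i)/vint_inP[].
pose h1 := h - u%:P.
have h1E b : h1`_b \in K /\ h1`_b ≺ 1.
  have /vint_inP[hbK hb1] := polyOverP hK b; have /vint_inP[uK _] := zK j.
  rewrite coefB coefC; split; first by case: eqP; rewrite rpredB ?rpred0.
  case: b {hb1} hbK => [|b] _; rewrite /h coef_poly /=.
    by rewrite addn0 subrr.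
  rewrite subr0; case: ifP => // _; apply: zb; rewrite -{1}[j]addn0 ltn_add2l //.
(* The corrections must satisfy g * eta + h * gam = e. Write h = u + h1 with h1 infinitesimal and
   take f = g * eta + u * gam as the unknown: division of f by g returns eta and gam, and the
   equation becomes f + u^-1 h1 (f %% g) = e, a system of the form 1 + M. *)
pose M i k := (u^-1 *: (h1 * ('X^k %% g)))`_i.
have XgK k : ('X^k %% g) \is a polyOver (vint_in K).
  have := @monic_division _ _ K 1 'X^k g (gp_monic z) gK; rewrite -!polyOver_vball1.
  by case=> //; rewrite rpredX ?polyOverX.
have MK i k : M i k \in K /\ M i k ≺ 1.
  have /vint_inP[vK v1] := uV; rewrite /M coefZ coefM; split.
    rewrite rpredM // rpred_sum // => a _; rewrite rpredM //; first by case: (h1E a).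
    by have /vint_inP[] := polyOverP (XgK k) (i - a)%N.
  apply: vlt_1M => //; apply: vlt_sum => [|a _]; first exact: oner_neq0.
  apply: vlt_M1; first by case: (h1E a).
  by have /vint_inP[] := polyOverP (XgK k) (i - a)%N.
have [x [xd xE]] := lin_solve n.+1 MK (polyOverP ed).
pose f := \poly_(k < n.+1) x k.
have fd : f \is a polyOver (vball K d).
  by apply/polyOverP => k; rewrite coef_poly; case: ifP => // _; apply: rpred0.
have fE : f + u^-1 *: (h1 * (f %% g)) = e.
  apply/polyP => i; have [lt|ge] := ltnP i n.+1.
    rewrite -(xE i lt) coefD coef_poly lt; congr (_ + _).
    rewrite modp_linear mulr_sumr scaler_sumr coef_sum; apply: eq_bigr => k _.
    by rewrite -scalerAr scalerA mulrC -scalerA coefZ mulrC.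
  rewrite coefD coef_poly ltnNge ge /= add0r coefZ.
  rewrite [e`_i]nth_default; last first.
    apply: leq_trans ge; rewrite (leq_trans (size_polyD _ _)) // geq_max sq size_polyN.
    exact: size_gh.
  rewrite nth_default ?mulr0 //; apply: leq_trans ge.
  apply: leq_trans (size_polyMleq _ _) _.
  have s1 : (size h1 <= (n - j).+1)%N.
    rewrite (leq_trans (size_polyD _ _)) // geq_max hp_size size_polyN.
    by rewrite (leq_trans (size_polyC_leq1 _)).
  have s2 : (size (f %% g)%R <= j)%N.
    by rewrite -ltnS -(gp_size z) ltn_modp -size_poly_gt0 gp_size.
  apply: (@leq_trans ((n - j).+1 + j).-1); last by rewrite addSn /= subnK.
  by rewrite -!subn1 leq_sub2r // leq_add.
pose gam := u^-1 *: (f %% g); pose eta := f %/ g.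
have [fmd etad] := monic_division (gp_monic z) gK fd; rewrite -/eta -/g in fmd etad.
have gamd : gam \is a polyOver (vball K d).
  by apply/polyOverP => i; rewrite coefZ; apply: vballM => //; apply: (polyOverP fmd).
have lin : g * eta + h * gam = e.
  rewrite -fE /gam /h1 mulrBl scalerBr mul_polyC scalerA mulVf // scale1r -scalerAr.
  by rewrite {2}(divp_eq f g) -/eta; ring.
have sgam : (size gam <= j)%N.
  apply: leq_trans (size_scale_leq _ _) _.
  by rewrite -ltnS -(gp_size z) ltn_modp -size_poly_gt0 gp_size.
have seta : (size eta <= (n - j).+1)%N.
  rewrite /eta size_divp ?gp_size /=; last by rewrite -size_poly_gt0 gp_size.
  by rewrite -subSn // leq_sub2r // size_poly.
pose z' k := z k + (if (k < j)%N then gam`_k else eta`_(k - j)).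
have z'K k : z' k \in vint_in K /\ z' k - z k \in vball K d.
  have cd : (if (k < j)%N then gam`_k else eta`_(k - j)) \in vball K d.
    by case: ifP => _; apply/polyOverP.
  split; last by rewrite /z' addrC addKr.
  apply: rpredD => //; move: cd => /vballP[cK cd]; apply/vint_inP; split=> //.
  by apply: vle_trans cd (vlt_le dlt).
have gE : gp z' = g + gam.
  apply/polyP => k; rewrite [RHS]coefD (gpE z') (gpE z) /z'; case: (ltnP k j) => lt; first by rewrite addrA.
  by rewrite [gam`__]nth_default ?addr0 // (leq_trans sgam).
have hE : hp z' = h + eta.
  apply/polyP => k; rewrite [RHS]coefD /hp !coef_poly /z'; case: ifP => lt.
    by rewrite ltnNge leq_addr /= addKn.
  by rewrite nth_default ?addr0 // (leq_trans seta) // leqNgt lt.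
exists z'; split.
- have small k : z' k - z k ≺ 1.
    by have [_ /vballP[_ h2]] := z'K k; apply: vle_lt_trans h2 dlt.
  split=> [|b lt]; first by rewrite -(subrK (z j) (z' j)) -addrA; apply: vltD (small j) zj.
  by apply: vlt_swap (small b) (zb b lt).
- split=> k; first by case: (z'K k).
  move=> le; rewrite /z' z0 // add0r ltnNge (leq_trans jn) /= ?(ltnW le) //.
  by rewrite nth_default // (leq_trans seta) // -subSn // leq_sub2r.
move=> i lt; have : gam * eta \is a polyOver (vball K (d * d)) by apply: polyOver_vballM.
move=> /polyOverP/(_ i)/vballP[_].
rewrite /res gE hE.
have -> : (g + gam) * (h + eta) - q = gam * eta; last by [].
by have := lin; rewrite /e => E; rewrite -[q](subrK (g * h)) -E; ring.
Qed.

(** Modulo infinitesimals [q] has degree [j], so it is a monic polynomial of degree [j] times the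
    constant q_j. This factorization is lifted by treating the coefficients of both factors as the
    unknowns of [newton_zero]. *)
Lemma hensel_factor : exists g h, [/\ g \is a polyOver K, h \is a polyOver K,
  q = g * h & size g = j.+1].
Proof.
have qjK : q`_j \in vint_in K by apply: (polyOverP qK).
(* The cofactor starts as the constant q_j. The product then agrees with [q] up to degree [j] and
   misses only the infinitesimal coefficients above. *)
pose z0 k := if (k < j)%N then q`_k / q`_j else if k == j then q`_j else 0.
have z0in : tuple_in K n.+1 z0.
  split=> k; rewrite /z0; last first.
    move=> lt; have hj := leq_ltn_trans jn lt.
    by rewrite (ltnNge k j) (ltnW hj) /= gtn_eqF.
  case: ifP => _; first by apply: rpredM => //; apply: (polyOverP qK).
  by case: ifP => // _; apply: rpred0.
have near0 : near z0.
  rewrite /near /z0 ltnn eqxx subrr; split=> // b lt.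
  by rewrite (ltnNge b j) (ltnW lt) /= gtn_eqF.
have res0 i : res i z0 = if (j < i)%N then - q`_i else 0.
  have hE : hp z0 = (q`_j)%:P.
    apply/polyP => k; rewrite coef_poly coefC /z0; case: k => [|k] /=.
      by rewrite addn0 ltnn eqxx.
    have -> : (j + k.+1 < j)%N = false by apply/negbTE; rewrite -leqNgt leq_addr.
    have -> : (j + k.+1 == j)%N = false by rewrite -{2}[j]addn0 eqn_add2l.
    by case: ifP.
  rewrite /res coefB hE coefMC gpE /z0; case: (ltngtP i j) => h.
  - by rewrite add0r divfK // subrr.
  - by rewrite addr0 mul0r sub0r.
  - by rewrite addr0 mul1r h subrr.
have fin z : tuple_in K n.+1 z -> (forall i, (i < n.+1)%N -> res i z = 0) ->
    exists g h, [/\ g \is a polyOver K, h \is a polyOver K, q = g * h & size g = j.+1].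
  move=> [zK _] h; have sub p : p \is a polyOver (vint_in K) -> p \is a polyOver K.
    by move=> /polyOverP pK; apply/polyOverP => i; have /vint_inP[] := pK i.
  exists (gp z), (hp z); split; rewrite ?sub ?gp_in ?hp_in ?gp_size //.
  apply/polyP => i; have [lt|ge] := ltnP i n.+1.
    by apply/eqP; rewrite eq_sym -subr_eq0 -coefB; apply/eqP; apply: h.
  by rewrite !nth_default // ?(leq_trans sq) // (leq_trans (size_gh z)).
have [k ltk kmax] := vle_max (fun i => res i z0) (ltn0Sn n).
have [rk0|rk0] := eqVneq (res k z0) 0.
  by apply: (fin z0 z0in) => i lt; apply/eqP; rewrite -vle0 -rk0 kmax.
have [||z [_ zin hz]] := newton_zero Kmono Kd (fun i _ => res_dmap i) _ _ newton_step.
- move=> z z1 [n1 n2] _ zz; split=> [|b lt]; last by apply: vlt_swap (zz b) (n2 b lt).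
  by rewrite -(subrK (z1 j) (z j)) -addrA; apply: vltD (zz j) n1.
- exists z0, (res k z0); split=> //; split=> //.
  by rewrite res0; case: ifP => // lt; rewrite vltN qhigh.
exact: fin zin hz.
Qed.

End Factor.
End HenselFactor.

(** * Valuations of the coefficients of minimal polynomials *)

Section MinimalPolynomials.
Variables (H : oagType) (L : valuedDiffFieldType H).
Variable K : divringClosed L.

Definition minpoly_over (a : L) (p : {poly L}) : Prop :=
  [/\ p \is monic, p \is a polyOver K, p.[a] = 0 &
      forall r, r \is a polyOver K -> r.[a] = 0 -> r != 0 -> (size p <= size r)%N].

Lemma minpoly_exists a p : p \is a polyOver K -> p != 0 -> p.[a] = 0 ->
  exists q, minpoly_over a q.
Proof.
move=> pK p0 pa.
pose P s := `[< exists q, [/\ q \is a polyOver K, q != 0, q.[a] = 0 & size q = s] >].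
have exP : exists s, P s by exists (size p); apply/asboolP; exists p.
case: (ex_minnP exP) => s /asboolP[q [qK q0 qa sq]] smin.
have lq0 : lead_coef q != 0 by rewrite lead_coef_eq0.
have lqK : lead_coef q \in K by rewrite lead_coefE; apply: (polyOverP qK).
exists ((lead_coef q)^-1 *: q); split.
- by rewrite monicE lead_coefZ mulVf.
- by apply/polyOverP => i; rewrite coefZ rpredM ?rpredV //; apply: (polyOverP qK).
- by rewrite hornerZ qa mulr0.
move=> r rK ra r0; rewrite size_scale ?invr_eq0 // sq; apply: smin.
by apply/asboolP; exists r.
Qed.

Lemma minpoly_gt1 a p : minpoly_over a p -> (1 < size p)%N.
Proof.
move=> [pm _ pa _]; rewrite ltnNge; apply/negP => le.
have sp : size p = 1%N by apply/eqP; rewrite eqn_leq le size_poly_gt0 monic_neq0.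
have p0 : p`_0 = 1 by have := monicP pm; rewrite lead_coefE sp.
have : p = 1 by rewrite [LHS](size1_polyC le) p0.
by move=> p1; move: pa; rewrite p1 hornerC => /eqP; rewrite oner_eq0.
Qed.

Lemma minpoly_small a p r : minpoly_over a p -> r \is a polyOver K -> r.[a] = 0 ->
  (size r < size p)%N -> r = 0.
Proof.
move=> [_ _ _ h] rK ra lt; apply/eqP; apply: contraT => r0.
by rewrite ltnNge h in lt.
Qed.

Definition revpoly (s : {poly L}) : {poly L} := \poly_(i < size s) s`_((size s).-1 - i).

Lemma revpolyE s a : a != 0 -> (revpoly s).[a] = a ^+ (size s).-1 * s.[a^-1].
Proof.
move=> a0; rewrite horner_poly horner_coef mulr_sumr (reindex_inj rev_ord_inj) /=.
apply: eq_bigr => i _; have lti := ltn_ord i.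
have le : (i <= (size s).-1)%N by rewrite -ltnS prednK //; apply: leq_trans lti.
have -> : (size s - i.+1 = (size s).-1 - i)%N by rewrite subnS -subn1 -subnDA addnC subnDA subn1.
rewrite subKn // [RHS]mulrCA; congr (_ * _).
by rewrite -[in RHS](subnK le) exprD exprVn mulfK // expf_neq0.
Qed.

Lemma minpoly_inv a p : minpoly_over a p -> a != 0 ->
  p`_0 != 0 /\ minpoly_over a^-1 ((p`_0)^-1 *: revpoly p).
Proof.
move=> mp a0; have [pm pK pa pmin] := mp; have gt1 := minpoly_gt1 mp.
have p0 : p`_0 != 0.
  apply/eqP => p00; pose r := \poly_(i < (size p).-1) p`_i.+1.
  have pE : p = r * 'X.
    apply/polyP => i; rewrite coefMX coef_poly; case: i => [|i] //=.
    by case: ifP => // /negbT; rewrite -leqNgt => h; rewrite nth_default // -(prednK (ltnW gt1)).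
  have rK : r \is a polyOver K.
    by apply/polyOverP => i; rewrite coef_poly; case: ifP => _; rewrite ?rpred0 ?(polyOverP pK).
  have ra : r.[a] = 0.
    by move: pa; rewrite pE hornerMX => /eqP; rewrite mulf_eq0 (negbTE a0) orbF => /eqP.
  have r0 : r = 0.
    apply: (minpoly_small mp rK ra); rewrite -[X in (_ < X)%N](prednK (ltnW gt1)).
    by rewrite ltnS size_poly.
  by move: (monic_neq0 pm); rewrite pE r0 mul0r eqxx.
have p0K : p`_0 \in K by apply: (polyOverP pK).
have revK s : s \is a polyOver K -> revpoly s \is a polyOver K.
  by move=> sK; apply/polyOverP => i; rewrite coef_poly; case: ifP => _; rewrite ?rpred0 ?(polyOverP sK).
have rev0 s : s != 0 -> revpoly s != 0.
  move=> s0; apply: contra_neq s0 => /(congr1 (fun u : {poly L} => u`_0)).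
  rewrite coef0 coef_poly subn0; case: ifP => [_ /eqP|/negbT].
    by rewrite -lead_coefE lead_coef_eq0 => /eqP.
  by rewrite -leqNgt leqn0 size_poly_eq0 => /eqP.
have srev s : (size (revpoly s) <= size s)%N by apply: size_poly.
have sr : size (revpoly p) = size p.
  apply/eqP; rewrite eqn_leq srev /=.
  apply: contraT; rewrite -ltnNge => lt.
  have := coef_poly (size p) (fun i => p`_((size p).-1 - i)) (size p).-1.
  rewrite subnn ltn_predL (ltnW gt1) -/(revpoly p) nth_default; last first.
    by rewrite -ltnS (prednK (ltnW gt1)).
  by move=> /esym/eqP; rewrite (negbTE p0).
split=> //; split.
- rewrite monicE lead_coefZ lead_coefE sr coef_poly ltn_predL (ltnW gt1) subnn.
  by rewrite mulVf.
- by apply/polyOverP => i; rewrite coefZ rpredM ?rpredV //; apply: (polyOverP (revK _ pK)).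
- by rewrite hornerZ revpolyE ?invr_eq0 // invrK pa !mulr0.
move=> r rK ra r0; rewrite size_scale ?invr_eq0 // sr; apply: leq_trans (srev r).
by apply: pmin; [apply: revK | rewrite revpolyE // ra mulr0 | apply: rev0].
Qed.

Hypothesis Kmono : mono_subfield K.
Hypothesis Kd : dhens K.

(** A last dominant coefficient strictly between the two ends would split the polynomial by
    [hensel_factor], and [a] would be a root of a factor of smaller degree. *)
Lemma minpoly_slope a p c j : minpoly_over a p -> c \in K -> c != 0 -> (j < size p)%N ->
  (forall i, c * p`_i ≼ 1) -> 1 ≼ c * p`_j -> (forall i, (j < i)%N -> c * p`_i ≺ 1) ->
  j = 0%N \/ j.+1 = size p.
Proof.
move=> mp cK c0 ltj h1 hj hhigh; have [pm pK pa pmin] := mp; have gt1 := minpoly_gt1 mp.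
have [->|j0] := posnP j; [by left | right].
apply/eqP; rewrite eqn_leq ltj /= leqNgt; apply/negP => lt.
have [|||||g [h [gK hK E sg]]] := @hensel_factor _ L K Kmono Kd (size p).-1 j (c *: p).
- by rewrite -ltnS (prednK (ltnW gt1)).
- by apply/polyOverP => i; rewrite coefZ; apply/vint_inP; rewrite rpredM ?(polyOverP pK).
- by rewrite size_scale // (prednK (ltnW gt1)).
- by rewrite coefZ.
- by move=> i lti; rewrite coefZ hhigh.
have q0 : c *: p != 0 by rewrite scaler_eq0 (negbTE c0) monic_neq0.
have [g0 h0] : g != 0 /\ h != 0.
  by split; apply/eqP => z; move: q0; rewrite E z ?mul0r ?mulr0 eqxx.
have /eqP : (g * h).[a] = 0 by rewrite -E hornerZ pa mulr0.
have sE : (size g + size h).-1 = size p by rewrite -size_mul // -E size_scale.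
rewrite hornerM mulf_eq0 => /orP[]/eqP r.
  by have := pmin _ gK r g0; rewrite sg leqNgt lt.
by have := pmin _ hK r h0; rewrite -sE sg; clear -j0; lia.
Qed.

Lemma horner_small (p : {poly L}) a : (forall i, (0 < i)%N -> p`_i * a ^+ i ≺ 1) ->
  p.[a] = 0 -> p`_0 ≺ 1.
Proof.
move=> h; rewrite horner_coef; have [s0|s0] := posnP (size p).
  by move=> _; rewrite nth_default ?s0.
rewrite -(prednK s0) big_ord_recl expr0 mulr1 => /eqP; rewrite addr_eq0 => /eqP ->.
by rewrite vltN; apply: vlt_sum => [|i _]; [apply: oner_neq0 | apply: h].
Qed.

Lemma minpoly_vint a p : minpoly_over a p -> a ≼ 1 -> p \is a polyOver (vint_in K).
Proof.
move=> mp a1; have [pm pK pa pmin] := mp; have gt1 := minpoly_gt1 mp.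
have p0 := monic_neq0 pm.
have [|j [ltj pj0 jmax jlast]] := @vle_last_max _ L (size p) (fun i => p`_i).
  by exists (size p).-1; rewrite ?ltn_predL ?size_poly_gt0 // -lead_coefE lead_coef_eq0.
have pjK : p`_j \in K by apply: (polyOverP pK).
have le i : p`_i ≼ p`_j.
  by have [/jmax //|ge] := ltnP i (size p); rewrite nth_default.
have lt i : (j < i)%N -> p`_i ≺ p`_j.
  move=> ij; have [lti|ge] := ltnP i (size p); first by rewrite jlast ?ij.
  by rewrite nth_default // v0lt.
have small i : (j < i)%N -> (p`_j)^-1 * p`_i ≺ 1 by move=> ij; rewrite mulrC vlt_div1 ?lt.
have [|||||||jE] := @minpoly_slope a p (p`_j)^-1 j mp; rewrite ?rpredV ?invr_eq0 //.
- by move=> i; rewrite mulrC vle_div1.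
- by rewrite mulVf.
(* If the constant coefficient were the last dominant one, the other terms of p(a) would be strictly
   smaller and could not cancel it. *)
- move=> j0; subst j; have := @horner_small ((p`_0)^-1 *: p) a.
  rewrite hornerZ pa mulr0 coefZ mulVf // => /(_ _ erefl) /=.
  rewrite vlt_irr => h; have: false; last by [].
  apply: h => i i0; rewrite coefZ; apply: vlt_M1; last exact: vleX1.
  exact: small.
have pj1 : p`_j = 1 by have := monicP pm; rewrite lead_coefE -jE.
apply/polyOverP => i; apply/vint_inP; split; first exact: (polyOverP pK).
by rewrite -pj1.
Qed.

(** Reversing the coefficients gives the minimal polynomial of a^-1 up to a factor and turns the
    first unit coefficient of [p] into a last dominant one. By [minpoly_slope] it sits at an end,
    and not at the constant end, since the remaining terms of p(a) = 0 are infinitesimal. *)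
Lemma minpoly_vlt a p i : minpoly_over a p -> a ≺ 1 -> (i < (size p).-1)%N -> p`_i ≺ 1.
Proof.
move=> mp a1 lti; have [pm pK pa pmin] := mp; have gt1 := minpoly_gt1 mp.
have pO := minpoly_vint mp (vlt_le a1).
have p1 k : p`_k ≼ 1 by have /vint_inP[] := polyOverP pO k.
have [a0|a0] := eqVneq a 0.
  have s2 : (size p <= 2)%N.
    by have := pmin 'X; rewrite size_polyX polyX_eq0; apply; rewrite ?polyOverX // hornerX.
  have i0 : i = 0%N by move: lti s2; clear; lia.
  by move: pa; rewrite i0 a0 horner_coef0 => ->.
have p0lt : p`_0 ≺ 1.
  apply: horner_small pa => k k0; apply: vlt_1M => //.
  by rewrite -(prednK k0) exprS; apply: vlt_M1 => //; apply: vleX1; apply: vlt_le.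
rewrite /vlt; apply/negP => pi1.
have exP : exists k, 1 ≼ p`_k by exists i.
case: (ex_minnP exP) => j pj jmin.
have ji : (j <= i)%N by apply: jmin.
have low k : (k < j)%N -> p`_k ≺ 1.
  by move=> lt; rewrite /vlt; apply/negP => /jmin; rewrite leqNgt lt.
have j0 : (0 < j)%N by rewrite lt0n; apply/eqP => j0; rewrite j0 in pj; move: p0lt; rewrite /vlt pj.
have [p00 mr] := minpoly_inv mp a0; set r := _ *: _ in mr.
have rE k : p`_0 * r`_k = if (k < size p)%N then p`_((size p).-1 - k) else 0.
  by rewrite coefZ mulVKf // coef_poly.
have sr : size r = size p.
  have [rm _ _ _] := mr; apply/eqP; rewrite eqn_leq; apply/andP; split.
    by rewrite /r size_scale ?invr_eq0 // size_poly.
  rewrite -(prednK (ltnW gt1)); apply: contraT; rewrite -leqNgt => le.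
  have := rE (size p).-1; rewrite [r`__]nth_default // mulr0 ltn_predL (ltnW gt1) subnn.
  by move=> /eqP; rewrite eq_sym (negbTE p00).
have := @minpoly_slope a^-1 r p`_0 ((size p).-1 - j) mr.
have hj : (j <= (size p).-1)%N by apply: leq_trans ji (ltnW lti).
case=> //.
- exact: (polyOverP pK).
- by rewrite sr; clear -gt1; lia.
- by move=> k; rewrite rE; case: ifP.
- by rewrite rE; case: ifP => [_|]; [rewrite subKn | clear -gt1; lia].
- move=> k; rewrite rE; case: ifP => // h1 h2; apply: low; move: h1 h2 hj; clear; lia.
- by clear -ji lti; lia.
- by rewrite sr; clear -j0 gt1; lia.
Qed.

End MinimalPolynomials.

(** * Coordinates with respect to the powers of one element *)

Section Coordinates.
Variables (H : oagType) (L : valuedDiffFieldType H).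
Variable K : divringClosed L.
Variables (s : L) (n : nat).

Definition scomb (c : nat -> L) : L := \sum_(i < n) c i * s ^+ i.

(** Size is measured here by coordinates, not by the valuation. Small coordinates make a small
    element when [s] is integral ([sball_le]), but a small element may have large coordinates as
    long as the powers of [s] are not known to be valuation independent. *)
Definition sball (d : L) : {pred L} :=
  fun x => `[< exists c : nat -> L, (forall i, c i \in vball K d) /\ x = scomb c >].

Lemma sballP d x : reflect (exists c : nat -> L, (forall i, c i \in vball K d) /\ x = scomb c)
  (x \in sball d).
Proof. exact: asboolP. Qed.

Lemma sball_closed d : zmod_closed (sball d).
Proof.
split.
  apply/sballP; exists (fun=> 0); split=> [i|]; first exact: rpred0.
  by rewrite /scomb big1 // => i _; rewrite mul0r.
move=> x y /sballP[c [cd ->]] /sballP[c' [cd' ->]]; apply/sballP.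
exists (fun i => c i - c' i); split=> [i|]; first exact: rpredB.
by rewrite /scomb -sumrB; apply: eq_bigr => i _; rewrite mulrBl.
Qed.

HB.instance Definition _ d := GRing.isZmodClosed.Build L (sball d) (sball_closed d).

Lemma sball_scale d e b x : b \in vball K d -> x \in sball e -> b * x \in sball (d * e).
Proof.
move=> /vballP[bK bd] /sballP[c [cd ->]]; apply/sballP; exists (fun i => b * c i).
split=> [i|]; last by rewrite /scomb mulr_sumr; apply: eq_bigr => i _; rewrite mulrA.
by have /vballP[cK ce] := cd i; apply/vballP; rewrite rpredM // vleM.
Qed.

Hypothesis reduce : forall k, s ^+ k \in sball 1.

Lemma sballM d e x y : x \in sball d -> y \in sball e -> x * y \in sball (d * e).
Proof.
move=> /sballP[c [cd ->]] /sballP[c' [cd' ->]].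
rewrite mulr_suml; apply: rpred_sum => i _; rewrite mulr_sumr; apply: rpred_sum => j _.
rewrite mulrACA -exprD -[d * e]mulr1; apply: sball_scale => //.
have /vballP[a b] := cd i; have /vballP[a' b'] := cd' j.
by apply/vballP; rewrite rpredM // vleM.
Qed.

Definition sring : {pred L} := sball 1.

Lemma sring_closed : subring_closed sring.
Proof.
split; first by have := reduce 0; rewrite expr0.
  exact: rpredB.
by move=> x y xA yA; rewrite /sring -[1]mulr1; apply: sballM.
Qed.

Lemma sring_scale d x y : x \in sring -> y \in sball d -> x * y \in sball d.
Proof. by move=> xA yd; rewrite -[d]mul1r; apply: sballM. Qed.

Lemma vint_vball c : (c \in vint_in K) = (c \in vball K 1).
Proof. by rewrite !inE. Qed.

Lemma sring_vint c : c \in vint_in K -> c \in sring.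
Proof.
rewrite vint_vball => cK; rewrite /sring -[1]mul1r -[c]mulr1; apply: sball_scale => //.
by have := reduce 0; rewrite expr0.
Qed.

Hypothesis s1 : s ≼ 1.

Lemma sball_le d x : x \in sball d -> x ≼ d.
Proof.
move=> /sballP[c [cd ->]]; apply: vle_sum => i _; have /vballP[_ h] := cd i.
by apply: vle_M1 => //; apply: vleX1.
Qed.

Hypothesis Kmono : mono_subfield K.

(** Restriction of scalars from K[s] to [K]: to solve g z = 0 it is enough to solve the equations Q
    i z = 0 over [K]. *)
Definition rep (g : (nat -> L) -> L) : Prop :=
  exists Q : nat -> (nat -> L) -> L, (forall i, dmap K (Q i)) /\ forall z, g z = scomb (Q^~ z).

Lemma rep_ext g h : (forall z, g z = h z) -> rep g -> rep h.
Proof. by move=> gh [Q [Qd gQ]]; exists Q; split=> // z; rewrite -gh. Qed.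

Lemma rep_add g h : rep g -> rep h -> rep (fun z => g z + h z).
Proof.
move=> [Q [Qd gQ]] [R [Rd hR]]; exists (fun i z => Q i z + R i z); split=> [i|z].
  exact: dmap_add.
by rewrite gQ hR /scomb -big_split; apply: eq_bigr => i _; rewrite /= mulrDl.
Qed.

Lemma rep_scale f g : dmap K f -> rep g -> rep (fun z => f z * g z).
Proof.
move=> fd [Q [Qd gQ]]; exists (fun i z => f z * Q i z); split=> [i|z].
  exact: dmap_mul.
by rewrite gQ /scomb mulr_sumr; apply: eq_bigr => i _; rewrite mulrA.
Qed.

Lemma rep_const x : x \in sring -> rep (fun=> x).
Proof.
move=> /sballP[c [c1 ->]]; exists (fun i _ => c i); split=> // i.
by apply: dmap_const; rewrite vint_vball.
Qed.

Lemma rep_sum m (g : nat -> (nat -> L) -> L) : (forall i, rep (g i)) ->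
  rep (fun z => \sum_(i < m) g i z).
Proof.
move=> gr; elim: m => [|m IH].
  apply: (rep_ext (g := fun=> 0)) => [z|]; first by rewrite big_ord0.
  by apply: rep_const; apply: rpred0.
apply: (rep_ext (g := fun z => \sum_(i < m) g i z + g m z)) => [z|].
  by rewrite big_ord_recr.
exact: rep_add.
Qed.

Lemma rep_mul g h : rep g -> rep h -> rep (fun z => g z * h z).
Proof.
move=> [Q [Qd gQ]] [R [Rd hR]].
apply: (rep_ext (g := fun z => \sum_(i < n) \sum_(j < n) (Q i z * R j z) * s ^+ (i + j))) => [z|].
  rewrite gQ hR /scomb mulr_suml; apply: eq_bigr => i _; rewrite mulr_sumr.
  by apply: eq_bigr => j _; rewrite mulrACA exprD.
apply: (@rep_sum n (fun i z => \sum_(j < n) (Q i z * R j z) * s ^+ (i + j))) => i.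
apply: (@rep_sum n (fun j z => (Q i z * R j z) * s ^+ (i + j))) => j.
by apply: rep_scale; [apply: dmap_mul | apply: rep_const].
Qed.

Lemma rep_exp g k : rep g -> rep (fun z => g z ^+ k).
Proof.
move=> gr; elim: k => [|k IH].
  by apply: (rep_ext (g := fun=> 1)) => //; apply: rep_const; have := reduce 0; rewrite expr0.
by apply: (rep_ext (g := fun z => g z * g z ^+ k)) => [z|]; [rewrite exprS | apply: rep_mul].
Qed.

Lemma rep_scomb : rep scomb.
Proof. by exists (fun i z => z i); split=> // i; apply: dmap_var. Qed.

Lemma rep_horner (p : {poly L}) g : (forall i, p`_i \in sring) -> rep g ->
  rep (fun z => p.[g z]).
Proof.
move=> pA gr; apply: (rep_ext (g := fun z => \sum_(i < size p) p`_i * g z ^+ i)) => [z|].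
  by rewrite horner_coef.
apply: (@rep_sum _ (fun i z => p`_i * g z ^+ i)) => i.
by apply: rep_mul; [apply: rep_const | apply: rep_exp].
Qed.

Lemma rep_der g : der s \in sring -> rep g -> rep (fun z => der (g z)).
Proof.
move=> sA [Q [Qd gQ]].
apply: (rep_ext (g := fun z => \sum_(i < n)
  (der (Q i z) * s ^+ i + Q i z * (i%:R * s ^+ i.-1 * der s)))) => [z|].
  by rewrite gQ raddf_sum; apply: eq_bigr => i _; rewrite /= derM derX.
apply: (@rep_sum _ (fun i z => der (Q i z) * s ^+ i + Q i z * (i%:R * s ^+ i.-1 * der s))) => i.
apply: rep_add; apply: rep_scale => //; first exact: dmap_der.
  exact: rep_const.
apply: rep_const; apply: sring_scale => //; apply: sring_scale => //.
by apply: sring_vint; apply: rpred_nat.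
Qed.

End Coordinates.

(** * Lifting simple roots over the integral combinations of powers of an integral element *)

Section Roots.
Variables (H : oagType) (L : valuedDiffFieldType H).
Variable K : divringClosed L.
Hypothesis Kmono : mono_subfield K.
Hypothesis Kd : dhens K.
Hypothesis Kalg : forall x : L, exists2 p : {poly L}, p \is a polyOver K & p != 0 /\ p.[x] = 0.

Lemma minpoly_ex x : exists p, minpoly_over K x p.
Proof. by have [p pK [p0 px]] := Kalg x; apply: minpoly_exists px. Qed.

Variables (s : L) (mu : {poly L}).
Hypothesis mus : minpoly_over K s mu.
Hypothesis s1 : s ≼ 1.
Let n := (size mu).-1.

Let muO : mu \is a polyOver (vint_in K).
Proof. exact: minpoly_vint mus s1. Qed.

Let nE : size mu = n.+1.
Proof. by rewrite /n prednK // ltnW // (minpoly_gt1 mus). Qed.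

Lemma scomb_horner d (f : {poly L}) : f \is a polyOver (vball K d) -> f.[s] \in sball K s n d.
Proof.
have [mum _ mu0 _] := mus.
move=> fd; have [rd _] := monic_division mum muO fd.
rewrite {1}(divp_eq f mu) hornerD hornerM mu0 mulr0 add0r.
apply/sballP; exists (fun i => (f %% mu)`_i); split=> [i|]; first exact: (polyOverP rd).
rewrite (@horner_coef_wide _ n) //.
by rewrite -ltnS -nE ltn_modp monic_neq0.
Qed.

Lemma sring_reduce k : s ^+ k \in sball K s n 1.
Proof.
rewrite -hornerXn; apply: scomb_horner.
by rewrite -polyOver_vball1 rpredX ?polyOverX.
Qed.

HB.instance Definition _ :=
  GRing.isSubringClosed.Build L (sring K s n) (sring_closed sring_reduce).

Lemma scomb_inj (c c' : nat -> L) : (forall i, c i \in K) -> (forall i, c' i \in K) ->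
  scomb s n c = scomb s n c' -> forall i, (i < n)%N -> c i = c' i.
Proof.
move=> cK cK' E i lt; apply/eqP; rewrite -subr_eq0; apply/eqP.
have : \poly_(i < n) (c i - c' i) = 0.
  apply: (minpoly_small mus); last by rewrite nE ltnS size_poly.
    by apply/polyOverP => k; rewrite coef_poly; case: ifP => _; rewrite ?rpred0 ?rpredB.
  rewrite horner_poly; under eq_bigr => k _ do rewrite mulrBl.
  by rewrite sumrB -/(scomb s n c) -/(scomb s n c') E subrr.
by move=> /(congr1 (fun p : {poly L} => p`_i)); rewrite coef_poly lt coef0.
Qed.

Lemma sring_horner p x : p \is a polyOver (vint_in K) -> x \in sring K s n ->
  p.[x] \in sring K s n.
Proof.
move=> pO xA; rewrite horner_coef; apply: rpred_sum => i _; apply: rpredM; last exact: rpredX.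
by apply: (sring_vint sring_reduce); apply: (polyOverP pO).
Qed.

(** The minimal polynomial [p] of [x] expresses the inverse as a polynomial in [x] with denominator
    p_0. That denominator is a unit: its inverse is the constant coefficient of the minimal
    polynomial of x^-1, which is integral as well. *)
Lemma sring_inv x : x \in sring K s n -> 1 ≼ x -> x^-1 \in sring K s n.
Proof.
move=> xA x1; have x0 : x != 0 by apply: vle_neq0 x1 (oner_neq0 _).
have [p mp] := minpoly_ex x; have [pm pK px _] := mp.
have xle : x ≼ 1 by apply: (sball_le s1 xA).
have pO := minpoly_vint Kmono Kd mp xle.
have [p0 mr] := minpoly_inv mp x0.
have xV : x^-1 ≼ 1 by rewrite -[_^-1]mul1r vdiv_le ?mul1r.
have := minpoly_vint Kmono Kd mr xV => /polyOverP/(_ 0%N).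
rewrite coefZ coef_poly subn0 size_poly_gt0 monic_neq0 // -lead_coefE (monicP pm) mulr1 => p0O.
pose r := \poly_(i < (size p).-1) p`_i.+1.
have rO : r \is a polyOver (vint_in K).
  by apply/polyOverP => i; rewrite coef_poly; case: ifP => _; rewrite ?rpred0 ?(polyOverP pO).
have pE : p = r * 'X + (p`_0)%:P.
  apply/polyP => i; rewrite coefD coefMX coefC coef_poly; case: i => [|i] /=; first by rewrite add0r.
  rewrite addr0; case: ifP => // /negbT; rewrite -leqNgt => h.
  by rewrite nth_default // -(prednK (ltnW (minpoly_gt1 mp))).
have -> : x^-1 = - (p`_0)^-1 * r.[x].
  apply: (mulfI x0); rewrite divff //.
  move: px; rewrite {1}pE hornerD hornerMX hornerC => /eqP; rewrite addr_eq0 => /eqP E.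
  by rewrite mulNr mulrN mulrCA (mulrC x) E mulrN mulVf // opprK.
by apply: rpredM; [rewrite rpredN; apply: (sring_vint sring_reduce) | apply: sring_horner].
Qed.

(** The minimal equation of [x] writes its top power through lower powers with infinitesimal
    coefficients; N is the degree and [d] the largest of these coefficients. *)
Lemma sring_nil x : x \in sring K s n -> x ≺ 1 -> x != 0 ->
  exists N d, [/\ d != 0, d ≺ 1 & x ^+ N \in sball K s n d].
Proof.
move=> xA x1 x0; have [p mp] := minpoly_ex x; have [pm pK px _] := mp.
have gt1 := minpoly_gt1 mp.
have pO := minpoly_vint Kmono Kd mp (vlt_le x1).
have [|k ltk kmax] := @vle_max _ L (size p).-1 (fun i => p`_i).
  by rewrite -ltnS (prednK (ltnW gt1)).
have xE : x ^+ (size p).-1 = - \sum_(i < (size p).-1) p`_i * x ^+ i.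
  have le : (size p <= (size p).-1.+1)%N by rewrite prednK // ltnW.
  move: px; rewrite (horner_coef_wide _ le) big_ord_recr /= -lead_coefE (monicP pm) mul1r.
  by move=> /eqP; rewrite addrC addr_eq0 => /eqP.
exists (size p).-1, p`_k; split.
- apply/eqP => pk0; move: xE; rewrite big1 => [|i _].
    by rewrite oppr0 => /eqP; rewrite expf_eq0 (negbTE x0) andbF.
  by have := kmax i (ltn_ord i); rewrite pk0 vle0 => /eqP ->; rewrite mul0r.
- exact: (minpoly_vlt Kmono Kd mp x1 ltk).
rewrite xE rpredN; apply: rpred_sum => i _; rewrite mulrC.
apply: (sring_scale sring_reduce); first exact: rpredX.
rewrite -[p`_i]mulr1 -[p`_k]mulr1; apply: sball_scale.
  by apply/vballP; split; [apply: (polyOverP pK) | apply: kmax].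
by have := sring_reduce 0; rewrite expr0.
Qed.

Lemma poly_taylor2 (S : subringClosed L) (p : {poly L}) x h : p \is a polyOver S ->
  x \in S -> h \in S -> exists2 c, c \in S & p.[x + h] = p.[x] + p^`().[x] * h + h ^+ 2 * c.
Proof.
move=> pS xS hS; exists (\sum_(i < size p) (p^`N(i.+2)).[x] * h ^+ i).
  apply: rpred_sum => i _; apply: rpredM; last exact: rpredX.
  by apply: rpred_horner => //; apply: polyOver_nderivn.
rewrite (@nderiv_taylor_wide _ (size p).+2) ?leqW //; last exact: mulrC.
rewrite !big_ord_recl /= nderivn0 nderivn1 expr0 mulr1 expr1 addrA mulr_sumr; congr (_ + _).
by apply: eq_bigr => i _; rewrite [RHS]mulrCA -exprD.
Qed.

Variables (phi : {poly L}) (t0 : L).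
Hypothesis phiA : phi \is a polyOver (sring K s n).
Hypothesis t0A : t0 \in sring K s n.
Hypothesis phit0 : phi.[t0] ≺ 1.
Hypothesis dphit0 : 1 ≼ phi^`().[t0].

Let A := sring K s n.

Let A1 x : x \in A -> x ≼ 1.
Proof. exact: sball_le. Qed.

Let newton t : t \in A -> t - t0 ≺ 1 ->
  exists t', [/\ t' \in A, t' - t0 ≺ 1 & exists2 b, b \in A & phi.[t'] = phi.[t] ^+ 2 * b].
Proof.
move=> tA tt0; have phiA' : phi \is a polyOver A by [].
have dA : phi^`() \is a polyOver A by apply: polyOver_deriv.
have hA : t - t0 \in A by apply: rpredB.
have close (q : {poly L}) : q \is a polyOver A -> q.[t] - q.[t0] ≺ 1.
  move=> qA; have [c cA] := poly_taylor2 qA t0A hA; rewrite addrC subrK => ->.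
  rewrite -[_ + _ + (t - t0) ^+ 2 * _]addrA addrAC subrr add0r; apply: vltD.
    by apply: vlt_1M => //; apply: A1; apply: rpred_horner => //; apply: polyOver_deriv.
  by rewrite expr2 -mulrA; apply: vlt_M1 => //; apply: A1; apply: rpredM.
have pt1 : phi.[t] ≺ 1 by apply: vlt_swap (close _ phiA) phit0.
have dt1 : 1 ≼ phi^`().[t].
  by rewrite -[phi^`().[t]](subrK phi^`().[t0]) addrC vle_addr_iff ?close.
have d0 : phi^`().[t] != 0 by apply: vle_neq0 dt1 (oner_neq0 _).
have dtA : phi^`().[t] \in A by apply: rpred_horner.
have ptA : phi.[t] \in A by apply: rpred_horner.
have vA := sring_inv dtA dt1.
pose h := - (phi.[t] * (phi^`().[t])^-1).
have h2A : h \in A by rewrite rpredN rpredM.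
have [c cA E] := poly_taylor2 phiA tA h2A.
exists (t + h); split.
- exact: rpredD.
- rewrite addrAC; apply: vltD => //; rewrite /h vltN.
  by apply: vlt_M1 => //; apply: A1.
exists ((phi^`().[t])^-1 ^+ 2 * c); first by rewrite rpredM ?rpredX.
rewrite E /h mulrN [phi^`().[t] * _]mulrCA divff // mulr1 subrr add0r.
by rewrite sqrrN exprMn -mulrA.
Qed.

(** [newton_zero] must start from infinitesimal coordinates, whereas [phit0] bounds only the
    valuation. By [sring_nil] the N-th power of phi.[t0] has infinitesimal coordinates, and after N
    Newton steps the residual is a multiple of its power with exponent 2^N, which is at least N. *)
Lemma root_lift : exists t, [/\ t \in sring K s n, phi.[t] = 0 & t - t0 ≺ 1].
Proof.
have t00 : t0 - t0 ≺ 1 by rewrite subrr.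
have [e0|ne0] := eqVneq phi.[t0] 0; first by exists t0.
have ptA : phi.[t0] \in A by apply: rpred_horner.
have [N [d [d0 d1 xN]]] := sring_nil ptA phit0 ne0.
have iter k : exists t, [/\ t \in A, t - t0 ≺ 1 &
    exists2 b, b \in A & phi.[t] = phi.[t0] ^+ (2 ^ k) * b].
  elim: k => [|k [t [tA tt [b bA E]]]].
    by exists t0; split=> //; exists 1; rewrite ?rpred1 // expn0 expr1 mulr1.
  have [t' [tA' tt' [b' bA' E']]] := newton tA tt; exists t'; split=> //.
  exists (b ^+ 2 * b'); first by rewrite rpredM ?rpredX.
  by rewrite E' E exprMn -exprM -mulrA expnSr.
have [t1 [t1A tt1 [b bA E1]]] := iter N.
have phit1 : phi.[t1] \in sball K s n d.
  have le : (N <= 2 ^ N)%N by apply: ltnW; apply: ltn_expl.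
  rewrite E1 -(subnK le) exprD mulrC mulrA; apply: (sring_scale sring_reduce) => //.
  by rewrite rpredM ?rpredX.
have coords e x : x \in sball K s n e -> e ≼ 1 -> exists z, [/\ tuple_in K n z,
    forall i, z i \in vball K e & x = scomb s n z].
  move=> /sballP[c [ce ->]] e1; exists (fun i => if (i < n)%N then c i else 0); split.
  - split=> i; last by rewrite leqNgt => /negbTE ->.
    case: ifP => _; last exact: rpred0.
    by have /vballP[cK cle] := ce i; apply/vint_inP; split=> //; apply: vle_trans e1.
  - by move=> i; case: ifP => // _; apply: rpred0.
  by apply: eq_bigr => i _; rewrite ltn_ord.
have scombA z : tuple_in K n z -> scomb s n z \in A.
  by case=> zK _; apply/sballP; exists z; split=> // i; rewrite -vint_vball.
have [Q [Qd QE]] : rep K s n (fun z => phi.[scomb s n z]).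
  apply: (rep_horner sring_reduce); last exact: rep_scomb.
  by move=> i; apply: (polyOverP phiA).
have Qball z e : tuple_in K n z -> phi.[scomb s n z] \in sball K s n e ->
    forall i, (i < n)%N -> Q i z ≼ e.
  move=> [zK _] /sballP[c [ce E]] i lt.
  have -> : Q i z = c i; last by have /vballP[] := ce i.
  apply: (@scomb_inj (Q^~ z) c) => // [k|k|].
  - by have /vint_inP[] := dmap_vint Kmono (Qd k) zK.
  - by have /vballP[] := ce k.
  by rewrite -E -QE.
have [|||z [Pz zin Qz]] := @newton_zero _ L K Kmono Kd n n Q (fun z => scomb s n z - t0 ≺ 1) (fun i _ => Qd i).
- move=> z z0 P0 zin zz; rewrite -(subrK (scomb s n z0) (scomb s n z)) -addrA; apply: vltD => //.
  rewrite /scomb -sumrB; apply: vlt_sum => [|i _]; first exact: oner_neq0.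
  by rewrite -mulrBl; apply: vlt_M1 => //; apply: vleX1.
- have [z [zin _ E]] := coords 1 t1 t1A (vle_refl _).
  exists z, d; split; rewrite -?E //.
  by move=> i lt; apply: Qball => //; rewrite -E.
- move=> z e Pz zin e0 e1 Qe.
  have [t' [tA' tt' [b' bA' E']]] := newton (scombA z zin) Pz.
  have pe : phi.[scomb s n z] \in sball K s n e.
    rewrite QE; apply/sballP; exists (fun i => if (i < n)%N then Q i z else 0); split.
      move=> i; case: ifP => lt; last exact: rpred0.
      apply/vballP; split; last exact: Qe.
      by have /vint_inP[] := dmap_vint Kmono (Qd i) (proj1 zin).
    by apply: eq_bigr => i _; rewrite ltn_ord.
  have [z' [zin' _ Ez]] := coords 1 t' tA' (vle_refl _).
  exists z'; split; rewrite -?Ez //.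
  move=> i lt; apply: Qball => //; rewrite -Ez E' mulrC expr2.
  apply: (sring_scale sring_reduce) => //; exact: (sballM sring_reduce).
exists (scomb s n z); split=> //; first exact: scombA.
by rewrite QE /scomb big1 // => i _; rewrite Qz ?mul0r.
Qed.

End Roots.

(** * Linear differential operators *)

Section RightOperators.
Variable F : diffFieldType.
Implicit Types (p q : {poly F}) (a c y : F).

(* A polynomial [p] stands for the operator y |-> \sum_i (p_i y)^(i). *)
Definition opr p y : F := \sum_(i < size p) jet i (p`_i * y).

Lemma opr_wide n p y : (size p <= n)%N -> opr p y = \sum_(i < n) jet i (p`_i * y).
Proof.
move=> le; rewrite /opr (big_ord_widen n (fun i => jet i (p`_i * y)) le) big_mkcond.
apply: eq_bigr => i _; case: ifPn => //; rewrite -leqNgt => h.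
by rewrite nth_default // mul0r raddf0.
Qed.

Lemma oprB p q y : opr (p - q) y = opr p y - opr q y.
Proof.
pose n := maxn (size p) (size q).
have h : (size (p - q)%R <= n)%N by rewrite (leq_trans (size_polyD _ _)) // size_polyN.
rewrite (opr_wide y h) (@opr_wide n p) ?leq_maxl // (@opr_wide n q) ?leq_maxr //.
by rewrite -sumrB; apply: eq_bigr => i _; rewrite coefB mulrBl raddfB.
Qed.

Lemma opr0 y : opr 0 y = 0.
Proof. by rewrite /opr size_poly0 big_ord0. Qed.

Lemma oprD p q y : opr (p + q) y = opr p y + opr q y.
Proof. by rewrite -[q in LHS]opprK oprB -[- q]sub0r oprB opr0 sub0r opprK. Qed.

Lemma opr_sum (I : Type) (r : seq I) (f : I -> {poly F}) y :
  opr (\sum_(i <- r) f i) y = \sum_(i <- r) opr (f i) y.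
Proof. by apply: (big_morph (fun p => opr p y)) => [p q|]; rewrite ?oprD ?opr0. Qed.

Lemma oprZ c p y : opr (c *: p) y = opr p (c * y).
Proof.
rewrite (@opr_wide (size p) (c *: p)) ?size_scale_leq // /opr.
by apply: eq_bigr => i _; rewrite coefZ [RHS]/= mulrA [p`_i * c]mulrC.
Qed.

Lemma oprX p y : opr ('X * p) y = der (opr p y).
Proof.
rewrite (@opr_wide (size p).+1 ('X * p)); last first.
  by rewrite (leq_trans (size_polyMleq _ _)) // size_polyX.
rewrite big_ord_recl coefXM /= mul0r add0r /opr raddf_sum.
by apply: eq_bigr => i _; rewrite coefXM.
Qed.

Lemma oprC c y : opr c%:P y = c * y.
Proof. by rewrite (opr_wide y (size_polyC_leq1 c)) big_ord1 coefC. Qed.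

(* The operator a d^i, with its coefficients moved to the right of the d's. *)
Fixpoint lamX i a : {poly F} := if i is i'.+1 then 'X * lamX i' a - lamX i' (der a) else a%:P.

Lemma lamXE i a y : opr (lamX i a) y = a * jet i y.
Proof.
elim: i a => [|i IH] a /=; first by rewrite oprC.
by rewrite oprB oprX !IH derM -jetS addrC addKr.
Qed.

Lemma lamX_size i a : (size (lamX i a) <= i.+1)%N.
Proof.
elim: i a => [|i IH] a /=; first exact: size_polyC_leq1.
rewrite (leq_trans (size_polyD _ _)) // geq_max size_polyN (leq_trans (IH _)) // andbT.
by rewrite (leq_trans (size_polyMleq _ _)) // size_polyX ltnS IH.
Qed.

Lemma lamX_top i a : (lamX i a)`_i = a.
Proof.
elim: i a => [|i IH] a /=; first by rewrite coefC.
by rewrite coefB coefXM /= IH nth_default ?subr0 ?lamX_size.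
Qed.

Lemma lamX_ind (P : F -> Prop) i a : (forall x y, P x -> P y -> P (x - y)) -> P 0 ->
  (forall x, P x -> P (der x)) -> P a -> forall k, P (lamX i a)`_k.
Proof.
move=> PB P0 Pd; elim: i a => [|i IH] a Pa k /=; first by rewrite coefC; case: eqP.
rewrite coefB coefXM; apply: (PB _ _); last by apply: IH; apply: (Pd _).
by case: eqP => // _; apply: IH.
Qed.

(* Composition on the left with the operator \sum_k (a k) d^k. *)
Definition lcomp m (a : nat -> F) p : {poly F} :=
  \sum_(k < m) \sum_(i < size p) p`_i *: lamX (k + i) (a k).

Lemma lcomp_wide m (a : nat -> F) n p : (size p <= n)%N ->
  lcomp m a p = \sum_(k < m) \sum_(i < n) p`_i *: lamX (k + i) (a k).
Proof.
move=> le; apply: eq_bigr => k _.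
rewrite (big_ord_widen n (fun i => p`_i *: lamX (k + i) (a k)) le) big_mkcond.
apply: eq_bigr => i _; case: ifPn => //; rewrite -leqNgt => h.
by rewrite nth_default // scale0r.
Qed.

Lemma lcompD m (a : nat -> F) p q : lcomp m a (p + q) = lcomp m a p + lcomp m a q.
Proof.
pose n := maxn (size p) (size q).
rewrite (@lcomp_wide m a n p) ?leq_maxl // (@lcomp_wide m a n q) ?leq_maxr //.
rewrite (@lcomp_wide m a n) ?size_polyD // -big_split; apply: eq_bigr => k _.
by rewrite -big_split; apply: eq_bigr => i _; rewrite coefD scalerDl.
Qed.

(** This is why coefficients stand to the right of the derivations: multiplication by a scalar on
    the right then acts coefficientwise and commutes with composition on the left, so that
    [neat_multiple] can combine quotients and remainders linearly. *)
Lemma lcompZ m (a : nat -> F) c p : lcomp m a (c *: p) = c *: lcomp m a p.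
Proof.
rewrite (@lcomp_wide m a (size p) (c *: p)) ?size_scale_leq // scaler_sumr.
apply: eq_bigr => k _; rewrite scaler_sumr; apply: eq_bigr => i _.
by rewrite coefZ scalerA.
Qed.

Lemma lcomp0 m (a : nat -> F) : lcomp m a 0 = 0.
Proof. by rewrite -[in LHS](scale0r 0) lcompZ scale0r. Qed.

Lemma lcomp_sum m (a : nat -> F) (I : Type) (r : seq I) (f : I -> {poly F}) :
  lcomp m a (\sum_(i <- r) f i) = \sum_(i <- r) lcomp m a (f i).
Proof. by apply: big_morph => [p q|]; rewrite ?lcompD ?lcomp0. Qed.

Lemma lcompE m (a : nat -> F) p y : opr (lcomp m a p) y = \sum_(k < m) a k * jet k (opr p y).
Proof.
rewrite opr_sum; apply: eq_bigr => k _; rewrite opr_sum raddf_sum mulr_sumr.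
by apply: eq_bigr => i _; rewrite oprZ lamXE /jet iterD.
Qed.

End RightOperators.

Section LinearDependence.
Variables (F : fieldType) (K : divringClosed F).

Lemma lin_dep N (c : nat -> nat -> F) : (forall l t, c l t \in K) ->
  exists e : nat -> F, [/\ forall l, e l \in K, exists2 l, (l <= N)%N & e l != 0 &
    forall t, (t < N)%N -> \sum_(l < N.+1) e l * c l t = 0].
Proof.
elim: N c => [|N IH] c cK.
  by exists (fun=> 1); split=> // [_|]; [apply: rpred1 | exists 0%N; rewrite ?oner_neq0].
have [[l0 lt0 nz]|allz] := EM (exists2 l0, (l0 < N.+2)%N & c l0 N != 0); last first.
  have [e [eK [l le nz] he]] := IH c cK.
  exists (fun l => if (l <= N)%N then e l else 0); split.
  - by move=> k; case: ifP => // _; apply: rpred0.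
  - by exists l; rewrite ?le // (leq_trans le).
  have zN k : (k < N.+2)%N -> c k N = 0.
    by move=> lt; apply/eqP; apply: contraT => h; case: allz; exists k.
  move=> t; rewrite ltnS leq_eqVlt => /predU1P[->|lt].
    by rewrite big1 // => k _; rewrite zN ?mulr0.
  rewrite big_ord_recr /= ltnn mul0r addr0 -[RHS](he t lt).
  by apply: eq_bigr => k _; rewrite -ltnS ltn_ord.
pose u := bump l0.
have ul k : (u k == l0) = false by rewrite eq_sym (negbTE (neq_bump l0 k)).
have [|e [eK [l le nzl] he]] := IH (fun l t => c (u l) t - c (u l) N / c l0 N * c l0 t).
  by move=> l t; rewrite rpredB ?rpredM ?rpredV.
pose e0 := - \sum_(l < N.+1) e l * (c (u l) N / c l0 N).
exists (fun l => if l == l0 then e0 else e (unbump l0 l)); split.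
- move=> k; case: ifP => // _; rewrite rpredN; apply: rpred_sum => i _.
  by rewrite ?rpredM ?rpredV.
- exists (u l); last by rewrite ul bumpK.
  by rewrite /u /bump; case: (l0 <= l)%N; rewrite ?add1n ?add0n // leqW.
move=> t lt; rewrite (bigD1_ord (Ordinal lt0)) //= eqxx.
under eq_bigr => k _ do rewrite -/(u k) ul bumpK.
have hN : \sum_(k < N.+1) e k * c (u k) N = - e0 * c l0 N.
  by rewrite opprK mulr_suml; apply: eq_bigr => k _; rewrite -mulrA divfK.
move: lt; rewrite ltnS leq_eqVlt => /predU1P[->|lt].
  by rewrite -/u hN [- e0 * _]mulNr subrr.
have -> : \sum_(k < N.+1) e k * c (u k) t = - e0 * c l0 t.
  rewrite opprK mulr_suml; apply/eqP; rewrite -subr_eq0 -sumrB -[X in _ == X](he t lt).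
  by apply/eqP; apply: eq_bigr => k _; rewrite [RHS]mulrBr -[in LHS]mulrA.
by rewrite [- e0 * _]mulNr subrr.
Qed.

End LinearDependence.

(** * Linear differential equations with solutions no larger than the right-hand side *)

Section NeatSurjectivity.
Variables (H : oagType) (L : valuedDiffFieldType H).

(** Put z = b y and divide by [b]: the result is linear in y with constant term -1. Its coefficient
    at the last index where [e] is a unit is a unit, since lower summands do not reach that order
    and higher ones are infinitesimal there; so [dhens] applies. *)
Lemma jet_mulC (K : divringClosed L) (Kmono : mono_subfield K) (Kd : dhens K) N (e : nat -> L) b :
  (forall l, e l \in vint_in K) -> (exists2 l, (l <= N)%N & 1 ≼ e l) -> b \in K ->
  exists z, [/\ z \in K, z ≼ b & \sum_(l < N.+1) jet l (e l * z) = b].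
Proof.
move=> eO [l1 le1 el1] bK; have [->|b0] := eqVneq b 0.
  by exists 0; split; rewrite ?rpred0 // big1 // => l _; rewrite mulr0 raddf0.
pose e' l := if (l <= N)%N then e l else 0.
have e'O l : e' l \in vint_in K by rewrite /e'; case: ifP => // _; apply: rpred0.
have exP : exists l, (l <= N)%N && (1 ≼ e l) by exists l1; rewrite le1.
have ubP l : (l <= N)%N && (1 ≼ e l) -> (l <= N)%N by case/andP.
case: (ex_maxnP exP ubP) => l0 /andP[l0N el0] l0max.
have high l : (l0 < l)%N -> (l <= N)%N -> e l ≺ 1.
  move=> lt le; rewrite /vlt; apply/negP => h.
  by have := l0max l; rewrite le h => /(_ isT); rewrite leqNgt lt.
pose g l i := (leib (e l * b) l)`_i.
have gb l i : g l i \in vball K (e l * b).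
  have /vint_inP[elK _] := eO l.
  by apply: leib_vball => //; apply/vballP; rewrite rpredM.
have gK l i : g l i / b \in vint_in K.
  have /vballP[a1 a2] := gb l i; have /vint_inP[elK el] := eO l; apply/vint_inP; split.
    by rewrite rpredM ?rpredV.
  by rewrite vdiv_le // mul1r; apply: vle_trans a2 _; apply: vle_1M.
pose c i := \sum_(l < N.+1) g l i / b.
have cO i : c i \in vint_in K by apply: rpred_sum => l _; apply: gK.
pose P : {mpoly L[N.+1]} := \sum_(i < N.+1) c i *: 'X_i - 1.
have PU (i : 'I_N.+1) : P@_U_(i) = c i.
  rewrite mcoeffB raddf_sum mcoeff1 mnm1_eq0 subr0 (bigD1 i) //= mcoeffZ mcoeffX eqxx mulr1.
  by rewrite big1 ?addr0 // => k ki; rewrite /= mcoeffZ mcoeffX eq_mnm1 (negbTE ki) mulr0.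
have PN m : mdeg m != 1%N -> P@_m = - (m == 0%MM)%:R.
  move=> m1; rewrite mcoeffB raddf_sum mcoeff1 big1 ?sub0r // => k _ /=.
  rewrite mcoeffZ mcoeffX; have [E|] := eqVneq U_(k)%MM m; last by rewrite mulr0.
  by rewrite -E mdeg1 in m1.
have PQ : quasilinear K P.
  split.
  - move=> m; have [/eqP/mdeg1P[i /eqP ->]|m1] := eqVneq (mdeg m) 1%N; first by rewrite PU.
    by rewrite PN // rpredN rpred_nat.
  - move=> m m2; rewrite PN; last by case: (mdeg m) m2 => [|[]].
    case: eqP => [m0|_]; last by rewrite oppr0 v0lt1.
    by rewrite m0 mdeg0 in m2.
  exists (Ordinal (l0N : (l0 < N.+1)%N)); rewrite PU /c /= (bigD1 (Ordinal (l0N : (l0 < N.+1)%N))) //=.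
  rewrite {1}/g leib_top mulfK // vle_addr_iff // ; apply: vlt_sum => [|l ll0]; first exact: oner_neq0.
  have [lt|gt|E] := ltngtP l l0; last by rewrite -val_eqE /= E eqxx in ll0.
    by rewrite /g leib_size // mul0r v0lt1.
  rewrite vdiv_lt // mul1r; have /vballP[_ h] := gb l l0; apply: vle_lt_trans h _.
  by rewrite -[X in _ ≺ X]mul1r vlt_pM2r // high // -ltnS.
have [y yO Py] := Kd _ _ PQ; have /vint_inP[yK y1] := yO.
exists (b * y); split; [exact: rpredM | exact: vle_M1 |].
move: Py; rewrite /deval mevalB meval1 raddf_sum /= => /eqP; rewrite subr_eq0 => /eqP E.
rewrite -[RHS]mulr1 -E mulr_sumr.
under [RHS]eq_bigr => i _ do rewrite mevalZ mevalXU /c mulr_suml mulr_sumr.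
rewrite exchange_big /=; apply: eq_bigr => l _; rewrite mulrA leibE -/(g l).
rewrite (big_ord_widen N.+1 (fun i => g l i * jet i y)) // big_mkcond.
apply: eq_bigr => i _ /=; case: ifPn => [_|h]; first by rewrite mulrA mulrCA divff // mulr1.
by rewrite /g leib_size ?ltnNge // !mul0r mulr0.
Qed.

Section Gauss.
Variable K : divringClosed L.
Hypothesis Kmono : mono_subfield K.

Lemma lamX_vball i a z k : a \in vball K z -> (lamX i a)`_k \in vball K z.
Proof.
move=> az; apply: (@lamX_ind _ (fun x => x \in vball K z)) => //.
- by move=> x y; apply: rpredB.
- exact: rpred0.
- by move=> x; apply: (@jet_vball _ _ _ Kmono 1).
Qed.

Variables (m : nat) (a : nat -> L).
Hypothesis aO : forall k, a k \in vint_in K.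

(* Gauss' lemma for the product of operators. *)
Lemma lcomp_ge p z : (exists2 k, (k < m)%N & 1 ≼ a k) -> p \is a polyOver K ->
  (forall t, (lcomp m a p)`_t ≼ z) -> forall i, p`_i ≼ z.
Proof.
move=> [k1 ltk1 ak1] pK hz.
have [[i lti pi]|allz] := EM (exists2 i, (i < size p)%N & p`_i != 0); last first.
  move=> i; have [lt|ge] := ltnP i (size p); last by rewrite nth_default.
  have [->//|nz] := eqVneq p`_i 0.
  by case: allz; exists i.
have [|i0 [lti0 pi0 imax ilast]] := @vle_last_max _ L (size p) (fun i => p`_i); first by exists i.
suff: p`_i0 ≼ z.
  move=> h j; have [/imax|ge] := ltnP j (size p); last by rewrite nth_default.
  by move/vle_trans; apply.
have exP : exists k, (k < m)%N && (1 ≼ a k) by exists k1; rewrite ltk1.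
have ubP k : (k < m)%N && (1 ≼ a k) -> (k <= m)%N by case/andP => /ltnW.
case: (ex_maxnP exP ubP) => k0 /andP[ltk0 ak0] kmax.
have khigh k : (k0 < k)%N -> (k < m)%N -> a k ≺ 1.
  move=> lt ltm; rewrite /vlt; apply/negP => h.
  by have := kmax k; rewrite ltm h => /(_ isT); rewrite leqNgt lt.
(* With [k0] the last unit coefficient of the left operator and [i0] the last dominant one of [p],
   the pair (k0, i0) gives the only dominant summand of this coefficient: pairs of smaller sum do
   not reach it, and every other pair exceeds [k0] or [i0] in one entry. *)
apply: vle_trans (hz (k0 + i0)%N).
pose T k i := p`_i * (lamX (k + i) (a k))`_(k0 + i0).
have small k i' : (k < m)%N -> (i' < size p)%N -> (k, i') != (k0, i0) -> T k i' ≺ p`_i0.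
  move=> ltk lti' ne; rewrite /T.
  have ab : (lamX (k + i') (a k))`_(k0 + i0) \in vball K (a k).
    by apply: lamX_vball; have /vint_inP[? _] := aO k; apply/vballP.
  have /vballP[_ le] := ab; have /vint_inP[_ a1] := aO k.
  have [lt|ge] := ltnP (k + i') (k0 + i0).
    by rewrite [X in _ * X]nth_default ?mulr0 ?v0lt // (leq_trans (lamX_size _ _)).
  have [ltk0k|lek] := ltnP k0 k.
    rewrite -[X in _ ≺ X]mulr1; apply: vle_ltM => //; first exact: imax.
    exact: vle_lt_trans le (khigh _ ltk0k ltk).
  have lt : (i0 < i')%N.
    rewrite ltnNge; apply: contraNN ne => lei.
    have kk : k = k0 by apply/eqP; rewrite eqn_leq lek -(leq_add2r i0) (leq_trans ge) // leq_add2l.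
    by move: ge; rewrite kk leq_add2l xpair_eqE eqxx /= eqn_leq lei.
  apply: vlt_M1; first by apply: ilast; rewrite lt.
  exact: vle_trans le a1.
have -> : (lcomp m a p)`_(k0 + i0) = \sum_(k < m) \sum_(i < size p) T k i.
  rewrite coef_sum; apply: eq_bigr => k _; rewrite coef_sum; apply: eq_bigr => i' _.
  by rewrite coefZ.
rewrite (bigD1 (Ordinal ltk0)) //= (bigD1 (Ordinal lti0)) //= -addrA vle_addr_iff.
  by rewrite /T lamX_top -{1}[p`_i0]mulr1 vle_pM2l.
apply: vltD.
  apply: vlt_sum => // i' ne; apply: small => //.
  by rewrite xpair_eqE eqxx.
apply: vlt_sum => // k ne; apply: vlt_sum => // i' _; apply: small => //.
by rewrite xpair_eqE negb_and -(inj_eq val_inj) /= in ne *; rewrite ne.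
Qed.

Hypothesis am : a m != 0.

Lemma lcomp_division f : f \is a polyOver K -> exists q r,
  [/\ q \is a polyOver K, r \is a polyOver K, (size r <= m)%N & f = lcomp m.+1 a q + r].
Proof.
have [n] := ubnP (size f); elim: n f => // n IH f; rewrite ltnS => le fK.
have [lt|ge] := leqP (size f) m.
  by exists 0, f; rewrite rpred0 lcomp0 add0r.
have fK0 : lead_coef f \in K by rewrite lead_coefE; apply: (polyOverP fK).
have /vint_inP[amK _] := aO m.
pose i := ((size f).-1 - m)%N; pose c := lead_coef f / a m.
have sf : (size f).-1 = (m + i)%N by rewrite subnKC // -ltnS (ltn_predK ge).
have qK : c *: 'X^i \is a polyOver K.
  apply/polyOverP => k; rewrite coefZ coefXn rpredM ?rpred_nat //.
  by rewrite rpredM ?rpredV.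
have E t : (lcomp m.+1 a (c *: 'X^i))`_t = c * \sum_(k < m.+1) (lamX (k + i) (a k))`_t.
  rewrite lcompZ coefZ; congr (_ * _); rewrite (@lcomp_wide _ m.+1 a i.+1) ?size_polyXn //.
  rewrite coef_sum; apply: eq_bigr => k _; rewrite big_ord_recr /= coefD coef_sum.
  rewrite big1 => [|j _]; first by rewrite add0r coefXn eqxx scale1r.
  by rewrite coefXn ltn_eqF // scale0r coef0.
have lt1 : (size (f - lcomp m.+1 a (c *: 'X^i))%R < n)%N.
  apply: leq_trans le; rewrite -[X in (_ < X)%N](ltn_predK ge) ltnS.
  apply/leq_sizeP => t; rewrite leq_eqVlt => /predU1P[<-|lt]; rewrite coefB E.
    rewrite -lead_coefE sf big_ord_recr /= lamX_top big1 ?add0r ?divfK ?subrr // => k _.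
    by rewrite nth_default // (leq_trans (lamX_size _ _)) // ltn_add2r.
  rewrite nth_default; last by rewrite -(ltn_predK ge).
  rewrite sub0r big1 ?mulr0 ?oppr0 // => k _; rewrite nth_default //.
  rewrite (leq_trans (lamX_size _ _)) //; move: lt; rewrite sf; apply: leq_ltn_trans.
  by rewrite leq_add2r -ltnS.
have f1K : f - lcomp m.+1 a (c *: 'X^i) \is a polyOver K.
  apply: rpredB => //; apply: rpred_sum => k _; apply: rpred_sum => j _.
  apply/polyOverP => t; rewrite coefZ rpredM ?(polyOverP qK) //.
  by have := aO k; rewrite vint_vball => /(@lamX_vball (k + j) _ _ t)/vballP[].
have [q [r [qK' rK sr Er]]] := IH _ lt1 f1K.
exists (q + c *: 'X^i), r; split=> //; first exact: rpredD.
by rewrite lcompD addrAC -Er subrK.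
Qed.

End Gauss.

Variables (K K1 : divringClosed L).
Hypothesis KK1 : {subset K <= K1}.
Hypothesis K1mono : mono_subfield K1.
Hypothesis Kmono : mono_subfield K.
Hypothesis Kd : dhens K.
Variables (n : nat) (beta : nat -> L).
Hypothesis betaK1 : forall j, beta j \in K1.
Hypothesis basis : forall x, x \in K1 -> exists2 c : nat -> L, forall j, c j \in K &
  x = \sum_(j < n) c j * beta j /\ forall j, (j < n)%N -> c j * beta j ≼ x.

(* Divide the operators u d^l, 0 <= l <= m n, on the left by A = \sum_k (a k) d^k.
   The remainders are dependent over [K], so \sum_l u d^l e_l = A B with e_l in
   [K]; [jet_mulC] solves \sum_l (e_l z)^(l) = b in [K] and w = B z. *)
Lemma neat_multiple m a u b : (forall k, a k \in vint_in K1) ->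
  (exists2 k, (k < m.+1)%N & 1 ≼ a k) -> a m != 0 -> u \in K1 -> b \in K ->
  exists w, [/\ w \in K1, w ≼ b * u & \sum_(k < m.+1) a k * jet k w = b * u].
Proof.
move=> aO aunit am uK bK.
(* A remainder has [m] coefficients with [n] coordinates each, so N + 1 remainders are linearly
   dependent over [K]. *)
pose N := (m * n)%N.
have uv : u \in vball K1 u by apply/vballP.
have lamK l : lamX l u \is a polyOver K1.
  by apply/polyOverP => t; have /vballP[] := lamX_vball K1mono l t uv.
have exqr l : exists qr : {poly L} * {poly L}, [/\ qr.1 \is a polyOver K1,
    qr.2 \is a polyOver K1, (size qr.2 <= m)%N & lamX l u = lcomp m.+1 a qr.1 + qr.2].
  have [q [r [h1 h2 h3 h4]]] := lcomp_division K1mono aO am (lamK l).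
  by exists (q, r).
have [qr hqr] := choice exqr.
have exc l : exists ci : nat -> nat -> L, forall i, (forall j, ci i j \in K) /\
    (qr l).2`_i = \sum_(j < n) ci i j * beta j.
  have h i : exists c : nat -> L, (forall j, c j \in K) /\ (qr l).2`_i = \sum_(j < n) c j * beta j.
    have [_ rK _ _] := hqr l; have [c cK [E _]] := basis (polyOverP rK i).
    by exists c.
  by have [c hc] := choice h; exists c.
have [kap hkap] := choice exc.
have [|e [eK [l1 le1 nz1] he]] := @lin_dep L K N (fun l t => kap l (t %/ n)%N (t %% n)%N).
  by move=> l t; case: (hkap l (t %/ n)%N) => h _; apply: h.
have rel i : \sum_(l < N.+1) e l * (qr l).2`_i = 0.
  have [lt|ge] := ltnP i m; last first.
    apply: big1 => l _; have [_ _ sr _] := hqr l.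
    by rewrite nth_default ?mulr0 // (leq_trans sr).
  under eq_bigr => l _ do rewrite (proj2 (hkap l i)) mulr_sumr.
  rewrite exchange_big big1 // => j _ /=.
  under eq_bigr => l _ do rewrite mulrA.
  rewrite -mulr_suml; have ltt : (i * n + j < N)%N.
    rewrite /N; apply: (@leq_trans (i.+1 * n)%N); last by rewrite leq_mul2r lt orbT.
    by rewrite mulSn addnC ltn_add2r.
  have := he _ ltt; rewrite divnMDl ?(leq_ltn_trans (leq0n j)) // divn_small // addn0.
  by rewrite modnMDl modn_small // => ->; rewrite mul0r.
(* Dividing the homogeneous relation by a dominant coefficient makes all coefficients integral and
   one of them 1, as [jet_mulC] requires. *)
have [l0 [ltl0 e0 emax _]] := @vle_last_max _ L N.+1 e (ex_intro2 _ _ l1 (le1 : (l1 < N.+1)%N) nz1).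
pose e' l := if (l <= N)%N then e l / e l0 else 0.
have e'O l : e' l \in vint_in K.
  rewrite /e'; case: ifP => h; last exact: rpred0.
  by apply/vint_inP; rewrite rpredM ?rpredV // vle_div1 // emax.
have [z [zK zb zE]] : exists z, [/\ z \in K, z ≼ b & \sum_(l < N.+1) jet l (e' l * z) = b].
  apply: jet_mulC => //; exists l0 => //.
  by rewrite /e' -ltnS ltl0 divff.
pose B := \sum_(l < N.+1) e' l *: (qr l).1.
have BK : B \is a polyOver K1.
  apply: rpred_sum => l _; apply/polyOverP => i; rewrite coefZ rpredM //.
    by apply: KK1; case/vint_inP: (e'O l).
  by have [qK _ _ _] := hqr l; apply: (polyOverP qK).
have BE : lcomp m.+1 a B = \sum_(l < N.+1) e' l *: lamX l u.
  rewrite lcomp_sum; under eq_bigr => l _ do rewrite lcompZ.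
  have r0 : \sum_(l < N.+1) e' l *: (qr l).2 = 0.
    apply/polyP => i; rewrite coef_sum coef0.
    transitivity ((\sum_(l < N.+1) e l * (qr l).2`_i) / e l0); last by rewrite rel mul0r.
    by rewrite mulr_suml; apply: eq_bigr => l _; rewrite coefZ /e' -ltnS ltn_ord mulrAC.
  transitivity (\sum_(l < N.+1) e' l *: lcomp m.+1 a (qr l).1 + \sum_(l < N.+1) e' l *: (qr l).2).
    by rewrite r0 addr0.
  rewrite -big_split; apply: eq_bigr => l _ /=.
  by have [_ _ _ ->] := hqr l; rewrite scalerDr.
have Bu i : B`_i ≼ u.
  apply: (lcomp_ge K1mono aO aunit BK) => t; rewrite BE coef_sum; apply: vle_sum => l _.
  rewrite coefZ; apply: vle_1M; first by case/vint_inP: (e'O l).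
  by have /vballP[] := lamX_vball K1mono l t uv.
have wb : opr B z \in vball K1 (b * u).
  apply: rpred_sum => i _; apply: jet_vball => //; apply/vballP; split.
    by rewrite rpredM ?(polyOverP BK) // KK1.
  by rewrite mulrC; apply: vleM.
have /vballP[wK wle] := wb.
exists (opr B z); split=> //.
rewrite -lcompE BE opr_sum; under eq_bigr => l _ do rewrite oprZ lamXE.
by rewrite -mulr_sumr zE mulrC.
Qed.

(** A valuation basis splits [b] into summands no larger than [b], each treated by [neat_multiple]
    with u = beta j. The operator is cut at its highest nonzero coefficient, by which the division
    divides. *)
Theorem neat_surjective m a b : (forall k, a k \in vint_in K1) ->
  (exists2 k, (k < m)%N & 1 ≼ a k) -> b \in K1 ->
  exists w, [/\ w \in K1, w ≼ b & \sum_(k < m) a k * jet k w = b].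
Proof.
move=> aO [k1 ltk1 ak1] bK.
have exP : exists k, (k < m)%N && (a k != 0).
  by exists k1; rewrite ltk1 (vle_neq0 ak1) ?oner_neq0.
have ubP k : (k < m)%N && (a k != 0) -> (k <= m)%N by case/andP => /ltnW.
case: (ex_maxnP exP ubP) => r /andP[ltr ar] rmax.
have k1r : (k1 <= r)%N by apply: rmax; rewrite ltk1 (vle_neq0 ak1) ?oner_neq0.
have short w : \sum_(k < m) a k * jet k w = \sum_(k < r.+1) a k * jet k w.
  rewrite [RHS](big_ord_widen m (fun k => a k * jet k w)) // [RHS]big_mkcond /=.
  apply: eq_bigr => k _; case: ifPn => //; rewrite -leqNgt => lt.
  have [->|nz] := eqVneq (a k) 0; first by rewrite mul0r.
  by have := rmax k; rewrite ltn_ord nz => /(_ isT); rewrite leqNgt lt.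
have [c cK [E cb]] := basis bK.
have exw j : exists w, (j < n)%N -> [/\ w \in K1, w ≼ c j * beta j &
    \sum_(k < r.+1) a k * jet k w = c j * beta j].
  have [w hw] := @neat_multiple r a (beta j) (c j) aO (ex_intro2 _ _ k1 (k1r : (k1 < r.+1)%N) ak1) ar (betaK1 j) (cK j).
  by exists w.
have [w hw] := choice exw; exists (\sum_(j < n) w j); split.
- by apply: rpred_sum => j _; case: (hw j (ltn_ord j)).
- apply: vle_sum => j _; have [_ h _] := hw j (ltn_ord j).
  exact: vle_trans h (cb j (ltn_ord j)).
rewrite short; under eq_bigr => k _ do rewrite raddf_sum mulr_sumr.
rewrite exchange_big /= [RHS]E; apply: eq_bigr => j _.
by have [_ _ h] := hw j (ltn_ord j).
Qed.

End NeatSurjectivity.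

(** * Differential henselianity of simple extensions *)

Section QuasilinearNewton.
Variables (H : oagType) (L : valuedDiffFieldType H).
Variable K : divringClosed L.
Hypothesis Kmono : mono_subfield K.

Lemma meval_small n (P : {mpoly L[n]}) (v : 'I_n -> L) :
  (forall m, P@_m ≺ 1) -> (forall i, v i ≼ 1) -> P.@[v] ≺ 1.
Proof.
move=> P1 v1; rewrite mevalE; apply: vlt_sum; first exact: oner_neq0.
move=> m _; apply: vlt_M1 => //.
by apply: (big_ind (fun x => x ≼ 1)) => [|a b|i _]; [exact: vle_refl | exact: vle_M1 | exact: vleX1].
Qed.

Variables (n : nat) (P : {mpoly L[n]}).
Hypothesis Pq : quasilinear K P.

Let PO : forall m, P@_m \in vint_in K. Proof. by case: Pq. Qed.

Let ord (F : 'I_n -> L) (k : nat) : L := oapp F 0 (insub k).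

Let ordE F (i : 'I_n) : ord F i = F i. Proof. by rewrite /ord valK. Qed.

Let ord_vint F : (forall i, F i \in vint_in K) -> forall k, ord F k \in vint_in K.
Proof. by move=> FO k; rewrite /ord; case: insub => [i|] /=; rewrite ?rpred0. Qed.

Lemma deval_mderiv y (i : 'I_n) : y \in vint_in K -> deval P^`M(i) y - P@_U_(i) ≺ 1.
Proof.
move=> yO; have -> : deval P^`M(i) y - P@_U_(i) = deval (P^`M(i) - (P@_U_(i))%:MP) y.
  by rewrite /deval mevalB mevalC.
apply: meval_small => [m|j]; last by case/vint_inP: (jet_vint Kmono j yO).
rewrite mcoeffB mcoeffC mcoeff_mderiv; case: eqVneq => [->|m0].
  by rewrite mulr1 mnm0E add0m subrr v0lt1.
rewrite mulr0 subr0 -mulr_natl; apply: vlt_1M; first exact: vnat_le1.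
have [_ h _] := Pq; apply: h; rewrite mdegD mdeg1 addn1 ltnS.
by rewrite lt0n mdeg_eq0.
Qed.

Hypothesis neat : forall m a b, (forall k, a k \in vint_in K) ->
  (exists2 k, (k < m)%N & 1 ≼ a k) -> b \in K ->
  exists w, [/\ w \in K, w ≼ b & \sum_(k < m) a k * jet k w = b].

(** The linearization of [P] at [y] still has a unit coefficient, so [neat] solves the Newton
    equation exactly with a correction at most [d]; only the second-order Taylor remainder is
    left. *)
Lemma quasilinear_newton y d : y \in vint_in K -> d ≼ 1 -> deval P y ≼ d ->
  exists2 y', y' \in vint_in K & deval P y' ≼ d * d.
Proof.
move=> yO d1 yd; have [_ _ [i0 i1]] := Pq.
have [PK _] := vint_inP _ _ (deval_vint Kmono PO yO).
have [|||w [wK wle]] := @neat n (ord (fun i => deval P^`M(i) y)) (- deval P y).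
- by apply: ord_vint => i; apply: deval_vint => //; apply: mderiv_vint.
- exists i0 => //; rewrite ordE.
  by have := vle_addr_iff P@_U_(i0) (deval_mderiv i0 yO); rewrite addrC subrK i1.
- by rewrite rpredN.
under eq_bigr => i _ do rewrite ordE.
move=> E; have wd : w \in vball K d.
  by apply/vballP; split=> //; apply: vle_trans wle _; rewrite vleN.
have wO : w \in vint_in K by apply/vint_inP; split=> //; case/vballP: wd => _ h; apply: vle_trans d1.
exists (y + w); first exact: rpredD.
have /vballP[_] := deval_add Kmono PO yO wd d1.
by rewrite E opprK subrK.
Qed.

(** An exact zero of the part of degree at most 1 leaves only the terms of higher degree, whose
    coefficients are infinitesimal. *)
Lemma quasilinear_approx : exists2 y, y \in vint_in K & deval P y ≺ 1.
Proof.
have [_ h2 [i0 i1]] := Pq.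
have P0 : P@_0 \in vint_in K by [].
have [|||w [wK wle]] := @neat n (ord (fun i => P@_U_(i))) (- P@_0).
- exact: ord_vint.
- by exists i0 => //; rewrite ordE.
- by rewrite rpredN; case/vint_inP: P0.
under eq_bigr => i _ do rewrite ordE.
move=> E; have wO : w \in vint_in K.
  by apply/vint_inP; split=> //; apply: vle_trans wle _; rewrite vleN; case/vint_inP: P0.
exists w => //; pose Q := P - (P@_0)%:MP - \sum_(i < n) P@_U_(i) *: 'X_i.
have -> : deval P w = deval Q w.
  rewrite /deval !mevalB mevalC [X in _ - X](raddf_sum (meval _)) /=.
  under eq_bigr => i _ do rewrite mevalZ mevalXU.
  by rewrite E opprK subrK.
apply: meval_small => [m|j]; last by case/vint_inP: (jet_vint Kmono j wO).
rewrite !mcoeffB mcoeffC raddf_sum /=.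
under eq_bigr => i _ do rewrite mcoeffZ mcoeffX.
case: (ltngtP (mdeg m) 1) => [|lt|/eqP/mdeg1P[i /eqP ->]].
- rewrite ltnS leqn0 mdeg_eq0 => /eqP ->; rewrite eqxx mulr1 subrr sub0r big1 ?oppr0 ?v0lt1 // => i _.
  by rewrite mnm1_eq0 mulr0.
- rewrite big1 => [|i _].
    rewrite subr0; have [m0|_] := eqVneq 0%MM m; last by rewrite mulr0 subr0 h2.
    by rewrite -m0 mdeg0 in lt.
  by have [e|] := eqVneq; rewrite ?mulr0 // -e mdeg1 in lt *.
rewrite (bigD1 i) //= eqxx mulr1 [U_(i)%MM == 0%MM]mnm1_eq0 mulr0 subr0 big1 ?addr0 ?subrr ?v0lt1 // => j ji.
by rewrite eq_mnm1 (negbTE ji) mulr0.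
Qed.

(* Residuals attainable in [vint_in K] are squared by Newton's method; when no
   exact zero exists they are multiplicatively cofinal. *)
Definition residual d : Prop := [/\ d != 0, d ≺ 1 & exists2 y, y \in vint_in K & deval P y ≼ d].

Lemma residual_small d : residual d -> d != 0 /\ d ≺ 1. Proof. by case. Qed.

Lemma residual_mul d e : residual d -> residual e -> exists2 f, residual f & f ≼ d * e.
Proof.
have sq c : residual c -> residual (c * c).
  move=> [c0 c1 [y yO yc]]; split; first by rewrite mulf_neq0.
    by apply: vlt_M1 => //; apply: vlt_le.
  exact: quasilinear_newton yO (vlt_le c1) yc.
move=> Rd Re; case/orP: (vle_total d e) => le.
  by exists (d * d); [apply: sq | apply: vleM => //; apply: vle_refl].
by exists (e * e); [apply: sq | apply: vleM => //; apply: vle_refl].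
Qed.

Lemma residual_ex : (forall y, y \in vint_in K -> deval P y != 0) -> exists d, residual d.
Proof.
move=> no; have [y yO y1] := quasilinear_approx.
by exists (deval P y); split=> //; [exact: no | exists y => //; apply: vle_refl].
Qed.

Lemma residual_zero y : y \in vint_in K -> (exists d, residual d) ->
  infinitesimal residual (deval P y) -> deval P y = 0.
Proof.
move=> yO [d0 Rd0] yI; apply/eqP; apply: contraT => y0.
have y1 : deval P y ≺ 1.
  by apply: vle_lt_trans (yI _ Rd0) _; case: Rd0.
have Ry : residual (deval P y) by split=> //; exists y => //; apply: vle_refl.
have [f Rf fle] := residual_mul Ry Ry.
have := vle_trans (yI _ Rf) fle; rewrite -[X in X ≼ _]mulr1 vle_pM2l // => h.
by move: y1; rewrite /vlt h.
Qed.

End QuasilinearNewton.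

(** * Coordinate charts up to infinitesimals *)

Section Charts.
Variables (H : oagType) (L : valuedDiffFieldType H).
Variables K K1 : divringClosed L.
Hypothesis KK1 : {subset K <= K1}.
Hypothesis Kmono : mono_subfield K.
Hypothesis K1mono : mono_subfield K1.
Hypothesis Kd : dhens K.

Variable D : L -> Prop.
Hypothesis D_ex : exists d, D d.
Hypothesis D_small : forall d, D d -> d != 0 /\ d ≺ 1.
Hypothesis D_mul : forall d e, D d -> D e -> exists2 f, D f & f ≼ d * e.

Lemma inf_M1 x b : infinitesimal D x -> b ≼ 1 -> infinitesimal D (x * b).
Proof. by move=> xI b1 d Dd; apply: vle_M1 => //; apply: xI. Qed.

Lemma notinfM x y : ~ infinitesimal D x -> ~ infinitesimal D y -> ~ infinitesimal D (x * y).
Proof.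
move=> /notinf[d Dd dx] /notinf[e De ey] h; have [f Df fle] := D_mul Dd De.
by have := vle_lt_trans (vle_trans (h f Df) fle) (vltM dx ey); rewrite vlt_irr.
Qed.

Lemma notinf_expr x k : ~ infinitesimal D x -> ~ infinitesimal D (x ^+ k).
Proof.
move=> xI; elim: k => [h|k IH]; last by rewrite exprS; apply: notinfM.
by have := inf_le1 D_ex D_small h; rewrite vlt_irr.
Qed.

(** Some member of D lies below [c], and D is multiplicatively cofinal. This is what allows charts
    to have denominators. *)
Lemma inf_div x c : ~ infinitesimal D c -> infinitesimal D x -> infinitesimal D (c^-1 * x).
Proof.
move=> cI xI d Dd; have [e De ec] := notinf cI; have [f Df fle] := D_mul Dd De.
rewrite mulrC vdiv_le ?(vlt_neq0 ec) //; apply: vle_trans (xI f Df) _.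
by apply: vle_trans fle _; apply: vleM; [exact: vle_refl | exact: vlt_le].
Qed.

Lemma deval_inf n (P : {mpoly L[n]}) y y' : (forall m, P@_m \in vint_in K1) ->
  y \in vint_in K1 -> y' \in vint_in K1 -> infinitesimal D (y' - y) ->
  infinitesimal D (deval P y' - deval P y).
Proof.
move=> PO yO y'O yI d Dd; have [_ d1] := D_small Dd; have d1' := vlt_le d1.
have wd : y' - y \in vball K1 d.
  by apply/vballP; split; [case/vint_inP: (rpredB y'O yO) | exact: yI].
have /vballP[_] := deval_add K1mono PO yO wd d1'; rewrite [y + _]addrC subrK => h.
apply: (@vle_swap _ _ _ (\sum_(i < n) deval P^`M(i) y * jet i (y' - y))).
  by apply: vle_trans h _; rewrite expr2; apply: vle_M1 => //; apply: vle_refl.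
apply: vle_sum => i _; apply: vle_1M.
  by case/vint_inP: (deval_vint K1mono (mderiv_vint i PO) yO).
by case/vballP: (jet_vball K1mono i wd).
Qed.

(* A chart: up to infinitesimals, every integral element of [K1] is c^-1 times an
   integral combination of 1, s, ..., s^(m-1) over [K], with c not infinitesimal.
   Passing to coordinates turns a differential polynomial over [K1] into [m]
   differential polynomials over [K], to which [swap_quantifiers] applies. *)
Variables (s c : L) (m : nat).
Hypothesis sK1 : s \in K1.
Hypothesis s1 : s ≼ 1.
Hypothesis reduce : forall k, s ^+ k \in sball K s m 1.
Hypothesis ds : der s \in sring K s m.
Hypothesis cO : c \in vint_in K.
Hypothesis c_notinf : ~ infinitesimal D c.
Hypothesis chart_approx : forall y, y \in vint_in K1 -> exists u,
  (forall i, u i \in vint_in K) /\ infinitesimal D (c * y - scomb s m u).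
Hypothesis chart_orth : forall a, (forall i, a i \in K) ->
  forall i, (i < m)%N -> c * a i ≼ scomb s m a.

Let c0 : c != 0.
Proof. by apply/eqP => c0; apply: c_notinf; rewrite c0 => d _; apply: v0le. Qed.

Let c1 : c ≼ 1. Proof. by case/vint_inP: cO. Qed.

(* As [rep], up to a power of the common denominator [c]. *)
Let wrep g := exists k, rep K s m (fun z => c ^+ k * g z).

Let rep_cX k g : rep K s m g -> rep K s m (fun z => c ^+ k * g z).
Proof. by apply: rep_scale => //; apply: dmap_const; apply: rpredX. Qed.

Let wrep_ext g h : (forall z, g z = h z) -> wrep g -> wrep h.
Proof. by move=> gh [k r]; exists k; apply: rep_ext r => z; rewrite gh. Qed.

Let wrep_add g h : wrep g -> wrep h -> wrep (fun z => g z + h z).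
Proof.
move=> [k gr] [l hr]; exists (l + k)%N.
apply: (rep_ext (g := fun z => c ^+ l * (c ^+ k * g z) + c ^+ k * (c ^+ l * h z))) => [z|].
  by rewrite exprD; ring.
by apply: rep_add; apply: rep_cX.
Qed.

Let wrep_mul g h : wrep g -> wrep h -> wrep (fun z => g z * h z).
Proof.
move=> [k gr] [l hr]; exists (k + l)%N.
apply: (rep_ext (g := fun z => (c ^+ k * g z) * (c ^+ l * h z))) => [z|].
  by rewrite exprD; ring.
exact: rep_mul.
Qed.

Let wrep_const x : x \in sring K s m -> wrep (fun=> x).
Proof. by move=> xA; exists 0%N; apply: rep_cX; apply: rep_const. Qed.

Let wrep_der g : wrep g -> wrep (fun z => der (g z)).
Proof.
move=> [k gr]; exists k.+1.
apply: (rep_ext (g := fun z => c * der (c ^+ k * g z) + (- (k%:R * der c)) * (c ^+ k * g z))) => [z|].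
  rewrite derM derX exprS; case: (k) => [|l]; first by rewrite !expr0; ring.
  by rewrite /= exprS; ring.
apply: rep_add; apply: rep_scale => //.
- exact: dmap_const.
- exact: rep_der.
- apply: dmap_const; rewrite rpredN rpredM ?rpred_nat //.
  exact: (jet_vint Kmono 1).
Qed.

Let wrep_sum (I : Type) (r : seq I) g : (forall i, wrep (g i)) -> wrep (fun z => \sum_(i <- r) g i z).
Proof.
move=> gw; elim: r => [|i r IH].
  by apply: (wrep_ext (g := fun=> 0)) => [z|]; [rewrite big_nil | apply: wrep_const; apply: rpred0].
by apply: (wrep_ext (g := fun z => g i z + \sum_(j <- r) g j z)) => [z|];
  [rewrite big_cons | apply: wrep_add].
Qed.

Let wrep_prod (I : Type) (r : seq I) g : (forall i, wrep (g i)) -> wrep (fun z => \prod_(i <- r) g i z).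
Proof.
have w1 : wrep (fun=> 1) by apply: wrep_const; have := reduce 0; rewrite expr0.
move=> gw; elim: r => [|i r IH].
  by apply: (wrep_ext (g := fun=> 1)) => [z|]; [rewrite big_nil |].
by apply: (wrep_ext (g := fun z => g i z * \prod_(j <- r) g j z)) => [z|];
  [rewrite big_cons | apply: wrep_mul].
Qed.

Let wrep_exp g k : wrep g -> wrep (fun z => g z ^+ k).
Proof.
move=> gw; apply: (wrep_ext (g := fun z => \prod_(i < k) g z)) => [z|].
  by rewrite prodr_const card_ord.
exact: wrep_prod.
Qed.

Let pt z := c^-1 * scomb s m z.

Let wrep_jet k : wrep (fun z => jet k (pt z)).
Proof.
elim: k => [|k IH]; last exact: wrep_der.
exists 1%N; apply: (rep_ext (g := scomb s m)) => [z|]; first by rewrite expr1 mulVKf.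
exact: rep_scomb.
Qed.

Lemma chart_zero n (P : {mpoly L[n]}) : (forall k, P@_k \in vint_in K1) ->
  (forall d, D d -> exists2 y, y \in vint_in K1 & deval P y ≼ d) ->
  exists2 y, y \in vint_in K1 & infinitesimal D (deval P y).
Proof.
move=> PO Papprox.
have exp k : exists u, (forall i, u i \in vint_in K) /\ infinitesimal D (c * P@_k - scomb s m u).
  exact: chart_approx.
have [p hp] := choice exp.
(* [P] at the point with coordinates [z], its coefficients replaced by their chart approximations.
   The change is infinitesimal, and a power of [c] times [g] has coordinates given by differential
   polynomials over [K]. *)
pose g z := \sum_(k <- msupp P) pt (p k) * \prod_(i < n) jet i (pt z) ^+ k i.
have ptK1 z : (forall i, z i \in vint_in K) -> pt z \in K1.
  move=> zO; rewrite rpredM ?rpredV ?(KK1 (proj1 (vint_inP _ _ cO))) // rpred_sum // => i _.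
  by rewrite rpredM ?rpredX // KK1 //; case/vint_inP: (zO i).
have gP z : pt z \in vint_in K1 -> infinitesimal D (deval P (pt z) - g z).
  move=> zO; rewrite /deval mevalE /g -sumrB; apply/inf_predP/rpred_sum => k _.
  apply/inf_predP; rewrite -mulrBl; apply: inf_M1.
    rewrite -[P@_k](mulKf c0) -mulrBr; apply: inf_div => //.
    by case: (hp k).
  apply: (big_ind (fun x => x ≼ 1)) => [|a b|i _]; [exact: vle_refl | exact: vle_M1 |].
  by apply: vleX1; case/vint_inP: (jet_vint K1mono i zO).
have [k [Q [Qd QE]]] : wrep g.
  apply: wrep_sum => k; apply: wrep_mul; last first.
    by apply: wrep_prod => i; apply: wrep_exp; apply: wrep_jet.
  exists 1%N; apply: (rep_ext (g := fun=> scomb s m (p k))) => [z|]; first by rewrite expr1 mulVKf.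
  apply: rep_const; apply/sballP; exists (p k); split=> // i.
  by rewrite -vint_vball; case: (hp k).
have exT i : exists t, tconst (vint_in K) t /\ forall z, Q i z = teval z t.
  by have [t tK E] := Qd i; exists t.
have [t ht] := choice exT.
have [e De ec] := notinf c_notinf.
have ptE z z' : pt z - pt z' = c^-1 * scomb s m (fun i => z i - z' i).
  rewrite -mulrBr /scomb -sumrB; congr (_ * _).
  by apply: eq_bigr => i _; rewrite mulrBl.
have hyp d : D d -> exists z, [/\ pt z ≼ 1, forall j, z j \in vint_in K,
    forall j, (m <= j)%N -> z j = 0 & forall i, (i < m)%N -> teval z (t i) ≼ d].
  (* The error is taken below d * e with e ≺ c, because [chart_orth] loses a factor [c] in passing
     to coordinates. *)
  move=> Dd; have [f Df fle] := D_mul Dd De; have [y yO yf] := Papprox _ Df.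
  have [u [uO uI]] := chart_approx yO; pose z j := if (j < m)%N then u j else 0.
  have zO j : z j \in vint_in K by rewrite /z; case: ifP => // _; apply: rpred0.
  have zu : scomb s m z = scomb s m u.
    by apply: eq_bigr => j _; rewrite /z ltn_ord.
  have zI : infinitesimal D (pt z - y).
    move=> h Dh; rewrite vle_subC -[y](mulKf c0) /pt zu -mulrBr.
    exact: inf_div.
  have pt1 : pt z \in vint_in K1.
    apply/vint_inP; split; first exact: ptK1.
    case/vint_inP: (yO) => _; apply: vle_swap; apply: vlt_le.
    exact: (inf_le1 D_ex D_small zI).
  exists z; split=> // [|j|i lti]; first by case/vint_inP: pt1.
    by rewrite leqNgt /z => /negbTE ->.
  have gf : g z ≼ f.
    apply: (@vle_swap _ _ _ (deval P (pt z))); first by rewrite vle_subC; apply: gP.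
    by apply: vle_swap yf; apply: (deval_inf PO).
  have [_ <-] := ht i; rewrite -(vle_pM2l _ _ c0).
  apply: vle_trans (chart_orth (a := Q^~ z) _ lti) _ => [j|].
    by case/vint_inP: (dmap_vint Kmono (Qd j) zO).
  rewrite -QE; apply: vle_1M; first exact: vleX1.
  apply: (vle_trans gf); apply: (vle_trans fle).
  by rewrite [c * d]mulrC; apply: vleM; [apply: vle_refl | apply: vlt_le].
have tK i : (i < m)%N -> tconst (vint_in K) (t i) by move=> _; case: (ht i).
(* The relation carried along says that the point is integral. It survives because the coordinates
   move by at most [e], hence the point by less than 1. *)
have [h [z0 [z [_ z01 zz z_ Qz]]]] :=
  swap_quantifiers Kmono Kd D_ex D_small D_mul (A := fun=> fun z => pt z ≼ 1) tK hyp De.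
have zO j : z j \in vint_in K by case: (zz j).
have pt1 : pt z \in vint_in K1.
  apply/vint_inP; split; first exact: ptK1.
  apply: vle_swap z01; rewrite ptE mulrC vdiv_le // mul1r.
  apply: vle_sum => j _; apply: vle_M1; last exact: vleX1.
  by case: (zz j) => _ le; apply: vle_trans le (vlt_le ec).
exists (pt z) => //; rewrite -(subrK (g z) (deval P (pt z))).
apply/inf_predP; apply: rpredD; first by apply/inf_predP; apply: gP.
apply/inf_predP; rewrite -[g z](mulKf (expf_neq0 k c0)); apply: inf_div.
  exact: notinf_expr.
rewrite QE; apply/inf_predP/rpred_sum => j _; apply/inf_predP/inf_M1; last exact: vleX1.
by case: (ht j) => _ ->; apply: Qz.
Qed.

End Charts.

Section SimpleExtension.
Variables (H : oagType) (L : valuedDiffFieldType H).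
Variables K K1 : divringClosed L.
Hypothesis KK1 : {subset K <= K1}.
Hypothesis Kmono : mono_subfield K.
Hypothesis K1mono : mono_subfield K1.
Hypothesis Kd : dhens K.
Variables (theta : L) (f : nat).
Hypothesis thetaK1 : theta \in K1.
Lemma vgeX1 (x : L) k : 1 ≼ x -> 1 ≼ x ^+ k.
Proof.
move=> x1; elim: k => [|k IH]; first by rewrite expr0 vle_refl.
by rewrite exprS -[1]mulr1; apply: vleM.
Qed.

Hypothesis span : forall x, x \in K1 -> exists2 c, forall j, c j \in K & x = scomb theta f c.
Hypothesis orth : forall c, (forall j, c j \in K) ->
  forall j, (j < f)%N -> c j * theta ^+ j ≼ scomb theta f c.

Let neat m a b : (forall k, a k \in vint_in K1) ->
  (exists2 k, (k < m)%N & 1 ≼ a k) -> b \in K1 ->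
  exists w, [/\ w \in K1, w ≼ b & \sum_(k < m) a k * jet k w = b].
Proof.
apply: (@neat_surjective _ L K K1 KK1 K1mono Kmono Kd f (fun j => theta ^+ j)).
  by move=> j; apply: rpredX.
by move=> x /span[c cK E]; exists c => //; split=> // j ltj; rewrite E; apply: orth.
Qed.

Let zero_or_residual n (P : {mpoly L[n]}) : quasilinear K1 P ->
  ((exists d, residual K1 P d) ->
    exists2 y, y \in vint_in K1 & infinitesimal (residual K1 P) (deval P y)) ->
  exists2 y, y \in vint_in K1 & deval P y = 0.
Proof.
move=> Pq h; have [//|no] := EM (exists2 y, y \in vint_in K1 & deval P y = 0).
have Rex : exists d, residual K1 P d.
  apply: (residual_ex K1mono Pq neat) => y yO; apply/eqP => y0.
  by apply: no; exists y.
have [y yO yI] := h Rex; exists y => //.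
exact: (residual_zero K1mono Pq neat).
Qed.

Let attained n (P : {mpoly L[n]}) d : residual K1 P d ->
  exists2 y, y \in vint_in K1 & deval P y ≼ d.
Proof. by case. Qed.

Let inf0 D : @infinitesimal _ L D 0. Proof. by move=> d _; apply: v0le. Qed.

(** Since the powers of [theta] are units, [orth] gives integral elements integral coordinates, so
    [theta] is a chart with c = 1. *)
Theorem dhens_residual : theta ≼ 1 -> 1 ≼ theta -> dhens K1.
Proof.
move=> t1 t1' n P Pq; apply: zero_or_residual => // Rex.
have [PO _ _] := Pq.
have R1 := @residual_small _ L K1 n P.
have coefO c : (forall j, c j \in K) -> forall j, (j < f)%N -> c j ≼ scomb theta f c.
  move=> cK j ltj; apply: vle_trans (orth cK ltj).
  by rewrite -{1}[c j]mulr1; apply: vleM; [apply: vle_refl | apply: vgeX1].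
have sringO y : y \in vint_in K1 -> exists u, (forall i, u i \in vint_in K) /\ y = scomb theta f u.
  move=> /vint_inP[/span[c cK ->] y1]; exists (fun j => if (j < f)%N then c j else 0); split=> [j|].
    case: ifP => ltj; last exact: rpred0.
    by apply/vint_inP; split=> //; apply: vle_trans (coefO _ cK _ ltj) y1.
  by apply: eq_bigr => j _; rewrite ltn_ord.
have sringI y : y \in vint_in K1 -> y \in sring K theta f.
  by move=> /sringO[u [uO ->]]; apply/sballP; exists u.
have tO : theta \in vint_in K1 by apply/vint_inP.
apply: (@chart_zero _ L K K1 KK1 Kmono K1mono Kd _ Rex R1 _ theta 1 f) => //.
- by move=> d e; apply: (residual_mul K1mono Pq neat).
- by move=> k; apply: sringI; apply: rpredX.
- by apply: sringI; apply: (jet_vint K1mono 1).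
- exact: rpred1.
- by move=> h; have := inf_le1 Rex R1 h; rewrite vlt_irr.
- move=> y /sringO[u [uO E]]; exists u; split=> //.
  by rewrite -E mul1r subrr; apply: inf0.
- by move=> a aK i lti; rewrite mul1r; apply: coefO.
- exact: attained.
Qed.

(* If some integral b theta is not infinitesimal, its powers give a chart;
   otherwise all integral a theta^j, 0 < j < f, are infinitesimal and 1 does. *)
Theorem dhens_ramified : prime f -> theta != 0 -> theta ^+ f \in K -> dhens K1.
Proof.
move=> fp t0 tfK n P Pq; apply: zero_or_residual => // Rex.
have [PO _ _] := Pq; have f0 := prime_gt0 fp.
have R1 := @residual_small _ L K1 n P.
have R2 d e := @residual_mul _ L K1 K1mono n P Pq neat d e.
set D := residual K1 P in Rex R1 R2 *.
have ninf1 : ~ infinitesimal D 1.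
  by move=> h; have := inf_le1 Rex R1 h; rewrite vlt_irr.
have [[b bK [bt1 btI]]|no] := EM (exists2 b, b \in K & b * theta ≼ 1 /\ ~ infinitesimal D (b * theta)).
  (* [c] lies in [K] and serves as common denominator: in terms of s^j, the multiple c * (a j
     theta^j) has the coefficient c a_j b^-j, which equals s^(f-j) times the integral element a_j
     theta^j. *)
  pose s := b * theta; pose c := s ^+ f.
  have cK : c \in K by rewrite /c /s exprMn rpredM // rpredX.
  have cI : ~ infinitesimal D c by apply: (notinf_expr Rex R1 R2).
  have c0 : c != 0 by apply/eqP => c0; apply: cI; rewrite c0; apply: inf0.
  have s0 : s != 0 by apply: contra_neq c0 => s0; rewrite /c s0 expr0n eqn0Ngt f0.
  have b0 : b != 0 by apply: contra_neq s0 => b0; rewrite /s b0 mul0r.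
  have c1 : c ≼ 1 by apply: vleX1.
  have cO : c \in vint_in K by apply/vint_inP.
  have reduce k : s ^+ k \in sball K s f 1.
    apply/sballP; exists (fun j => if j == (k %% f)%N then c ^+ (k %/ f) else 0); split=> [j|].
      case: ifP => _; last exact: rpred0.
      by rewrite -vint_vball rpredX.
    have ltk : (k %% f < f)%N by rewrite ltn_mod.
    rewrite /scomb (bigD1 (Ordinal ltk)) //= eqxx big1 => [|j jk].
      by rewrite addr0 -exprM -exprD mulnC -divn_eq.
    by rewrite -val_eqE in jk; rewrite (negbTE jk) mul0r.
  have fn0 := @vnat_neq0 _ L f f0.
  have ds : der s = der c / (f%:R * c) * s.
    have -> : der c = f%:R * s ^+ f.-1 * der s by rewrite /c derX.
    have -> : f%:R * c = f%:R * s ^+ f.-1 * s by rewrite /c -mulrA -exprSr prednK.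
    by field; rewrite s0 expf_neq0 // fn0.
  have dcO : der c / (f%:R * c) \in vint_in K.
    have [dcK dc] := Kmono cK; apply/vint_inP; split.
      by rewrite rpred_div // rpredM // rpred_nat.
    rewrite vdiv_le ?mulf_neq0 // mul1r; apply: vle_trans dc _.
    by rewrite -{1}[c]mul1r; apply: vleM; [apply: vnat_ge1 | apply: vle_refl].
  apply: (@chart_zero _ L K K1 KK1 Kmono K1mono Kd _ Rex R1 R2 s c f) => //.
  - by rewrite rpredM // KK1.
  - rewrite ds; apply: (sring_scale reduce); first exact: sring_vint.
    by have := reduce 1%N; rewrite expr1.
  - move=> y /vint_inP[/span[a aK yE] y1].
    have aE j : (j <= f)%N -> s ^+ (f - j) * (a j * theta ^+ j) = c * a j * b ^- j.
      move=> le; rewrite /c -{2}(subnK le) exprD /s [(_ * theta) ^+ j]exprMn.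
      by field; rewrite expf_neq0.
    exists (fun j => if (j < f)%N then c * a j * b ^- j else 0); split=> [j|].
      case: ifP => [ltj|_]; last exact: rpred0.
      apply/vint_inP; split; first by rewrite !rpredM // rpredV rpredX.
      rewrite -aE; last exact: ltnW.
      apply: vle_1M; first exact: vleX1.
      by apply: vle_trans y1; rewrite yE; apply: orth.
    suff -> : c * y = scomb s f (fun j => if (j < f)%N then c * a j * b ^- j else 0).
      by rewrite subrr; apply: inf0.
    rewrite yE /scomb mulr_sumr; apply: eq_bigr => j _.
    by rewrite ltn_ord /s exprMn; field; rewrite expf_neq0.
  - move=> a aK i lti; have -> : scomb s f a = scomb theta f (fun j => a j * b ^+ j).
      by apply: eq_bigr => j _; rewrite /s exprMn mulrA.
    have abK j : a j * b ^+ j \in K by rewrite rpredM ?rpredX.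
    apply: vle_trans (orth abK lti).
    rewrite /c -(subnK (ltnW lti)) exprD -!mulrA; apply: vle_1M; first exact: vleX1.
    by rewrite /s exprMn mulrC; apply: vle_refl.
  - exact: attained.
have tI a j : (0 < j < f)%N -> a \in K -> a * theta ^+ j ≼ 1 -> infinitesimal D (a * theta ^+ j).
  move=> /andP[j0 jf] aK a1; apply: contrapT => aI.
  have cop : gcdn j f = 1%N.
    by apply/eqP; rewrite -/(coprime j f) coprime_sym prime_coprime // gtnNdvd.
  (* Bezout: as i j = q f + 1, the i-th power of a theta^j is an element of [K] times theta, and
     powers of an element that is not infinitesimal are not infinitesimal either. *)
  case: (egcdnP f j0) => i q ij _; rewrite cop in ij; apply: no; exists (a ^+ i * (theta ^+ f) ^+ q).
    by apply: rpredM; apply: rpredX.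
  have -> : a ^+ i * (theta ^+ f) ^+ q * theta = (a * theta ^+ j) ^+ i.
    by rewrite exprMn -!exprM -mulrA -exprSr mulnC [(j * i)%N]mulnC ij addn1.
  by split; [apply: vleX1 | apply: (notinf_expr Rex R1 R2)].
have span1 u : scomb 1 1 u = u 0%N by rewrite /scomb big_ord1 expr0 mulr1.
apply: (@chart_zero _ L K K1 KK1 Kmono K1mono Kd _ Rex R1 R2 1 1 1) => //.
- exact: rpred1.
- move=> k; rewrite expr1n; apply/sballP; exists (fun=> 1); rewrite span1; split=> // _.
  by rewrite -vint_vball rpred1.
- by rewrite der1 rpred0.
- exact: rpred1.
- move=> y /vint_inP[/span[a aK yE] y1].
  have f1 := prime_gt1 fp.
  have a1 j : (j < f)%N -> a j * theta ^+ j ≼ 1.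
    by move=> ltj; apply: vle_trans y1; rewrite yE; apply: orth.
  exists (fun=> a 0%N); split=> [_|].
    by apply/vint_inP; split=> //; have := a1 _ f0; rewrite expr0 mulr1.
  rewrite span1 mul1r yE /scomb; case: f f0 a1 tI => // f' _ a1' tI'.
  rewrite big_ord_recl expr0 mulr1 addrC addKr; apply/inf_predP/rpred_sum => j _.
  apply/inf_predP; apply: tI' => //; first by rewrite lift0 /= ltnS ltn_ord.
  by apply: (a1' (lift ord0 j)); apply: ltn_ord.
- move=> a aK i; rewrite ltnS leqn0 => /eqP ->; rewrite span1 mul1r; exact: vle_refl.
- exact: attained.
Qed.

End SimpleExtension.

(** * The tower of simple extensions *)

Section Adjunction.
Variables (H : oagType) (L : valuedDiffFieldType H).
Variable K : divringClosed L.
Hypothesis Kmono : mono_subfield K.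
Hypothesis Kalg : forall x : L, exists2 p : {poly L}, p \is a polyOver K & p != 0 /\ p.[x] = 0.

Definition adjoined (K1 : divringClosed L) (theta : L) : Prop :=
  forall x, (x \in K1) <-> (exists2 p, p \is a polyOver K & x = p.[theta]).

Lemma pack_divring (E : {pred L}) :
  GRing.divring_closed E -> exists S : divringClosed L, forall x, (x \in S) = (x \in E).
Proof.
move=> h; exists (HB.pack_for (divringClosed L) E (GRing.isDivringClosed.Build L E h)).
by move=> x.
Qed.

Lemma adjoin_exists theta : exists K1, adjoined K1 theta.
Proof.
pose E : {pred L} := fun x => `[< exists2 p, p \is a polyOver K & x = p.[theta] >].
suff h : GRing.divring_closed E.
  by have [S SE] := pack_divring h; exists S => x; rewrite SE; split=> /asboolP.
split.
- by apply/asboolP; exists 1; rewrite ?rpred1 // hornerC.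
- move=> x y /asboolP[p pK ->] /asboolP[q qK ->]; apply/asboolP.
  by exists (p - q); rewrite ?rpredB // hornerD hornerN.
move=> x y /asboolP[p pK ->] /asboolP[q qK ->]; apply/asboolP.
set z := q.[theta]; have [->|z0] := eqVneq z 0.
  by exists 0; rewrite ?rpred0 // invr0 mulr0 horner0.
have [u mu] := minpoly_ex Kalg z; have [um uK uz _] := mu; have [u0 _] := minpoly_inv mu z0.
pose r := \poly_(i < (size u).-1) u`_i.+1.
have rK : r \is a polyOver K.
  by apply/polyOverP => i; rewrite coef_poly; case: ifP => _; [apply: (polyOverP uK) | apply: rpred0].
have uE : u = r * 'X + (u`_0)%:P.
  apply/polyP => i; rewrite coefD coefMX coefC; case: i => [|i] /=; first by rewrite add0r.
  rewrite addr0 coef_poly; case: ltnP => // le.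
  by rewrite nth_default // -(ltn_predK (minpoly_gt1 mu)) ltnS.
have zV : z^-1 = - (u`_0)^-1 * r.[z].
  have := uz; rewrite {1}uE !hornerE => /eqP; rewrite addr_eq0 => /eqP Eu.
  by apply: (mulfI z0); rewrite divff // mulrCA [z * _]mulrC Eu mulrNN mulVf.
exists (p * ((- (u`_0)^-1)%:P * (r \Po q))).
  rewrite rpredM // rpredM ?polyOver_comp //.
  by rewrite polyOverC rpredN rpredV (polyOverP uK).
by rewrite !hornerM hornerC horner_comp zV.
Qed.

Variables (K1 : divringClosed L) (theta : L).
Hypothesis K1E : adjoined K1 theta.

Lemma adjoined_sub : {subset K <= K1}.
Proof. by move=> x xK; apply/K1E; exists x%:P; rewrite ?polyOverC // hornerC. Qed.

Lemma adjoined_gen : theta \in K1.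
Proof. by apply/K1E; exists 'X; rewrite ?polyOverX // hornerX. Qed.

Lemma adjoined_span phi x : phi \is monic -> phi \is a polyOver K -> phi.[theta] = 0 ->
  x \in K1 -> exists2 c, forall j, c j \in K & x = scomb theta (size phi).-1 c.
Proof.
move=> phim phiK phi0 /K1E[p pK ->].
have s0 : (0 < size phi)%N by rewrite size_poly_gt0 monic_neq0.
have [j [Q [T [_ TK E lt]]]] := pseudo_division s0 phiK pK.
move: E; rewrite (monicP phim) expr1n scale1r => ->.
exists (fun i => T`_i); first by move=> i; apply: (polyOverP TK).
rewrite hornerD hornerM phi0 mulr0 add0r (@horner_coef_wide _ (size phi).-1) //.
by rewrite -ltnS prednK.
Qed.

Lemma deriv_neq0 (p : {poly L}) : (1 < size p)%N -> p^`() != 0.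
Proof.
move=> gt1; have [k sE] : exists k, size p = k.+2.
  by case: (size p) gt1 => [|[|k]] // _; exists k.
apply/eqP => /(congr1 (fun q : {poly L} => q`_k)); rewrite coef_deriv coef0 -mulr_natl => /eqP.
rewrite mulf_eq0 (negbTE (vnat_neq0 L (ltn0Sn k))) /= -[k.+1]/(k.+2.-1) -sE.
by rewrite -lead_coefE lead_coef_eq0 -size_poly_eq0 sE.
Qed.

Lemma adjoined_der x : x \in K1 -> der x \in K1.
Proof.
have hK (p : {poly L}) : p \is a polyOver K -> p.[theta] \in K1.
  by move=> pK; apply/K1E; exists p.
have dK (p : {poly L}) : p \is a polyOver K -> map_poly der p \is a polyOver K.
  by move=> pK; apply/polyOverP => i; rewrite coef_map; case: (Kmono (polyOverP pK i)).
have [mu mmu] := minpoly_ex Kalg theta; have [mum muK mu0 _] := mmu.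
have dmu0 : mu^`().[theta] != 0.
  apply/eqP => E; have := deriv_neq0 (minpoly_gt1 mmu).
  rewrite (minpoly_small mmu _ E) ?eqxx ?polyOver_deriv //.
  by apply: lt_size_deriv; apply: monic_neq0.
have dt : der theta \in K1.
  have := d_horner (@derM L) mu theta; rewrite mu0 raddf0 => /esym/eqP.
  rewrite addrC addr_eq0 => /eqP Eu.
  rewrite -[der theta](mulKf dmu0) Eu mulrN rpredN rpredM ?rpredV ?hK ?dK //.
  exact: polyOver_deriv.
move=> /K1E[p pK ->]; rewrite (d_horner (@derM L)) rpredD ?rpredM ?hK ?dK //.
exact: polyOver_deriv.
Qed.

(** Each summand c_j theta^j dominates its own derivative, and by valuation independence the whole
    sum dominates each summand. *)
Lemma adjoined_mono phi : phi \is monic -> phi \is a polyOver K -> phi.[theta] = 0 ->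
  (forall c, (forall j, c j \in K) -> forall j, (j < (size phi).-1)%N ->
     c j * theta ^+ j ≼ scomb theta (size phi).-1 c) ->
  der theta ≼ theta -> mono_subfield K1.
Proof.
move=> phim phiK phi0 orth dt x xK1; split; first exact: adjoined_der.
have [c cK ->] := adjoined_span phim phiK phi0 xK1.
rewrite {1}/scomb raddf_sum; apply: vle_sum => j _; apply: vle_trans (orth c cK j (ltn_ord j)).
rewrite /= derM; apply: vleD.
  by apply: vleM; [case: (Kmono (cK j)) | apply: vle_refl].
apply: vleM; first exact: vle_refl.
case: (val j) => [|i]; first by rewrite expr0 der1 v0le.
rewrite derX /= exprSr -mulrA; apply: vle_1M; first exact: vnat_le1.
by apply: vleM => //; apply: vle_refl.
Qed.

End Adjunction.

(** * Residual and ramified steps *)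

Section Steps.
Variables (H : oagType) (L : valuedDiffFieldType H).
Variable K : divringClosed L.
Hypothesis Kmono : mono_subfield K.
Hypothesis Kd : dhens K.
Hypothesis Kalg : forall x : L, exists2 p : {poly L}, p \is a polyOver K & p != 0 /\ p.[x] = 0.

(** That [theta] is a polynomial in [alpha] keeps K1 inside K(alpha), which makes the degree of
    [alpha] over K1 smaller than over [K]. *)
Definition has_step (alpha : L) : Prop := exists K1 theta,
  [/\ adjoined K K1 theta, theta \notin K, mono_subfield K1, dhens K1 &
      exists2 p, p \is a polyOver K & theta = p.[alpha]].

Lemma has_step_horner (g : {poly L}) alpha : g \is a polyOver K ->
  has_step g.[alpha] -> has_step alpha.
Proof.
move=> gK [K1 [theta [K1E tK K1m K1d [q qK tE]]]]; exists K1, theta; split=> //.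
by exists (q \Po g); rewrite ?polyOver_comp // horner_comp.
Qed.

Lemma horner_close (p : {poly L}) (x y : L) : p \is a polyOver (vint_in K) ->
  x ≼ 1 -> y ≼ 1 -> x - y ≺ 1 -> p.[x] - p.[y] ≺ 1.
Proof.
move=> pO x1 y1 xy; rewrite !horner_coef -sumrB; apply: vlt_sum; first exact: oner_neq0.
move=> i _; rewrite -mulrBr; apply: vlt_1M; first by case/vint_inP: (polyOverP pO i).
elim: (val i) => [|k IH]; first by rewrite !expr0 subrr v0lt1.
have -> : x ^+ k.+1 - y ^+ k.+1 = (x - y) * x ^+ k + y * (x ^+ k - y ^+ k).
  by rewrite !exprS; ring.
by apply: vltD; [apply: vlt_M1 => //; apply: vleX1 | apply: vlt_1M].
Qed.

(* theta is the root near [u] of a lift phi of the minimal polynomial of the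
   residue of [u]; minimality makes 1, ..., theta^(f-1) valuation independent. *)
Lemma step_residual (u : L) : u ≼ 1 -> 1 ≼ u -> (forall k, k \in K -> ~~ (u - k ≺ 1)) -> has_step u.
Proof.
move=> u1 u1' far.
have [mu mmu] := minpoly_ex Kalg u; have [mum muK mu0 _] := mmu.
have muO := minpoly_vint Kmono Kd mmu u1.
pose Pr k := `[< exists phi : {poly L}, [/\ phi \is monic, phi \is a polyOver (vint_in K),
  phi.[u] ≺ 1 & size phi = k] >].
have exP : exists k, Pr k.
  by exists (size mu); apply/asboolP; exists mu; rewrite mu0 v0lt1.
case: (ex_minnP exP) => sz /asboolP[phi [phim phiO phiu <-]] phimin {sz}.
have phiK : phi \is a polyOver K.
  by apply/polyOverP => i; case/vint_inP: (polyOverP phiO i).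
have {}phimin q : q \is a polyOver (vint_in K) -> 1 ≼ lead_coef q -> q.[u] ≺ 1 ->
    (size phi <= size q)%N.
  move=> qO lq qu; have lq0 : lead_coef q != 0 by apply: vle_neq0 lq (oner_neq0 _).
  have lqV : (lead_coef q)^-1 \in vint_in K.
    have [lK _] := vint_inP _ _ (polyOverP qO (size q).-1).
    by apply/vint_inP; rewrite rpredV lK -[_^-1]mul1r vdiv_le // mul1r.
  rewrite -(size_scale q (invr_neq0 lq0)); apply: phimin; apply/asboolP.
  exists ((lead_coef q)^-1 *: q); split=> //.
  - by rewrite monicE lead_coefZ mulVf.
  - by apply: polyOverZ.
  by rewrite hornerZ; apply: vlt_1M => //; case/vint_inP: lqV.
have gt1 : (1 < size phi)%N.
  rewrite ltnNge; apply/negP => le1; have E := size1_polyC le1.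
  have : lead_coef phi = phi`_0 by rewrite lead_coefE E size_polyC; case: eqP.
  rewrite (monicP phim) => c1; move: phiu; rewrite E -c1 hornerC vlt_irr //.
set f := (size phi).-1; have fE : size phi = f.+1 by rewrite prednK // ltnW.
have f0 : (0 < f)%N by rewrite -ltnS -fE.
have dphiO : phi^`() \is a polyOver (vint_in K) by apply: polyOver_deriv.
(* Separability in residue characteristic 0: the derivative has smaller degree and a unit as leading
   coefficient, so minimality of [phi] forbids an infinitesimal value. *)
have dphiu : 1 ≼ phi^`().[u].
  rewrite -vnlt; apply/negP => lt.
  have dl : phi^`()`_f.-1 = f%:R.
    rewrite coef_deriv prednK //; have := monicP phim.
    by rewrite lead_coefE fE /= => ->.
  have sd : size phi^`() = f.
    apply/eqP; rewrite eqn_leq -ltnS -fE lt_size_deriv ?monic_neq0 //=.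
    rewrite -[X in (X <= _)%N](prednK f0); rewrite ltnNge; apply/negP => le.
    by have := vnat_neq0 L f0; rewrite -dl nth_default ?eqxx.
  have := phimin phi^`() dphiO; rewrite lead_coefE sd dl fE ltnn.
  by move=> /(_ (vnat_ge1 L f0) lt).
pose n := (size mu).-1.
have red := sring_reduce Kmono Kd mmu u1.
have uA : u \in sring K u n by have := red 1%N; rewrite expr1.
have phiA : phi \is a polyOver (sring K u n).
  by apply/polyOverP => i; apply: (sring_vint red); apply: (polyOverP phiO).
have [t [tA t0 tu]] := root_lift Kmono Kd Kalg mmu u1 phiA uA phiu dphiu.
have t1 : t ≼ 1 by apply: (sball_le u1 tA).
have tge : 1 ≼ t.
  by rewrite -(subrK u t) addrC vle_addr_iff.
have tK : t \notin K.
  by apply/negP => /far; rewrite vlt_subC tu.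
have orth c : (forall j, c j \in K) -> forall j, (j < f)%N -> c j * t ^+ j ≼ scomb t f c.
  move=> cK j ltj; apply: (@vle_trans _ _ (c j)).
    by apply: vle_M1; [apply: vle_refl | apply: vleX1].
  have [cj0|cj0] := eqVneq (c j) 0; first by rewrite cj0 v0le.
  have [|i [lti ci0 cmax clast]] := @vle_last_max _ L f c; first by exists j.
  apply: (vle_trans (cmax j ltj)); rewrite -vnlt; apply/negP => lt.
  (* The combination is scaled to dominant coefficient 1 and cut after it. The part cut off has
     infinitesimal coefficients, so [q] has leading coefficient 1, an infinitesimal value at [u],
     and smaller degree than [phi]. *)
  pose q := \poly_(k < i.+1) (c k / c i).
  pose q' := \poly_(k < f) (c k / c i).
  have q'O : q' \is a polyOver (vint_in K).
    apply/polyOverP => k; rewrite coef_poly; case: ifP => [ltk|_]; last exact: rpred0.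
    by apply/vint_inP; split; [rewrite rpred_div | apply: vle_div1; apply: cmax].
  have qO : q \is a polyOver (vint_in K).
    apply/polyOverP => k; rewrite coef_poly; case: ltnP => [ltk|_]; last exact: rpred0.
    have := polyOverP q'O k; rewrite coef_poly (leq_ltn_trans _ lti) //.
  have q't : q'.[t] ≺ 1.
    rewrite horner_poly; have -> : \sum_(k < f) c k / c i * t ^+ k = scomb t f c / c i.
      by rewrite /scomb mulr_suml; apply: eq_bigr => k _; rewrite mulrAC.
    exact: vlt_div1.
  have q'u : q'.[u] ≺ 1.
    by apply: vlt_swap q't; apply: horner_close => //; rewrite vlt_subC.
  have qu : q.[u] ≺ 1.
    apply: vlt_swap q'u; rewrite -hornerN -hornerD horner_coef.
    apply: vlt_sum; first exact: oner_neq0.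
    move=> k _; apply: vlt_M1; last exact: vleX1.
    rewrite coefB !coef_poly ltnS; case: (leqP k i) => le.
      by rewrite (leq_ltn_trans le lti) subrr v0lt1.
    case: ltnP => ltk; last by rewrite subrr v0lt1.
    by rewrite sub0r vltN; apply: vlt_div1; apply: clast; rewrite le.
  have sq : size q = i.+1 by rewrite size_poly_eq // divff ?oner_neq0.
  have := phimin q qO; rewrite lead_coefE sq coef_poly ltnSn divff // fE.
  move=> /(_ (vle_refl _) qu); rewrite ltnS => le.
  by rewrite ltnNge le in lti.
have dt : der t ≼ t.
  have dpt : 1 ≼ phi^`().[t].
    by rewrite -(subrK phi^`().[u] phi^`().[t]) addrC vle_addr_iff //; apply: horner_close.
  have := d_horner (@derM L) phi t; rewrite t0 raddf0 => /esym/eqP.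
  rewrite addrC addr_eq0 => /eqP E; apply: vle_trans tge.
  have dp0 : phi^`().[t] != 0 by apply: vle_neq0 dpt (oner_neq0 _).
  rewrite -(vle_pM2l _ _ dp0) E mulr1 vleN; apply: vle_trans dpt.
  rewrite horner_coef; apply: vle_sum => k _; apply: vle_M1; last exact: vleX1.
  rewrite coef_map /=; have /vint_inP[pK p1] := polyOverP phiO k.
  by case: (Kmono pK) => _ h; apply: vle_trans p1.
have [K1 K1E] := adjoin_exists Kalg t.
have K1m := adjoined_mono Kmono Kalg K1E phim phiK t0 orth dt.
exists K1, t; split=> //.
- apply: (dhens_residual (adjoined_sub K1E) Kmono K1m Kd (adjoined_gen K1E) _ orth t1 tge).
  by move=> x; apply: (adjoined_span K1E phim phiK t0).
move: tA => /sballP[c [cK ->]]; exists (\poly_(k < n) c k).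
  by apply/polyOverP => k; rewrite coef_poly; case: ifP => _; [case/vballP: (cK k) | apply: rpred0].
by rewrite horner_poly.
Qed.


End Steps.

Section RamifiedStep.
Variables (H : oagType) (L : valuedDiffFieldType H).
Variable K : divringClosed L.
Hypothesis Kmono : mono_subfield K.
Hypothesis Kd : dhens K.
Hypothesis Kalg : forall x : L, exists2 p : {poly L}, p \is a polyOver K & p != 0 /\ p.[x] = 0.

Lemma vle_dominant n (F : nat -> L) i : (i < n)%N -> F i != 0 ->
  (forall j, (j < n)%N -> j != i -> F j ≺ F i) -> F i ≼ \sum_(j < n) F j.
Proof.
move=> lti Fi0 h; rewrite (bigD1 (Ordinal lti)) //=; apply: vle_addr.
by apply: vlt_sum => // j ji; apply: h.
Qed.

Definition vsim (x y : L) : bool := (x ≼ y) && (y ≼ x).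

Lemma vsim_shift (t c d : L) i j : (j < i)%N -> t != 0 -> c != 0 ->
  vsim (c * t ^+ i) (d * t ^+ j) -> vsim (t ^+ (i - j)) (d / c).
Proof.
move=> lt t0 c0; rewrite /vsim -{1 2}(subnK (ltnW lt)) exprD !mulrA.
rewrite !(vle_pM2r _ _ (expf_neq0 j t0)) ![c * _]mulrC => /andP[h1 h2].
by rewrite vdiv_ge // vdiv_le // h1.
Qed.

(* Let N be minimal with v(alpha^N) in v(K), p a prime divisor of N, and
   a = alpha^(N/p). If the unit a^p / c is not close to an element of [K], it
   gives a residual step; otherwise it is k (1 + eps), and a divided by a p-th
   root of 1 + eps has its p-th power in [K]. *)
Lemma step_ramified alpha : (forall c, c \in K -> ~~ vsim alpha c) -> has_step K alpha.
Proof.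
move=> ram; have al0 : alpha != 0.
  by apply: contraNneq (ram 0 (rpred0 _)) => ->; rewrite /vsim vle_refl.
pose Pr N := (0 < N)%N && `[< exists2 c, c \in K & vsim (alpha ^+ N) c >].
have exP : exists N, Pr N.
  have [p pK [p0 pa]] := Kalg alpha; pose F i := p`_i * alpha ^+ i.
  (* In a vanishing sum the largest size is attained at least twice. Two such terms show that some
     power of [alpha] has its valuation in v(K). *)
  have [|i [lti Fi0 Fmax Flast]] := @vle_last_max _ L (size p) F.
    exists (size p).-1; first by rewrite prednK // size_poly_gt0.
    by rewrite mulf_neq0 ?expf_neq0 // -lead_coefE lead_coef_eq0.
  have [[j ltj Fj]|no] := EM (exists2 j, (j < i)%N & F i ≼ F j); last first.
    have : F i ≼ \sum_(j < size p) F j.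
      apply: vle_dominant => // j ltj ji; case: (ltngtP j i) => [lt|gt|/eqP].
      - by rewrite -[_ ≺ _]negbK vnlt; apply/negP => le; apply: no; exists j.
      - by apply: Flast; rewrite gt.
      - by rewrite (negbTE ji).
    by rewrite -horner_coef pa vle0 (negbTE Fi0).
  exists (i - j)%N; rewrite /Pr subn_gt0 ltj; apply/asboolP.
  have pi0 : p`_i != 0 by apply: contraNneq Fi0 => pi0; rewrite /F pi0 mul0r.
  exists (p`_j / p`_i); first by rewrite rpred_div // (polyOverP pK).
  by apply: vsim_shift => //; rewrite /vsim Fj Fmax // (ltn_trans ltj).
case: (ex_minnP exP) => N /andP[N0 /asboolP[c cK aN]] Nmin.
have c0 : c != 0.
  by apply: contraTneq aN => ->; rewrite /vsim vle0 expf_eq0 (negbTE al0) andbF.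
have N1 : (1 < N)%N.
  rewrite ltn_neqAle N0 andbT; apply/eqP => N1; move: (ram c cK).
  by rewrite -(expr1 alpha) N1 aN.
have pp := pdiv_prime N1; set p := pdiv N in pp; have p0 := prime_gt0 pp.
pose e := (N %/ p)%N; have eN : (e * p = N)%N by apply: divnK; apply: pdiv_dvd.
have e0 : (0 < e)%N by move: N0; rewrite -eN muln_gt0 => /andP[].
pose a := alpha ^+ e; have a0 : a != 0 by rewrite expf_neq0.
have aram j d : (0 < j < p)%N -> d \in K -> ~~ vsim (a ^+ j) d.
  move=> /andP[j0 jp] dK; apply/negP => h; have : (N <= e * j)%N.
    by apply: Nmin; rewrite /Pr muln_gt0 e0 j0; apply/asboolP; exists d; rewrite // exprM.
  by rewrite -eN leq_pmul2l // leqNgt jp.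
pose w := a ^+ p / c; have ap : a ^+ p = alpha ^+ N by rewrite -exprM eN.
have /andP[aN1 aN2] := aN.
have w1 : w ≼ 1 by rewrite /w vdiv_le // mul1r ap.
have w1' : 1 ≼ w by rewrite /w vdiv_ge // mul1r ap.
have wE : w = (c^-1 *: 'X^N).[alpha] by rewrite hornerZ hornerXn /w ap mulrC.
have wpK : c^-1 *: 'X^N \is a polyOver K by rewrite polyOverZ ?rpredV // polyOverXn.
have [[k kK wk]|far] := EM (exists2 k, k \in K & w - k ≺ 1); last first.
  apply: (has_step_horner wpK); rewrite -wE; apply: step_residual => //.
  by move=> k kK; apply/negP => h; apply: far; exists k.
have k1 : 1 ≼ k by rewrite -(vle_addr_iff k wk) addrC subrK.
have k0 : k != 0 by apply: vle_neq0 k1 (oner_neq0 _).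
pose eps := (w - k) / k.
have eps1 : eps ≺ 1 by rewrite vdiv_lt // mul1r; apply: vlt_le_trans wk k1.
have eps1' := vlt_le eps1.
have epsE : 1 + eps = w / k by rewrite /eps; field.
have [mu mmu] := minpoly_ex Kalg eps.
pose n := (size mu).-1.
have red := sring_reduce Kmono Kd mmu eps1'.
have epsA : eps \in sball K eps n 1 by have := red 1%N; rewrite expr1.
have oneA : 1 \in sball K eps n 1 by have := red 0%N; rewrite expr0.
have A1 : 1 + eps \in sball K eps n 1 by apply: rpredD.
(* The p-th root is sought over K[eps], hence inside K(alpha); near 1 it is a simple root because p
   is a unit. *)
pose phi : {poly L} := 'X^p - (1 + eps)%:P.
have phiA : phi \is a polyOver (sring K eps n).
  apply/polyOverP => i; rewrite coefB coefXn coefC /sring; apply: rpredB.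
    by case: eqP => _; rewrite ?rpred0.
  by case: eqP => _; rewrite ?rpred0.
have phi1 : phi.[1] ≺ 1.
  by rewrite hornerD hornerN hornerXn hornerC expr1n opprD addNKr vltN.
have dphi1 : 1 ≼ phi^`().[1].
  by rewrite derivB derivC subr0 derivXn hornerMn hornerXn expr1n vnat_ge1.
have [t [tA t0 t1]] := root_lift Kmono Kd Kalg mmu eps1' phiA oneA phi1 dphi1.
have tle : t ≼ 1 by apply: (sball_le eps1' tA).
have tge : 1 ≼ t by rewrite -(vle_addr_iff t (_ : - (t - 1) ≺ 1)) ?vltN // opprB addrC subrK vle_refl.
have tn0 : t != 0 by apply: vle_neq0 tge (oner_neq0 _).
have tp : t ^+ p = w / k.
  by move/eqP: t0; rewrite hornerD hornerN hornerXn hornerC subr_eq0 epsE => /eqP.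
pose theta := a / t; have th0 : theta != 0 by rewrite mulf_neq0 ?invr_neq0.
have w0 : w != 0 by apply: vle_neq0 w1' (oner_neq0 _).
have thp : theta ^+ p = c * k.
  rewrite /theta exprMn exprVn tp; have -> : a ^+ p = w * c by rewrite divfK.
  by field; rewrite ?k0 ?w0.
have thK : theta ^+ p \in K by rewrite thp rpredM.
have tram j d : (0 < j < p)%N -> d \in K -> ~~ vsim (theta ^+ j) d.
  move=> jp dK; apply: contra (aram j d jp dK) => /andP[h1 h2].
  have aE : a ^+ j = theta ^+ j * t ^+ j by rewrite -exprMn divfK.
  have tj0 : t ^+ j != 0 by rewrite expf_neq0.
  rewrite /vsim; apply/andP; split.
    by rewrite aE; apply: vle_M1 => //; apply: vleX1.
  apply: (vle_trans h2); rewrite /theta exprMn exprVn vdiv_le //.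
  by rewrite -{1}[a ^+ j]mulr1; apply: vleM; [apply: vle_refl | apply: vgeX1].
have orth c' : (forall j, c' j \in K) -> forall j, (j < p)%N ->
    c' j * theta ^+ j ≼ scomb theta p c'.
  move=> c'K j ltj; pose F i := c' i * theta ^+ i.
  have [Fj0|Fj0] := eqVneq (F j) 0; first by rewrite -/(F j) Fj0 v0le.
  have [|i [lti Fi0 Fmax Flast]] := @vle_last_max _ L p F; first by exists j.
  apply: (vle_trans (Fmax j ltj)); apply: (vle_dominant (F := F)) => // l ltl li.
  case: (ltngtP l i) => [lt|gt|/eqP]; last by rewrite (negbTE li).
    rewrite -[_ ≺ _]negbK vnlt; apply/negP => le.
    have ci0 : c' i != 0 by apply: contraNneq Fi0 => ci0; rewrite /F ci0 mul0r.
    have ilp : (0 < i - l < p)%N by rewrite subn_gt0 lt (leq_ltn_trans (leq_subr _ _)).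
    have /negP[] := tram _ _ ilp (rpred_div (c'K l) (c'K i)).
    by apply: vsim_shift => //; rewrite /vsim le Fmax.
  by apply: Flast; rewrite gt.
pose phi2 : {poly L} := 'X^p - (theta ^+ p)%:P.
have phi2m : phi2 \is monic by apply: monicXnsubC.
have phi2K : phi2 \is a polyOver K by rewrite rpredB ?polyOverXn ?polyOverC.
have phi20 : phi2.[theta] = 0 by rewrite hornerD hornerN hornerXn hornerC subrr.
have sE : (size phi2).-1 = p by rewrite size_XnsubC.
(* In [K] the derivative of theta^p is dominated by theta^p; the factor theta^(p-1) cancels and p is
   a unit. *)
have dth : der theta ≼ theta.
  have [_ dg] := Kmono thK; have pn0 := vnat_neq0 L p0.
  have tpn0 : theta ^+ p.-1 != 0 by rewrite expf_neq0.
  by move: dg; rewrite derX -mulrA vle_natM // -[X in _ ≼ _ ^+ X](prednK p0) exprSr vle_pM2l.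
have [K1 K1E] := adjoin_exists Kalg theta.
have K1m : mono_subfield K1.
  by apply: (adjoined_mono Kmono Kalg K1E phi2m phi2K phi20) => //; rewrite sE.
exists K1, theta; split=> //.
- by apply/negP => /(tram 1%N); rewrite expr1 /vsim vle_refl => /(_ (prime_gt1 pp)).
- apply: (dhens_ramified (adjoined_sub K1E) Kmono K1m Kd (adjoined_gen K1E) _ orth pp th0 thK).
  by move=> x /(adjoined_span K1E phi2m phi2K phi20); rewrite sE.
(* Membership in K2 = K(alpha) supplies the polynomial expressing [theta] in [alpha]. *)
have [K2 K2E] := adjoin_exists Kalg alpha.
apply/K2E; have KK2 := adjoined_sub K2E; have alK2 := adjoined_gen K2E.
have aK2 : a \in K2 := rpredX e alK2.
have wK2 : w \in K2 by apply: rpred_div; [apply: rpredX | apply: KK2].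
have epsK2 : eps \in K2 by apply: rpred_div; [apply: rpredB => //|]; apply: KK2.
apply: rpred_div => //.
move: tA => /sballP[d [dK ->]]; apply: rpred_sum => i _; rewrite rpredM ?rpredX //.
by apply: KK2; case/vballP: (dK i).
Qed.

End RamifiedStep.

(** * Reaching given elements by towers of steps *)

Section Tower.
Variables (H : oagType) (L : valuedDiffFieldType H).

Lemma expr_linear (a b : L) i (l := a *: 'X + b%:P) :
  [/\ (size (l ^+ i)%R <= i.+1)%N, (l ^+ i)`_i = a ^+ i &
      (l ^+ i.+1)`_i = i.+1%:R * a ^+ i * b].
Proof.
have lS k j : (l ^+ k.+1)`_j = a * (if j == 0%N then 0 else (l ^+ k)`_j.-1) + (l ^+ k)`_j * b.
  by rewrite exprSr mulrDr coefD -scalerAr coefZ coefMX coefMC.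
elim: i => [|i [IH1 IH2 IH3]].
  split; first by rewrite expr0 size_poly1.
    by rewrite !expr0 coef1.
  by rewrite lS expr0 mulr0 add0r coef1 !mul1r.
have top : (l ^+ i)`_i.+1 = 0 by apply/leq_sizeP: IH1 => //.
have top2 : (l ^+ i.+1)`_i.+1 = a ^+ i.+1.
  by rewrite lS /= IH2 top mul0r addr0 exprS.
split=> //.
  apply/leq_sizeP => j lt; rewrite lS; case: j lt => // j; rewrite ltnS => lt /=.
  by rewrite !(leq_sizeP _ _ IH1) ?leqW // mulr0 mul0r addr0.
by rewrite lS /= IH3 top2 -[i.+2%:R]natr1 exprS; ring.
Qed.

(** How the trace, read off the coefficient below the top, transforms under an affine
    substitution. *)
Lemma comp_linear (q : {poly L}) (a b : L) m (l := a *: 'X + b%:P) : size q = m.+2 ->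
  (q \Po l)`_m = a ^+ m * (q`_m + m.+1%:R * b * q`_m.+1).
Proof.
move=> sq; rewrite coef_comp_poly sq !big_ord_recr /= big1 => [|j _]; last first.
  have [h _ _] := expr_linear a b j.
  by rewrite [X in _ * X]nth_default ?mulr0 // (leq_trans h).
have [_ -> ->] := expr_linear a b m; ring.
Qed.

Section Step.
Variable K : divringClosed L.
Hypothesis Kmono : mono_subfield K.
Hypothesis Kd : dhens K.
Hypothesis Kalg : forall x : L, exists2 p : {poly L}, p \is a polyOver K & p != 0 /\ p.[x] = 0.

(* The trace of [alpha - b] vanishes, so it is not approximated to first order
   in [K]: a minimal polynomial of an infinitesimal has infinitesimal trace. *)
Lemma far_translate alpha : exists2 b, b \in K &
  forall c, c \in K -> ~~ (alpha - b - c ≺ alpha - b).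
Proof.
have [p mp] := minpoly_ex Kalg alpha; have [pm pK pa _] := mp.
have [m sp] : exists m, size p = m.+2.
  by case: (size p) (minpoly_gt1 mp) => [|[|m]] // _; exists m.
have m0 := vnat_neq0 L (ltn0Sn m).
(* [p] has degree m + 1, so this is the trace of [alpha] divided by its degree. *)
exists (- p`_m / m.+1%:R); first by rewrite rpred_div ?rpred_nat // rpredN (polyOverP pK).
set b := _ / _; move=> c cK; apply/negP => lt.
have bK : b \in K by rewrite rpred_div ?rpred_nat // rpredN (polyOverP pK).
have bE : p`_m = - b * m.+1%:R by rewrite /b mulNr divfK ?opprK.
clearbody b.
have c0 : c != 0.
  by apply: contraTneq lt => ->; rewrite subr0 vlt_irr.
pose eps := (alpha - b - c) / c.
have eps1 : eps ≺ 1.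
  rewrite /eps vdiv_lt // mul1r; apply: vlt_le_trans (lt) _.
  by move: lt; rewrite vlt_subC => /vle_addr; rewrite [_ + (c - _)]addrC subrK.
have [q mq] := minpoly_ex Kalg eps; have [qm qK qe _] := mq.
pose l : {poly L} := c^-1 *: 'X + (- (b + c) / c)%:P.
pose l' : {poly L} := c *: 'X + (b + c)%:P.
have sl (a d : L) : a != 0 -> size (a *: 'X + d%:P)%R = 2%N.
  by move=> a0; rewrite size_polyDl size_scale // size_polyX // size_polyC ltnS; case: eqP.
have sl1 : size l = 2%N by rewrite sl ?invr_neq0.
have sl2 : size l' = 2%N by rewrite sl.
have lE : l.[alpha] = eps by rewrite !hornerE /eps; field.
have l'E : l'.[eps] = alpha.
  by rewrite hornerD hornerZ hornerX hornerC /eps [c * _]mulrC divfK //; ring.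
have lK : l \is a polyOver K.
  by rewrite rpredD // ?polyOverZ ?polyOverX ?rpredV // polyOverC rpred_div // rpredN rpredD.
have l'K : l' \is a polyOver K by rewrite rpredD // ?polyOverZ ?polyOverX // polyOverC rpredD.
have sq : size q = m.+2.
  apply/eqP; rewrite -sp eqn_leq; apply/andP; split.
    have [_ _ _ qmin] := mq; rewrite -(size_comp_poly2 p sl2); apply: qmin.
    - exact: polyOver_comp.
    - by rewrite horner_comp l'E.
    by rewrite -size_poly_eq0 size_comp_poly2 // sp.
  have [_ _ _ pmin] := mp; rewrite -(size_comp_poly2 q sl1); apply: pmin.
  - exact: polyOver_comp.
  - by rewrite horner_comp lE.
  by rewrite -size_poly_eq0 size_comp_poly2 // size_poly_eq0 monic_neq0.
have q1 : q`_m.+1 = 1 by have := monicP qm; rewrite lead_coefE sq.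
have p1 : p`_m.+1 = 1 by have := monicP pm; rewrite lead_coefE sp.
have qtop : (q \Po l)`_m.+1 = c^-1 ^+ m.+1.
  rewrite coef_comp_poly sq big_ord_recr /= q1 mul1r big1 ?add0r => [|j _].
    by have [_ -> _] := expr_linear c^-1 (- (b + c) / c) m.+1.
  have [h _ _] := expr_linear c^-1 (- (b + c) / c) j.
  by rewrite [X in _ * X]nth_default ?mulr0 // (leq_trans h).
have E : q \Po l - c^-1 ^+ m.+1 *: p = 0.
  apply: (minpoly_small mp).
  - by rewrite rpredB ?polyOver_comp ?polyOverZ // rpredX // rpredV.
  - by rewrite hornerD hornerN hornerZ pa mulr0 horner_comp lE qe subrr.
  rewrite sp ltnS; apply/leq_sizeP => j; rewrite leq_eqVlt => /predU1P[<-|lt'].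
    by rewrite coefB coefZ qtop p1 mulr1 subrr.
  rewrite coefB coefZ !nth_default ?mulr0 ?subrr ?sp //.
  by rewrite size_comp_poly2 // sq.
have := minpoly_vlt Kmono Kd mq eps1 (i := m); rewrite sq ltnSn => /(_ isT).
(* Since alpha - b = c (1 + eps) has trace zero, the trace of [eps] is -(m + 1), a unit, although
   [eps] is infinitesimal. *)
suff -> : q`_m = m.+1%:R by rewrite /vlt vnat_ge1.
move/eqP: E; rewrite subr_eq0 => /eqP/(congr1 (fun r : {poly L} => r`_m)).
rewrite comp_linear // q1 coefZ.
rewrite bE exprSr -[X in _ = X]mulrA => E1.
have E2 := mulfI (expf_neq0 m (invr_neq0 c0)) E1.
transitivity (c^-1 * (- b * m.+1%:R) - m.+1%:R * (- (b + c) / c) * 1); first by rewrite -E2 addrK.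
by field.
Qed.

(** The translate beta is not approximated in [K] to first order. If it has the valuation of some c
    in [K], the unit beta / c is therefore not close to [K] and the residual step applies; otherwise
    the ramified one does. *)
Lemma tower_step alpha : alpha \notin K -> has_step K alpha.
Proof.
move=> aK; have [b bK far] := far_translate alpha.
have gK : 'X - b%:P \is a polyOver K by rewrite rpredB ?polyOverX ?polyOverC.
apply: (has_step_horner gK); rewrite hornerXsubC; set beta := alpha - b in far *.
have b0 : beta != 0.
  by apply: contraNneq aK => /eqP; rewrite subr_eq0 => /eqP ->.
have [[c cK /andP[bc cb]]|no] := EM (exists2 c, c \in K & vsim beta c); last first.
  apply: step_ramified => // c cK; apply/negP => h; apply: no; by exists c.
have c0 : c != 0 by apply: vle_neq0 bc b0.
have hK : c^-1 *: 'X \is a polyOver K by rewrite polyOverZ ?polyOverX ?rpredV.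
apply: (has_step_horner hK); rewrite hornerZ hornerX mulrC; apply: step_residual => //.
- by rewrite vdiv_le // mul1r.
- by rewrite vdiv_ge // mul1r.
move=> k kK; apply/negP => h; have /negP[] := far (k * c) (rpredM kK cK).
apply: vlt_le_trans cb; rewrite -[beta](divfK c0) -mulrBl -[X in _ ≺ X]mul1r.
by rewrite vlt_pM2r.
Qed.

End Step.

Lemma tower_element (K : divringClosed L) alpha : mono_subfield K -> dhens K ->
  (forall x : L, exists2 p : {poly L}, p \is a polyOver K & p != 0 /\ p.[x] = 0) ->
  exists K' : divringClosed L,
    [/\ {subset K <= K'}, mono_subfield K', dhens K' & alpha \in K'].
Proof.
move=> Km Kd Kalg; have [p mp] := minpoly_ex Kalg alpha.
have [n] := ubnP (size p); elim: n K p Km Kd Kalg mp => // n IH K p Km Kd Kalg mp; rewrite ltnS => le.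
have [aK|aK] := boolP (alpha \in K); first by exists K; split.
have [K1 [theta [K1E tK K1m K1d [g gK tE]]]] := tower_step Km Kd Kalg aK.
have KK1 := adjoined_sub K1E.
have KK1p (q : {poly L}) : q \is a polyOver K -> q \is a polyOver K1.
  by move=> qK; apply/polyOverP => i; apply: KK1; apply: (polyOverP qK).
have K1alg x : exists2 q : {poly L}, q \is a polyOver K1 & q != 0 /\ q.[x] = 0.
  by have [q qK hq] := Kalg x; exists q => //; apply: KK1p.
have [p1 mp1] := minpoly_ex K1alg alpha.
have [|K' [K1K' K'm K'd aK']] := IH K1 p1 K1m K1d K1alg mp1; last first.
  by exists K'; split=> // x /KK1/K1K'.
apply: leq_trans le; have [pm pK pa _] := mp; have gt1 := minpoly_gt1 mp.
have [j [Q [T [QK TK E lt]]]] := pseudo_division (ltnW gt1) pK gK.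
have Ta : T.[alpha] = theta.
  move: E; rewrite (monicP pm) expr1n scale1r => E.
  by rewrite tE E hornerD hornerM pa mulr0 add0r.
have [_ _ _ p1min] := mp1.
(* [T] is the reduced polynomial expressing [theta] in [alpha]. Over K1 the difference annihilates
   [alpha]; it is nonzero because otherwise [theta] would be a coefficient of [T], hence in [K]. *)
apply: (@leq_ltn_trans (size (T - theta%:P))).
  apply: p1min.
  - by apply: rpredB; [apply: KK1p | rewrite polyOverC; apply: (adjoined_gen K1E)].
  - by rewrite hornerD hornerN hornerC Ta subrr.
  rewrite subr_eq0; apply: contraNneq tK => TE.
  by have := polyOverP TK 0%N; rewrite TE coefC eqxx.
apply: leq_ltn_trans (size_polyD _ _) _; rewrite size_polyN gtn_max lt.
by apply: leq_ltn_trans gt1; rewrite size_polyC; case: eqP.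
Qed.

Lemma tower_seq (K : divringClosed L) (s : seq L) : mono_subfield K -> dhens K ->
  (forall x : L, exists2 p : {poly L}, p \is a polyOver K & p != 0 /\ p.[x] = 0) ->
  exists K' : divringClosed L,
    [/\ {subset K <= K'}, mono_subfield K', dhens K' & {subset s <= K'}].
Proof.
move=> Km Kd Kalg; elim: s => [|x s [K1 [KK1 K1m K1d sK1]]]; first by exists K; split.
have K1alg y : exists2 q : {poly L}, q \is a polyOver K1 & q != 0 /\ q.[y] = 0.
  have [q qK hq] := Kalg y; exists q => //.
  by apply/polyOverP => i; apply: KK1; apply: (polyOverP qK).
have [K2 [K12 K2m K2d xK2]] := tower_element x K1m K1d K1alg.
exists K2; split=> // [y /KK1/K12 //|y].
by rewrite inE => /predU1P[->|/sK1/K12].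
Qed.

End Tower.

(** * Transfer between the base field, its image and the residue-field formulation *)

Section Transfer.

Lemma mmap_map_mpoly (R S : comNzRingType) (f : {rmorphism R -> S}) n (v : 'I_n -> S) p :
  mmap f v p = (map_mpoly f p).@[v].
Proof.
rewrite [in RHS](mpolyE p) [map_mpoly _ _]raddf_sum [RHS](raddf_sum (meval v)).
by apply: eq_bigr => m _; rewrite /= map_mpolyZ map_mpolyX mevalZ mevalX.
Qed.

Lemma msize_eq2 (R : nzRingType) n (p : {mpoly R[n]}) : msize p = 2%N <->
  (forall m, (1 < mdeg m)%N -> p@_m = 0) /\ exists i : 'I_n, p@_U_(i) != 0.
Proof.
split=> [sp|[h [i pi]]].
  split=> [m lt|]; first by apply: memN_msupp_eq0; apply: msize_mdeg_ge; rewrite sp.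
  have p0 : p != 0 by rewrite -msize_poly_eq0 sp.
  have /eqP := mlead_deg p0; rewrite sp eqSS => /mdeg1P[i /eqP mE].
  by exists i; rewrite -mE mleadc_eq0.
apply/eqP; rewrite eqn_leq; apply/andP; split; last first.
  by rewrite -(mdeg1 i); apply: msize_mdeg_lt; rewrite mcoeff_msupp.
rewrite msizeE big_seq; apply: (big_ind (fun k => (k <= 2)%N)) => // [a b|m]; first by rewrite geq_max => -> ->.
by rewrite mcoeff_msupp ltnS leqNgt; apply: contraNN => /h ->.
Qed.

Variables (G : oagType) (F : valuedDiffFieldType G).

Lemma quasilinear_reduction n (P : {mpoly (valring F)[n]}) (K : divringClosed F) :
  (forall m, \val P@_m \in K) ->
  msize (diffpoly_reduction P) = 2%N -> quasilinear K (map_mpoly (\val : valring F -> F) P).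
Proof.
move=> PK; have res0 m : ((diffpoly_reduction P)@_m == 0) = (\val P@_m ≺ 1).
  by rewrite mcoeff_map_mpoly res_eq0.
move=> /msize_eq2[h1 [i hi]]; split=> [m|m lt|]; rewrite ?mcoeff_map_mpoly.
- by apply/vint_inP; split; [apply: PK | rewrite -vint_valring; apply: valP].
- by rewrite -res0 h1.
by exists i; rewrite mcoeff_map_mpoly -vnlt -res0.
Qed.

Lemma diffpoly_evalE n (P : {mpoly (valring F)[n]}) y :
  diffpoly_eval P y = deval (map_mpoly (\val : valring F -> F) P) y.
Proof. by rewrite /deval -mmap_map_mpoly. Qed.

Variables (H : oagType) (L : valuedDiffFieldType H) (i : vdf_extension F L).

Lemma ext_vle x y : (i x ≼ i y) = (x ≼ y).
Proof.
rewrite /vle !ext_vval; case: (vval x) (vval y) => [a|] [b|] //=.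
exact: (ext_vgrp_le i).
Qed.

Lemma ext_image : exists K : divringClosed L, forall x, (x \in K) <-> (exists f, i f = x).
Proof.
pose E : {pred L} := fun x => `[< exists f, i f = x >].
have [|K KE] := @pack_divring _ L E.
  split; first by apply/asboolP; exists 1; rewrite rmorph1.
    by move=> _ _ /asboolP[f <-] /asboolP[g <-]; apply/asboolP; exists (f - g); rewrite rmorphB.
  by move=> _ _ /asboolP[f <-] /asboolP[g <-]; apply/asboolP; exists (f / g); rewrite fmorph_div.
by exists K => x; rewrite KE; split=> /asboolP.
Qed.

Lemma ext_jet k f : jet k (i f) = i (jet k f).
Proof. by elim: k => //= k IH; rewrite /jet /= -/(jet k _) IH ext_der. Qed.

(** The embedding preserves and reflects dominance, so a quasilinear polynomial over the image is
    the image of one over the valuation ring of [F] whose reduction has degree 1. *)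
Lemma ext_base (K : divringClosed L) : (forall x, (x \in K) <-> (exists f, i f = x)) ->
  monotone_der F -> diff_henselian F -> mono_subfield K /\ dhens K.
Proof.
move=> KE Fm [_ Fh]; split.
  move=> _ /KE[f <-]; rewrite -ext_der ext_vle; split; first by apply/KE; exists (der f).
  exact: Fm.
move=> n P Pq; have [PO _ _] := Pq.
have exq m : exists q : valring F, i (\val q) = P@_m.
  have /vint_inP[/KE[f fE] f1] := PO m; have fO : f \in @valring_pred G F.
    by rewrite vint_valring -ext_vle fE rmorph1.
  by exists (ValRing fO).
have [q qE] := choice exq.
pose Q : {mpoly (valring F)[n]} := \sum_(m <- msupp P) q m *: 'X_[m].
pose iv : {rmorphism valring F -> L} := i \o (\val : valring F -> F).
have QP : map_mpoly iv Q = P.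
  rewrite [RHS]mpolyE [map_mpoly _ _]raddf_sum; apply: eq_bigr => m _.
  by rewrite [LHS](map_mpolyZ iv (q m) 'X_[m]) map_mpolyX -qE.
have Qm m : i (\val Q@_m) = P@_m by rewrite -QP mcoeff_map_mpoly.
have [|y yE] := Fh n Q.
  apply/msize_eq2; have [_ h1 [k hk]] := Pq.
  split=> [m lt|].
    by apply/eqP; rewrite mcoeff_map_mpoly res_eq0 /vlt -ext_vle Qm rmorph1; apply: h1.
  by exists k; rewrite mcoeff_map_mpoly res_eq0 vnlt -ext_vle Qm rmorph1.
exists (i (\val y)).
  apply/vint_inP; split; first by apply/KE; exists (\val y).
  by rewrite -(rmorph1 i) ext_vle -vint_valring; apply: valP.
have := congr1 i yE; rewrite rmorph0 => <-; rewrite diffpoly_evalE /deval meval_map_mpoly.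
rewrite -{1}QP; have -> : map_mpoly iv Q = map_mpoly i (map_mpoly (\val : valring F -> F) Q).
  by apply/mpolyP => m; rewrite !mcoeff_map_mpoly.
by apply: meval_eq => k; rewrite ext_jet.
Qed.

End Transfer.

Theorem corollary1 (G : oagType) (F : valuedDiffFieldType G)
    (hmono : monotone_der F) (hhens : diff_henselian F)
    (H : oagType) (L : valuedDiffFieldType H) (i : vdf_extension F L)
    (halg : forall x : L, algebraicOver i x) :
  monotone_der L /\ diff_henselian L.
Proof.
have [K KE] := ext_image i; have [Km Kd] := ext_base KE hmono hhens.
have Kalg x : exists2 p : {poly L}, p \is a polyOver K & p != 0 /\ p.[x] = 0.
  have [p p0 px] := halg x; exists (map_poly i p).
    by apply/polyOverP => k; rewrite coef_map; apply/KE; exists p`_k.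
  by rewrite map_poly_eq0 p0; split=> //; apply/eqP.
have Lm : monotone_der L.
  move=> f; have [K' [_ K'm _ fK']] := tower_element f Km Kd Kalg.
  by case: (K'm f fK').
split=> //; split=> [f f1|n P Pred].
  have := Lm f; rewrite -/(vle (der f) f) => h.
  have e1 x : (x \in @maxideal_pred H L) = (x ≺ 1) by rewrite inE /vlt /vle /lt_oo vval1.
  by rewrite e1; apply: vle_lt_trans h _; rewrite -e1.
pose P' := map_mpoly (\val : valring L -> L) P.
(* [P] has finitely many coefficients, so a finite tower reaches a differential-henselian
   intermediate field containing all of them, and a zero there is a zero in [L]. *)
have [K' [_ K'm K'd sK']] := tower_seq [seq \val P@_m | m <- msupp P] Km Kd Kalg.
have PK' m : \val P@_m \in K'.
  have [mP|/memN_msupp_eq0->] := boolP (m \in msupp P); last by rewrite raddf0 rpred0.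
  by apply: sK'; apply: map_f.
have [y /vint_inP[_ y1] yE] := K'd _ _ (quasilinear_reduction PK' Pred).
rewrite -vint_valring in y1; exists (ValRing y1).
by rewrite diffpoly_evalE.
Qed.
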